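(* Let $T\ge 1$ be an integer, let $\mathcal{X}_1,\dots,\mathcal{X}_T$ be Polish spaces, and let $d$ be any metric on $\mathcal{X}=\prod_{t=1}^T\mathcal{X}_t$ that metrizes the product topology. Let $p>1$ and let $\mu\in\mathcal{P}(\mathcal{X})$, $x_0\in\mathcal{X}$ and $\alpha>0$ be such that $\int_{\mathcal{X}}e^{\alpha d(x,x_0)^{2p}}\,\mu(dx)<\infty$. Then for all $\nu\in\mathcal{P}(\mathcal{X})$, $$\mathcal{AW}_p(\mu,\nu)^p\le\frac{2^{p-1}(2\sqrt{T}+1)}{\sqrt{\alpha}}\left(1+\log\int_{\mathcal{X}}e^{\alpha d(x,x_0)^{2p}}\,\mu(dx)\right)^{1/2}\sqrt{2H(\nu\,|\,\mu)}.$$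
   Context: $\mathcal{P}(\mathcal{X})$ is the set of Borel probability measures on $\mathcal{X}$. Relative entropy: $H(\nu\,|\,\mu)=\int_{\mathcal{X}}\log\left(\frac{d\nu}{d\mu}\right)d\nu$ if $\nu\ll\mu$, and $H(\nu\,|\,\mu)=+\infty$ otherwise. $\mathrm{Cpl}(\mu,\nu)$ is the set of couplings of $\mu$ and $\nu$, i.e. Borel probability measures on $\mathcal{X}\times\mathcal{X}$ with marginals $\mu$ and $\nu$. A coupling $\pi\in\mathrm{Cpl}(\mu,\nu)$ is bicausal if for $(X,Y)\sim\pi$ (with $X=(X_1,\dots,X_T)$, $Y=(Y_1,\dots,Y_T)$) and every $t\in\{1,\dots,T-1\}$: under $\pi$, $(Y_1,\dots,Y_t)$ is conditionally independent of $X$ given $(X_1,\dots,X_t)$, and $(X_1,\dots,X_t)$ is conditionally independent of $Y$ given $(Y_1,\dots,Y_t)$. The set of bicausal couplings is denoted $\mathrm{Cpl}_{bc}(\mu,\nu)$. The $p$-adapted Wasserstein distance is $$\mathcal{AW}_p(\mu,\nu)=\inf_{\pi\in\mathrm{Cpl}_{bc}(\mu,\nu)}\left(\int_{\mathcal{X}\times\mathcal{X}}d(x,y)^p\,\pi(dx,dy)\right)^{1/p}.$$ *)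

(* Defs.v *)
From HB Require Import structures.
From mathcomp Require Import all_boot all_order all_algebra.
From mathcomp Require Import all_classical all_reals all_analysis.

Set Implicit Arguments.
Unset Strict Implicit.
Unset Printing Implicit Defensive.

Import Order.TTheory GRing.Theory Num.Theory.
Import numFieldNormedType.Exports.

Local Open Scope classical_set_scope.
Local Open Scope ring_scope.

Section metrics.
Context {R : realType} {S : topologicalType}.
Implicit Type d : S -> S -> R.

Definition is_metric d : Prop :=
  [/\ forall x y, 0 <= d x y,
      forall x y, d x y = 0 <-> x = y,
      forall x y, d x y = d y x &
      forall x y z, d x z <= d x y + d y z].

Definition metrizes d : Prop :=
  forall (x : S) (A : set S),
    nbhs x A <-> exists2 e : R, 0 < e & [set y | d x y < e] `<=` A.

Definition complete_metric d : Prop :=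
  forall u : nat -> S,
    (forall e : R, 0 < e ->
       exists N : nat, forall m n : nat,
         (N <= m)%N -> (N <= n)%N -> d (u m) (u n) < e) ->
    exists l : S, u n @[n --> \oo] --> l.

End metrics.

Definition polish (R : realType) (S : topologicalType) : Prop :=
  (exists2 D : set S, countable D & dense D) /\
  exists d : S -> S -> R, [/\ is_metric d, metrizes d & complete_metric d].

(* On a product type S * S' this is the Borel sigma-algebra of the product
   topology, not the library's product sigma-algebra. *)
Notation borel S := (g_sigma_algebraType (@open S)).

HB.instance Definition _ (I : Type) (X : I -> ptopologicalType) :=
  Pointed.copy (prod_topology X) (forall i, X i).

(* The value of 'd nu '/d mu where it vanishes (or is negative) is irrelevant,
   since this set is nu-null; the integral is well defined in ]-oo, +oo] because
   s ln s >= - e^-1. *)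
Definition relative_entropy (R : realType) (dsp : measure_display)
    (S : measurableType dsp) (nu mu : probability S R) : \bar R :=
  if pselect (nu `<< mu) then
    (\int[nu]_x lne (Radon_Nikodym (charge_of_finite_measure nu) mu x))%E
  else +oo%E.

Section conditional_independence.
Context {R : realType} {dsp : measure_display} {O : measurableType dsp}.
Variable P : probability O R.

(* f is a version of the conditional probability P(A | G). *)
Definition is_cond_prob (G : set (set O)) (A : set O) (f : O -> R) : Prop :=
  [/\ forall B : set R, measurable B -> G (f @^-1` B),
      P.-integrable [set: O] (EFin \o f) &
      forall C : set O, G C -> (\int[P]_(w in C) (f w)%:E = P (A `&` C))%E].

(* F1 and F2 are conditionally independent given G; the versions always exist
   and are almost surely unique, hence the choice of versions is immaterial. *)
Definition cond_indep (F1 F2 G : set (set O)) : Prop :=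
  forall A B : set O, F1 A -> F2 B ->
    exists f g h : O -> R,
      [/\ is_cond_prob G A f, is_cond_prob G B g, is_cond_prob G (A `&` B) h &
          {ae P, forall w, h w = f w * g w}].

End conditional_independence.

(* sigma(Z_1, ..., Z_t), where the coordinates are indexed from 0 by 'I_T. *)
Definition sigma_upto (O : Type) (T : nat) (X : 'I_T -> ptopologicalType)
    (Z : O -> forall i, X i) (t : nat) : set (set O) :=
  <<s \bigcup_(i in [set i : 'I_T | (i < t)%N])
        preimage_set_system [set: O] (fun w => Z w i)
          (@measurable _ (borel (X i))) >>.

Section couplings.
Context {R : realType} {T : nat} {X : 'I_T -> ptopologicalType}.
Local Notation XX := (prod_topology X).

Definition is_coupling (mu nu : probability (borel XX) R)
    (gam : probability (borel (XX * XX)%type) R) : Prop :=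
  forall A : set XX, @measurable _ (borel XX) A ->
    gam (fst @^-1` A) = mu A /\ gam (snd @^-1` A) = nu A.

Definition sigma_rv (Z : XX * XX -> XX) : set (set (XX * XX)) :=
  preimage_set_system [set: XX * XX] Z (@measurable _ (borel XX)).

Definition bicausal (gam : probability (borel (XX * XX)%type) R) : Prop :=
  forall t : nat, (1 <= t < T)%N ->
    cond_indep gam (sigma_upto (@snd XX XX) t) (sigma_rv fst)
      (sigma_upto (@fst XX XX) t) /\
    cond_indep gam (sigma_upto (@fst XX XX) t) (sigma_rv snd)
      (sigma_upto (@snd XX XX) t).

Definition bicausal_couplings (mu nu : probability (borel XX) R) :
    set (probability (borel (XX * XX)%type) R) :=
  [set gam | is_coupling mu nu gam /\ bicausal gam].

Definition adapted_wasserstein (d : XX -> XX -> R) (p : R)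
    (mu nu : probability (borel XX) R) : \bar R :=
  ereal_inf [set poweR (\int[gam]_z (d z.1 z.2 `^ p)%:E)%E p^-1
            | gam in bicausal_couplings mu nu].

End couplings.

(* Main.v *)
From HB Require Import structures.
From mathcomp Require Import all_boot all_order all_algebra.
From mathcomp Require Import all_classical all_reals all_analysis.
From mathcomp Require Import measurable_realfun zify ring lra.
Require Import Defs.

Set Implicit Arguments.
Unset Strict Implicit.
Unset Printing Implicit Defensive.

Import Order.TTheory GRing.Theory Num.Theory.
Import numFieldNormedType.Exports.

Local Open Scope classical_set_scope.
Local Open Scope ring_scope.

(** The bound is realised by one explicit bicausal coupling of mu and nu. Only
the case where nu has a density D and finite relative entropy H matters, since
otherwise the right-hand side is infinite. Let D_t be the conditional
expectation of D under mu given the first t coordinates: a martingale from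
D_0 = 1 to D_T = D. Draw X from mu and let Y copy the coordinates of X for as
long as the two laws allow it: the mass that still sits on the diagonal after t
steps has density c_t with respect to mu, where c_0 = 1 and
c_(t+1) = c_t * min (D_(t+1) / D_t) 1. The mass leaving the diagonal at step s
has densities a_s = c_s - c_(s+1) in the X variable and
b_s = (c_s / D_s - c_(s+1) / D_(s+1)) * D in the Y variable. These have the same
conditional expectation given the first s coordinates, so that X and Y can be
completed independently of each other given these coordinates. At each step the
coupling consults only the past of both processes, hence it is bicausal
([gamma_causal_fst], [gamma_causal_snd], [causal_cond_indep]).

Put f = sqrt alpha * d(., x0)^p. Since the coupling has no cost on the diagonal
and d(x, y)^p <= 2^(p-1) * (d(x, x0)^p + d(y, x0)^p), its cost is at most
2^(p-1) / sqrt alpha times the sum of the mu-integrals of f * (1 - c_T) and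
f * (D - c_T) ([gamma_cost]), and D - c_T <= (D - 1)^+ + (1 - c_T). With L the
logarithm of the exponential moment, three estimates conclude
([transport_bound]):
- by Fenchel duality between r ln r - r + 1 and exp, f^2 has integral at most L
  under mu and at most H + L under nu ([donsker_varadhan]);
- r ln r - r + 1 >= (1 - r)^2 / 2 for r <= 1 ([entf_ge_below]), so a_s^2 / 2 is
  dominated by D_s times the entropy function at D_(s+1) / D_s, and the chain
  rule for the entropies of the D_t ([entropy_chain]) bounds the sum over s of
  the integrals of a_s^2 / 2 by H; hence 1 - c_T, a sum of T terms a_s, has
  squared L2 norm at most 2 T H ([lost_mass]);
- Cauchy-Schwarz then bounds the integral of f * (1 - c_T), which is counted
  twice, by sqrt (L * 2 T H), and the integral of f * (D - 1)^+ by
  sqrt ((1 + L) * 2 H). This is where 2 sqrt T + 1 comes from.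

Conditional expectations are all taken against explicit samplers Q_t: given the
first t coordinates and an independent uniform variable u, Q_t returns the whole
path ([disintegration]). A Polish space is a measurable retract of the real line
([polish_retract_real]), which reduces their existence to inverting conditional
distribution functions ([noise_outsourcing]). *)

(** * Borel structure of finite products of Polish spaces *)

Definition mfun_of d d' (T : measurableType d) (U : measurableType d')
  (f : T -> U) (mf : measurable_fun setT f) : {mfun T >-> U} :=
  HB.pack f (isMeasurableFun.Build _ _ _ _ _ mf).

Lemma measurable_preimageT d d' (T : measurableType d) (U : measurableType d')
    (f : T -> U) (A : set U) :
  measurable_fun setT f -> measurable A -> measurable (f @^-1` A).
Proof. by move=> mf mA; rewrite -[X in measurable X]setTI; exact: mf. Qed.

Lemma measurable_mem d (T : measurableType d) (A : set T) :
  measurable A -> measurable_fun setT (fun x => x \in A).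
Proof.
move=> mA; apply: (measurable_fun_bool true); rewrite setTI.
rewrite [X in measurable X](_ : _ = A)//.
by apply/seteqP; split => x /=; [move/set_mem|move/mem_set].
Qed.

Section prod_topology_pointwise.
Context (I : eqType) (X : I -> ptopologicalType).
Local Notation XX := (prod_topology X).

Lemma cvg_pointwise (F : set_system XX) (x : XX) : Filter F ->
  (forall t, (fun y : XX => y t) @ F --> x t) -> F --> x.
Proof.
move=> FF Fx; apply/cvg_sup => t A /=.
rewrite (@nbhsE (initial_topology (fun y : XX => y t))) => -[B [[C oC <-] Cx] CA].
apply: filterS CA _; apply: (Fx t C); exact: open_nbhs_nbhs.
Qed.

Lemma continuous_coord t : continuous (fun y : XX => y t).
Proof. exact: (@proj_continuous I X t). Qed.

End prod_topology_pointwise.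

Section metric_facts.
Context {R : realType} {S : topologicalType} (d : S -> S -> R).
Hypotheses (hd : is_metric d) (hm : metrizes d).

Lemma dist_nbhs x e : 0 < e -> nbhs x [set y | d x y < e].
Proof. by move=> e0; apply/hm; exists e. Qed.

Lemma dist_cvgP (u : nat -> S) (l : S) : u n @[n --> \oo] --> l <->
  forall e, 0 < e -> \forall n \near \oo, d l (u n) < e.
Proof.
split=> [ul e e0|ul A /hm[e e0 eA]]; first exact: ul (dist_nbhs l e0).
by apply: filterS (ul e e0) => n /= un; apply: eA.
Qed.

Lemma dist_xx x : d x x = 0. Proof. by have [_ dE _ _] := hd; apply/dE. Qed.

Lemma dist_sym x y : d x y = d y x. Proof. by have [_ _ + _] := hd. Qed.

Lemma dist_tri z x y : d x y <= d x z + d z y. Proof. by have [_ _ _ +] := hd. Qed.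

Lemma dist_ge0 x y : 0 <= d x y. Proof. by have [+ _ _ _] := hd. Qed.

Lemma dist_ball_open x e : open [set y | d x y < e].
Proof.
rewrite openE => y /= dxy; apply/hm; exists (e - d x y); first by rewrite subr_gt0.
by move=> z /= dyz; apply: le_lt_trans (dist_tri y _ _) _; rewrite -ltrBrDl.
Qed.

End metric_facts.

Lemma countable_dense_seq (S : ptopologicalType) :
  (exists2 D : set S, countable D & dense D) ->
  exists q : nat -> S, dense (range q).
Proof.
move=> [D /countable_injP[f] finj dD].
exists (fun n => xget point [set x | D x /\ f x = n]) => O O0 oO.
have [x [Ox Dx]] := dD O O0 oO; exists x; split => //.
exists (f x) => //; case: xgetP => [y _ [Dy fy]|/(_ x)]; last by case.
by apply: finj => //; rewrite inE.
Qed.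

Section polish_prod.
Context {R : realType} {T : nat} (X : 'I_T -> ptopologicalType).
Local Notation XX := (prod_topology X).

(** The maximum of the coordinate metrics metrizes the product, and is complete
because a sequence converges as soon as its coordinates do. The dense sequence
consists of the points whose coordinates lie in the dense sequences of the
factors. *)
Lemma polish_prod : (forall t, polish R (X t)) -> polish R XX.
Proof.
move=> hX.
have qex t : exists q : nat -> X t, dense (range q).
  by apply: countable_dense_seq; have [] := hX t.
pose q t := sval (cid (qex t)); have qP t : dense (range (q t)) := svalP (cid (qex t)).
have dex t : exists d : X t -> X t -> R,
    [/\ is_metric d, metrizes d & complete_metric d] by have [] := hX t.
pose d t := sval (cid (dex t)); have dP t := svalP (cid (dex t)).
have dm t : is_metric (d t) by have [] := dP t.
have dn t : metrizes (d t) by have [] := dP t.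
have dc t : complete_metric (d t) by have [] := dP t.
pose D (x y : XX) := \big[Num.max/0]_t d t (x t) (y t).
have Dge t (x y : XX) : d t (x t) (y t) <= D x y.
  exact: (@le_bigmax _ _ _ 0 (fun t => d t (x t) (y t)) t).
have Dlt (x y : XX) e : 0 < e -> (D x y < e) <-> forall t, d t (x t) (y t) < e.
  by move=> e0; split=> [De t|de]; [exact: le_lt_trans De|exact: bigmax_lt].
have Dnbhs x e : 0 < e -> nbhs x [set y | D x y < e].
  move=> e0; have : \forall y \near x, forall t, d t (x t) (y t) < e.
    apply: (@filter_forall XX _ (fun t y => d t (x t) (y t) < e) (nbhs x)) => t.
    apply: (@continuous_coord _ X t x [set z | d t (x t) z < e]).
    exact: dist_nbhs.
  by apply: filterS => y /Dlt; exact.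
have metD : metrizes D.
  move=> x A; split=> [xA|[e e0 eA]]; last first.
    by apply: filterS eA _; exact: Dnbhs.
  pose F : set_system XX := [set A | exists2 e : R, 0 < e & [set y | D x y < e] `<=` A].
  have FF : Filter F.
    split=> [|B C [e e0 eB] [e' e'0 eC]|B C BC [e e0 eB]].
    - by exists 1.
    - exists (Num.min e e'); first by rewrite lt_min e0.
      by move=> y /=; rewrite lt_min => /andP[ye ye']; split; [exact: eB|exact: eC].
    - by exists e => //; exact: subset_trans BC.
  suff : F --> x by apply.
  apply: cvg_pointwise => t B /(dn t)[e e0 eB]; exists e => // y /= /Dlt Dy.
  by apply: eB; exact: Dy.
split.
  exists (range (fun f : {ffun 'I_T -> nat} => ((fun t => q t (f t)) : XX))).
    have : countable [set: {ffun 'I_T -> nat}] by exact: countableP.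
    exact/sub_countable/card_image_le.
  move=> O [x Ox] oO.
  have /metD[e e0 eO] : nbhs x O by exact: open_nbhs_nbhs.
  have fex t : exists n, d t (x t) (q t n) < e.
    have [|y [/= yx [n _ ny]]] := qP t [set y | d t (x t) y < e] _ (dist_ball_open (dm t) (dn t) _ _).
      by exists (x t); rewrite /= (dist_xx (dm t)).
    by exists n; rewrite ny.
  have [f fP] := choice fex.
  exists (fun t => q t (f t)); split; last first.
    by exists [ffun t => f t] => //; apply: functional_extensionality_dep => t; rewrite ffunE.
  by apply: eO; apply/Dlt.
exists D; split.
- split.
  + by move=> x y; rewrite /D; apply: bigmax_ge_id.
  + move=> x y; split=> [D0|->].
      apply: functional_extensionality_dep => t; have [dge0 dE _ _] := dm t.
      by apply/dE/le_anti; rewrite dge0 -D0 Dge.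
    apply/le_anti; rewrite bigmax_ge_id andbT; apply: bigmax_le => // t _.
    by rewrite (dist_xx (dm t)).
  + by move=> x y; apply: eq_bigr => t _; exact: dist_sym.
  + move=> x y z; apply: bigmax_le => [|t _].
      by apply: addr_ge0; exact: bigmax_ge_id.
    by apply: le_trans (dist_tri (dm t) (y t) _ _) _; apply: lerD; exact: Dge.
- exact: metD.
- move=> u uC.
  have lex t : exists l : X t, (u n t) @[n --> \oo] --> l.
    apply: (dc t) => e e0; have [N NP] := uC e e0; exists N => m n Nm Nn.
    by apply: le_lt_trans (Dge t _ _) _; exact: NP.
  exists ((fun t => sval (cid (lex t))) : XX); apply: cvg_pointwise => t.
  exact: svalP (cid (lex t)).
Qed.

End polish_prod.

Lemma half_expr_lt (R : realType) (e : R) : 0 < e -> exists k, 2^-1 ^+ k < e.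
Proof.
move=> e0; exists (Num.bound e^-1).
have := archi_boundP (ltW (_ : 0 < e^-1)); rewrite invr_gt0 => /(_ e0) be.
rewrite exprVn -[X in _ < X]invrK ltf_pV2 ?posrE ?invr_gt0 ?exprn_gt0//.
apply: lt_le_trans be _; rewrite -natrX ler_nat; apply: ltnW.
exact: ltn_expl.
Qed.

Lemma measurable_fun_generated d (T : measurableType d) (S : pointedType)
    (G : set (set S)) (f : T -> S) :
  (forall U, G U -> measurable (f @^-1` U)) ->
  measurable_fun setT (f : T -> g_sigma_algebraType G).
Proof.
move=> fU; apply: (@measurability _ _ T (g_sigma_algebraType G) setT f G) => //.
by move=> _ [U oU <-]; rewrite setTI; exact: fU.
Qed.

Lemma borel_open (S : ptopologicalType) (U : set S) :
  open U -> @measurable _ (borel S) U.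
Proof. exact: sub_sigma_algebra. Qed.

Definition is_base (S : topologicalType) (B : nat -> set S) :=
  (forall n, open (B n)) /\
  forall U x, open U -> U x -> exists2 n, B n x & B n `<=` U.

Lemma polish_base (R : realType) (S : ptopologicalType) : polish R S ->
  exists B : nat -> set S, is_base B.
Proof.
move=> [/countable_dense_seq[q qD] [d [dm dn _]]].
pose B n : set S := if @unpickle (nat * nat)%type n is Some (i, k) then
  [set y | d (q i) y < 2^-1 ^+ k] else set0.
exists B; split.
  move=> n; rewrite /B; case: unpickle => [[i k]|]; last exact: open0.
  exact: dist_ball_open.
move=> U x oU Ux.
have /dn[e e0 eU] : nbhs x U by exact: open_nbhs_nbhs.
have [k ke] : exists k, (2^-1 : R) ^+ k < e / 2 by apply: half_expr_lt; rewrite divr_gt0.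
have k0 : (0 : R) < 2^-1 ^+ k by rewrite exprn_gt0// invr_gt0.
have [|y [/= xy [i _ iy]]] := qD [set y | d x y < 2^-1 ^+ k] _ (dist_ball_open dm dn _ _).
  by exists x; rewrite /= (dist_xx dm).
rewrite -iy in xy.
exists (pickle (i, k)); rewrite /B pickleK /=; first by rewrite (dist_sym dm).
move=> z /= qz; apply: eU => /=; apply: le_lt_trans (dist_tri dm (q i) _ _) _.
rewrite (splitr e) ltrD//; [exact: lt_trans xy ke|exact: lt_trans qz ke].
Qed.

(** With countable bases, an open set of the product is a countable union of
open rectangles, hence belongs to the product sigma-algebra. This is what makes
a measure on the product sigma-algebra a Borel measure of the product. *)
Lemma measurable_pair_borel (S1 S2 : ptopologicalType)
    (B1 : nat -> set S1) (B2 : nat -> set S2) :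
  is_base B1 -> is_base B2 ->
  measurable_fun setT (id : (borel S1 * borel S2)%type -> borel (S1 * S2)%type).
Proof.
move=> [oB1 B1P] [oB2 B2P].
refine (@measurable_fun_generated _ (borel S1 * borel S2)%type (S1 * S2)%type open id _) => U oU.
pose C n : set (borel S1 * borel S2) := if @unpickle (nat * nat)%type n is Some (i, k) then
  if `[< B1 i `*` B2 k `<=` U >] then B1 i `*` B2 k else set0 else set0.
rewrite (_ : id @^-1` U = \bigcup_n C n).
  apply: bigcupT_measurable => n; rewrite /C; case: unpickle => // -[i k].
  by case: ifP => // _; apply: measurableX; exact: borel_open.
apply/seteqP; split => [[x y] /= Uxy|z [n _]]; last first.
  rewrite /C; case: unpickle => // -[i k]; case: asboolP => // CU; exact: CU.
have : nbhs (x, y) U by exact: open_nbhs_nbhs.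
move=> [[V W] /= [xV yW] VWU].
have [i Bi BiV] := B1P _ x (@open_interior _ V) xV.
have [k Bk BkW] := B2P _ y (@open_interior _ W) yW.
exists (pickle (i, k)) => //; rewrite /C pickleK asboolT//.
move=> [x' y'] /= [Bx By]; apply: VWU; split => /=.
  by apply: interior_subset; exact: BiV.
by apply: interior_subset; exact: BkW.
Qed.

Section coordinates.
Context {T : nat} (X : 'I_T -> ptopologicalType).
Local Notation XX := (prod_topology X).

(** The open boxes around x generate a filter which converges to x coordinate by
coordinate, hence in the product topology. *)
Lemma nbhs_box (x : XX) (A : set XX) : nbhs x A ->
  exists V : forall t, set (X t),
    (forall t, open (V t) /\ V t (x t)) /\ [set y | forall t, V t (y t)] `<=` A.
Proof.
pose F : set_system XX := [set A | exists V : forall t, set (X t),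
  (forall t, open (V t) /\ V t (x t)) /\ [set y | forall t, V t (y t)] `<=` A].
have FF : Filter F.
  split=> [|B C [V [oV VB]] [W [oW WC]]|B C BC [V [oV VB]]].
  - by exists (fun t => setT); split => // t; split => //; exact: openT.
  - exists (fun t => V t `&` W t); split => [t|y yVW].
      have [oVt Vt] := oV t; have [oWt Wt] := oW t.
      by split => //; exact: openI.
    by split; [apply: VB => t|apply: WC => t]; have [] := yVW t.
  - by exists V; split => //; exact: subset_trans BC.
suff : F --> x by apply.
apply: cvg_pointwise => t B /=; rewrite nbhsE => -[C [oC Cx] CB].
(* The box with side C in direction t and the whole space elsewhere. *)
exists (fun s => [set z | forall e : s = t, C (ecast s (X s) e z)]); split.
  move=> s; have [st|/eqP st] := eqVneq s t.
    subst s; split => [|e]; last by rewrite eq_axiomK.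
    rewrite [X in open X](_ : _ = C)//; apply/seteqP; split => z /=.
      by move/(_ erefl).
    by move=> Cz e; rewrite eq_axiomK.
  split => [|e]; last by have := st e.
  rewrite [X in open X](_ : _ = setT); first exact: openT.
  by apply/seteqP; split => // z _ e; have := st e.
by move=> y /= /(_ t erefl) => ?; exact: CB.
Qed.

Variable B : forall t, nat -> set (X t).
Hypothesis hB : forall t, is_base (@B t).

(** An open set of a finite product is a countable union of boxes whose sides are
taken from countable bases, so that coordinatewise measurability suffices. *)
Lemma measurable_fun_coord d (O : measurableType d) (f : O -> XX) :
  (forall t, measurable_fun setT ((fun w => f w t) : O -> borel (X t))) ->
  measurable_fun setT (f : O -> borel XX).
Proof.
move=> mf; apply: measurable_fun_generated => U oU.
pose C n : set O := if @unpickle {ffun 'I_T -> nat} n is Some g then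
  if `[< [set y : XX | forall t, @B t (g t) (y t)] `<=` U >] then
  \bigcap_t ((fun w => f w t) @^-1` @B t (g t)) else set0 else set0.
rewrite (_ : f @^-1` U = \bigcup_n C n).
  apply: bigcupT_measurable => n; rewrite /C; case: unpickle => // g.
  case: ifP => // _; apply: fin_bigcap_measurable => // t _.
  apply: measurable_preimageT (mf t) _; apply: borel_open.
  by have [] := hB t.
apply/seteqP; split => [w /= Uw|w [n _]]; last first.
  rewrite /C; case: unpickle => // g; case: asboolP => // gU wC.
  by apply: gU => t; exact: wC.
have [V [Vo VU]] : exists V : forall t, set (X t),
  (forall t, open (V t) /\ V t (f w t)) /\ [set y | forall t, V t (y t)] `<=` U.
  by apply: nbhs_box; exact: open_nbhs_nbhs.
have /choice[g gP] t : exists n, @B t n (f w t) /\ @B t n `<=` V t.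
  by have [oV Vt] := Vo t; have [n ? ?] := (hB t).2 _ _ oV Vt; exists n.
exists (pickle [ffun t => g t]) => //; rewrite /C pickleK asboolT.
  by move=> t _; rewrite /= ffunE; have [] := gP t.
move=> y /= yB; apply: VU => t; have [_] := gP t; apply.
by have := yB t; rewrite ffunE.
Qed.

End coordinates.

Section measurable_metric.
Context {R : realType} {S : ptopologicalType} (d : S -> S -> R).
Hypotheses (dm : is_metric d) (dn : metrizes d).

(** Continuity of the metric: the set where it is less than r is open. *)
Lemma measurable_metric_pair :
  measurable_fun setT ((fun z => d z.1 z.2) : borel (S * S)%type -> R).
Proof.
apply: (@measurability _ _ _ _ _ _ (@RGenInftyO.G R)); first exact: RGenInftyO.measurableE.
move=> _ [_ [r ->] <-]; rewrite setTI; apply: sub_sigma_algebra.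
rewrite /= openE => -[x y] /=; rewrite in_itv/= => dr.
pose e := (r - d x y) / 2.
have e0 : 0 < e by rewrite divr_gt0// subr_gt0.
exists ([set z | d x z < e], [set z | d y z < e]); first by split; exact: dist_nbhs.
move=> [x' y'] /= [xx' yy']; rewrite in_itv/=.
have := dist_tri dm x x' y'; have := dist_tri dm y x y'.
rewrite (dist_sym dm x' x) => h1 h2; rewrite /e in xx' yy' *; lra.
Qed.

Lemma measurable_metric_pt x0 :
  measurable_fun setT ((fun x => d x x0) : borel S -> R).
Proof.
apply: (@measurability _ _ _ _ _ _ (@RGenInftyO.G R)); first exact: RGenInftyO.measurableE.
move=> _ [_ [r ->] <-]; rewrite setTI; apply: sub_sigma_algebra.
rewrite (_ : _ @^-1` _ = [set x | d x0 x < r]); first exact: dist_ball_open.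
by apply/seteqP; split => x /=; rewrite in_itv/= (dist_sym dm).
Qed.

End measurable_metric.

(** * Measurable retraction of a Polish space from the real line *)

Section ternary_code.
Context {R : realType} (b : nat -> bool).

(** The integer written in base 3 as b 0, ..., b n. Base 3 rather than 2: as the
digit 2 never occurs, distinct digit sequences have distinct sums, and the
remainder of the expansion is at most half of the last place. *)
Fixpoint tern n : nat := if n is m.+1 then 3 * tern m + b m.+1 else b 0%N.

Let a n : R := (tern n)%:R / 3 ^+ n.

Definition tern_code : R := sup (range a).

Let a_next n m : a (n + m)%N + 2^-1 / 3 ^+ (n + m) <= a n + 2^-1 / 3 ^+ n.
Proof.
elim: m => [|m ih]; first by rewrite addn0.
apply: le_trans ih; rewrite addnS /a /= exprS invfM natrD natrM.
have q0 : (0 : R) <= (3 ^+ (n + m))^-1 by rewrite invr_ge0 exprn_ge0.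
have b1 : ((b (n + m).+1)%:R : R) <= 1 by case: (b _).
move: q0 b1; move: (_^-1) (tern _)%:R (nat_of_bool _)%:R => q t c q0 c1.
have h : (3 * t + c) / 3 + 2^-1 / 3 <= t + 2^-1 by lra.
have := ler_wpM2r q0 h; lra.
Qed.

Let a_nd n m : a n <= a (n + m)%N.
Proof.
elim: m => [|m ih]; first by rewrite addn0.
apply: (le_trans ih); rewrite addnS /a /= exprS invfM natrD natrM.
have q0 : (0 : R) <= (3 ^+ (n + m))^-1 by rewrite invr_ge0 exprn_ge0.
have b0 : 0 <= ((b (n + m).+1)%:R : R) by [].
move: q0 b0; move: (_^-1) (tern _)%:R (nat_of_bool _)%:R => q t c q0 c0.
have h : t <= (3 * t + c) / 3 by lra.
have := ler_wpM2r q0 h; lra.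
Qed.

Let a_ub n m : a m <= a n + 2^-1 / 3 ^+ n.
Proof.
have p k : (0 : R) <= 2^-1 / 3 ^+ k by rewrite divr_ge0// exprn_ge0.
have [nm|/ltnW mn] := leqP n m.
  rewrite -(subnKC nm); apply: le_trans (a_next n (m - n)).
  by rewrite lerDl.
rewrite -(subnKC mn); apply: le_trans (a_nd m (n - m)) _.
by rewrite lerDl.
Qed.

Lemma tern_code_sup : has_sup (range a).
Proof.
by split; [exists (a 0%N); exists 0%N|exists (a 0%N + 2^-1 / 3 ^+ 0) => _ [m _ <-]].
Qed.

Lemma tern_codeP n :
  (tern n)%:R <= 3 ^+ n * tern_code < (tern n)%:R + 1.
Proof.
have p0 : (0 : R) < 3 ^+ n by rewrite exprn_gt0.
rewrite mulrC -ler_pdivrMr//; apply/andP; split.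
  by apply: sup_upper_bound; [exact: tern_code_sup|exists n].
apply: (@le_lt_trans _ _ ((tern n)%:R + 2^-1)); last by rewrite ltrD2l; lra.
rewrite -ler_pdivlMr// mulrDl; apply: ge_sup => [|_ [m _ <-]]; last exact: a_ub.
by exists (a 0%N); exists 0%N.
Qed.

(** The n-th digit is read off the code by the position of 3^n times the code
modulo 3, which is a Borel condition on the code. *)
Lemma tern_digit n : b n =
  `[< exists k : nat, (3 * k + 1)%:R <= (3 ^+ n * tern_code : R) < (3 * k + 2)%:R >].
Proof.
have [c1 c2] := andP (tern_codeP n); rewrite natr1 in c2.
have [k kE] : exists k, tern n = (3 * k + b n)%N by case: n {c1 c2} => [|n]; [exists 0%N|exists (tern n)].
apply/idP/asboolP => [bn|[j /andP[j1 j2]]].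
  by exists k; rewrite kE bn in c1 c2; rewrite c1 (lt_le_trans c2)// ler_nat; lia.
have l1 : (3 * j + 1 < (tern n).+1)%N by rewrite -(ltr_nat R); exact: le_lt_trans j1 c2.
have l2 : (tern n < 3 * j + 2)%N by rewrite -(ltr_nat R); exact: le_lt_trans c1 j2.
by move: l1 l2; rewrite kE; case: (b n) => //= l1 l2; exfalso; lia.
Qed.

End ternary_code.

Section measurable_selection.
Context d (T : measurableType d).

(** Take the first index whose set contains the point. *)
Lemma measurable_first (E : nat -> set T) : (forall i, measurable (E i)) ->
  exists f : T -> nat, (forall A, measurable (f @^-1` A)) /\
    forall x, (exists i, E i x) -> E (f x) x.
Proof.
move=> mE; pose F i := E i `\` \bigcup_(j < i) E j.
have mF i : measurable (F i).
  by apply: measurableD => //; apply: bigcup_measurable => j _.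
have Fex x : (exists i, E i x) -> exists i, F i x.
  move=> Ex; have Ex' : exists i, `[< E i x >] by case: Ex => i Ei; exists i; apply/asboolP.
  case: (ex_minnP Ex') => i /asboolP Ei imin; exists i; split => // -[j /= ji Ej].
  by have := imin j (asboolT Ej); rewrite leqNgt ji.
have Funiq x i j : F i x -> F j x -> i = j.
  move=> [Ei nEi] [Ej nEj]; case: (ltngtP i j) => // ij; exfalso.
    by apply: nEj; exists i.
  by apply: nEi; exists j.
pose f x := if pselect (exists i, F i x) is left e then sval (cid e) else 0%N.
have fF x : (exists i, F i x) -> F (f x) x.
  by rewrite /f; case: pselect => // e _; exact: svalP (cid e).
exists f; split=> [A|x /Fex/fF[]//].
rewrite (_ : f @^-1` A = (\bigcup_(i in A) F i) `|`
    (if `[< A 0%N >] then ~` \bigcup_i F i else set0)).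
  apply: measurableU; first exact: bigcup_measurable.
  by case: ifP => // _; apply: measurableC; exact: bigcup_measurable.
apply/seteqP; split => x /=.
  have [e|ne] := pselect (exists i, F i x).
    by move=> Af; left; exists (f x) => //; exact: fF.
  rewrite {1}/f; case: pselect => // _ A0; right; rewrite asboolT//.
  by move=> [i _ Fi]; apply: ne; exists i.
case=> [[i Ai Fi]|]; first by rewrite (Funiq x (f x) i)//; apply: fF; exists i.
case: asboolP => // A0 ne; rewrite /f; case: pselect => // -[i Fi].
by exfalso; apply: ne; exists i.
Qed.

End measurable_selection.

Section borel_retract.
Context {R : realType} {S : ptopologicalType}.

(** Code a point by the ternary number whose digits tell which balls of a
countable base contain it. To decode r, pick for each k the first centre i such
that the digit of the ball of radius 2^-k around q i is set in r. On the set G of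
those r for which consecutive centres are close enough, the centres form a
Cauchy sequence and psi r is its limit; elsewhere psi r is arbitrary. *)
Lemma polish_retract_real : polish R S -> exists (phi : S -> R) (psi : R -> S),
  [/\ measurable_fun setT (phi : borel S -> R),
      measurable_fun setT (psi : R -> borel S) & cancel phi psi].
Proof.
move=> [/countable_dense_seq[q qD] [d [dm dn dc]]].
pose h k : R := 2^-1 ^+ k.
have h0 k : 0 < h k by rewrite /h exprn_gt0// invr_gt0.
have hS k : h k = h k.+1 + h k.+1 by rewrite /h exprS; lra.
pose U n : set S := if @unpickle (nat * nat)%type n is Some (i, k) then
  [set y | d (q i) y < h k] else set0.
pose b (x : S) n := x \in U n.
pose phi x : R := tern_code (b x).
pose E n : set R := [set r | exists k : nat, (3 * k + 1)%:R <= 3 ^+ n * r < (3 * k + 2)%:R].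
have mE n : measurable (E n).
  rewrite (_ : E n = \bigcup_k ((fun r : R => 3 ^+ n * r) @^-1` `[(3 * k + 1)%:R, (3 * k + 2)%:R[%classic)).
    by apply: bigcupT_measurable => k; apply: measurable_preimageT => //; exact: mulrl_measurable.
  by apply/seteqP; split => [r [k rk]|r [k _ rk]]; exists k => //; move: rk; rewrite /= in_itv.
have EU x n : E n (phi x) <-> U n x.
  have := tern_digit (R := R) (b x) n; rewrite {1}/b => bE; split=> [Ex|Ux].
    by apply/set_mem; rewrite bE; apply/asboolP.
  by apply/asboolP; rewrite -bE; apply/mem_set.
have mphi : measurable_fun setT (phi : borel S -> R).
  have mU n : measurable (U n : set (borel S)).
    by rewrite /U; case: unpickle => [[i k]|//]; apply: borel_open; exact: dist_ball_open.
  have mt n : measurable_fun setT ((fun x => (tern (b x) n)%:R) : borel S -> R).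
    elim: n => [|n ih] /=.
      rewrite (_ : (fun _ => _) = (fun x => if x \in U 0%N then 1 else 0)).
        by apply: measurable_fun_ifT => //; exact: measurable_mem.
      by apply/funext => x; rewrite /b; case: (x \in _).
    rewrite (_ : (fun _ => _) = (fun x => 3 * (tern (b x) n)%:R + if x \in U n.+1 then 1 else 0)).
      apply: measurable_funD; first exact: measurable_funM.
      by apply: measurable_fun_ifT => //; exact: measurable_mem.
    by apply/funext => x; rewrite natrD natrM /b; case: (x \in _).
  apply: (@measurability _ _ _ _ _ _ (@RGenOInfty.G R)); first exact: RGenOInfty.measurableE.
  move=> _ [_ [r ->] <-]; rewrite setTI.
  rewrite (_ : _ @^-1` _ = \bigcup_n ((fun x => (tern (b x) n)%:R / 3 ^+ n : R) @^-1` `]r, +oo[%classic)).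
    apply: bigcupT_measurable => n; apply: measurable_preimageT => //.
    exact: measurable_funM.
  apply/seteqP; split => x /=; rewrite in_itv/= andbT.
    move=> /sup_gt[|_ [n _ <-] rn]; first by have [] := tern_code_sup (R := R) (b x).
    by exists n => //=; rewrite in_itv/= andbT.
  move=> [n _] /=; rewrite in_itv/= andbT => /lt_le_trans; apply.
  by apply: sup_upper_bound; [exact: tern_code_sup|exists n].
have idxex (k : nat) : exists f : R -> nat, (forall A, measurable (f @^-1` A)) /\
    forall r, (exists i : nat, E (@pickle (nat * nat)%type (i, k)) r) ->
      E (@pickle (nat * nat)%type (f r, k)) r.
  have [f [fA fE]] := @measurable_first _ R (fun i => E (@pickle (nat * nat)%type (i, k))) (fun i => mE _).
  exists f; split; [exact: fA|exact: fE].
have [idx idxP] := choice idxex.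
have midx k A : measurable (idx k @^-1` A) by have [] := idxP k.
pose y k r := q (idx k r).
pose G := [set r | forall k, d (y k r) (y k.+1 r) <= h k + h k.+1].
have mG : measurable G.
  pose W k i := [set j | d (q i) (q j) <= h k + h k.+1].
  rewrite (_ : G = \bigcap_k \bigcup_i (idx k @^-1` [set i] `&` idx k.+1 @^-1` W k i)).
    by apply: bigcapT_measurable => k; apply: bigcupT_measurable => i; apply: measurableI.
  apply/seteqP; split => [r Gr k _|r Gr k]; first by exists (idx k r) => //; split => //; exact: Gr.
  by have [i _ [/= <-]] := Gr k I; exact.
have h3 e : 0 < e -> exists k, 4 * h k < e.
  move=> e0; have [|k ke] := @half_expr_lt R (e / 4); first by rewrite divr_gt0.
  by exists k; rewrite mulrC -ltr_pdivlMr.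
have GC r k m : G r -> d (y k r) (y (k + m)%N r) + 3 * h (k + m)%N <= 3 * h k.
  move=> Gr; elim: m => [|m ih]; first by rewrite addn0 (dist_xx dm) add0r.
  apply: le_trans ih; rewrite addnS.
  have := dist_tri dm (y (k + m)%N r) (y k r) (y (k + m).+1 r).
  by have := Gr (k + m)%N; have := hS (k + m)%N; lra.
have Glim r : G r -> exists l, forall k, d (y k r) l <= 3 * h k.
  move=> Gr; have [|l /(dist_cvgP dn) yl] := dc (y ^~ r).
    move=> e e0; have [N Ne] : exists k, 4 * h k < e / 2 by apply: h3; rewrite divr_gt0.
    exists N => m n Nm Nn; apply: le_lt_trans (dist_tri dm (y N r) _ _) _; rewrite /=.
    have := GC r N (m - N)%N Gr; have := GC r N (n - N)%N Gr; rewrite !subnKC//.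
    rewrite /= (dist_sym dm (y m r)).
    have := h0 m; have := h0 n; have := h0 N; lra.
  exists l => k; apply/ler_addgt0Pr => e e0.
  have [M _ MP] := yl e e0; have := MP (k + M)%N (leq_addl _ _); rewrite /= => yn.
  have := GC r k M Gr; have := dist_tri dm (y (k + M)%N r) (y k r) l.
  rewrite (dist_sym dm (y (k + M)%N r) l); have := h0 (k + M)%N; lra.
pose psi r := if pselect (G r) is left Gr then sval (cid (Glim r Gr)) else point.
have psiG r k : G r -> d (y k r) (psi r) <= 3 * h k.
  by move=> Gr; rewrite /psi; case: pselect => // Gr'; move: (svalP (cid (Glim r Gr'))); exact.
exists phi, psi; split => //.
  apply: measurable_fun_generated => V oV.
  pose W k := [set i | [set z | d (q i) z < 4 * h k] `<=` V].
  rewrite (_ : _ @^-1` _ = (G `&` \bigcup_k (idx k @^-1` W k)) `|`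
      (if `[< V point >] then ~` G else set0)).
    apply: measurableU; last by case: ifP => // _; exact: measurableC.
    by apply: measurableI => //; exact: bigcupT_measurable.
  apply/seteqP; split => r.
    have [Gr Vr|nGr] := pselect (G r); last first.
      by rewrite /= /psi; case: pselect => // _ Vp; right; rewrite asboolT.
    have /dn[e e0 eV] : nbhs (psi r) V by exact: open_nbhs_nbhs.
    have [k ke] : exists k, 4 * h k < e / 2 by apply: h3; rewrite divr_gt0.
    left; split => //; exists k => // z /= yz; apply: eV => /=.
    apply: le_lt_trans (dist_tri dm (y k r) _ _) _.
    rewrite (dist_sym dm (psi r) (y k r)); have := psiG r k Gr; have := h0 k.
    rewrite /y in yz *; lra.
  case=> [[Gr [k _ Wk]]|].
    apply: Wk => /=; apply: le_lt_trans (psiG r k Gr) _.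
    by have := h0 k; lra.
  by case: asboolP => //= Vp nGr; rewrite /psi; case: pselect.
move=> x; have yx k : d (y k (phi x)) x < h k.
  have [|z [/= xz [i _ iz]]] := qD [set z | d x z < h k] _ (dist_ball_open dm dn _ _).
    by exists x; rewrite /= (dist_xx dm).
  have : E (pickle (idx k (phi x), k)) (phi x).
    apply: (idxP k).2; exists i; apply/EU.
    by rewrite /U pickleK /= iz (dist_sym dm).
  by move/EU; rewrite /U pickleK.
have Gx : G (phi x).
  move=> k; have := yx k; have := yx k.+1.
  have := dist_tri dm x (y k (phi x)) (y k.+1 (phi x)).
  by rewrite (dist_sym dm x (y k.+1 (phi x))); lra.
have [_ dE _ _] := dm; apply/dE/le_anti; rewrite dist_ge0// andbT.
apply/ler_addgt0Pr => e e0; rewrite add0r; have [k ke] := h3 e e0.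
have := dist_tri dm (y k (phi x)) (psi (phi x)) x; rewrite (dist_sym dm (psi (phi x)) (y k (phi x))).
by have := yx k; have := psiG _ k Gx; lra.
Qed.

End borel_retract.

(** * Disintegration *)

Section disintegration.
Local Open Scope ereal_scope.

(** Running maximum along an enumeration of the rationals below r. *)
Lemma rat_exhaust (R : realType) (r : R) : exists u : nat -> rat,
  [/\ {homo u : m n / (m <= n)%N >-> (m <= n)%R}, forall n, (ratr (u n) < r)%R &
      forall q : rat, (ratr q < r)%R -> exists n, (q <= u n)%R].
Proof.
have [q0 q0r] : exists q0 : rat, (ratr q0 < r)%R.
  have : (r - 1 < r)%R by rewrite ltrBlDr ltrDl.
  move=> /rat_in_itvoo[q]; rewrite in_itv/= => /andP[_ qr]; by exists q.
pose step q n := if @unpickle rat n is Some q' then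
  if (ratr q' < r)%R then Num.max q' q else q else q.
pose u := fix u n := if n is m.+1 then step (u m) m else q0.
have stepge q n : (q <= step q n)%R.
  by rewrite /step; case: unpickle => // q'; case: ifPn => // _; rewrite le_max lexx orbT.
exists u; split.
- by apply: homo_leq => // [x y z|n]; [exact: le_trans|exact: stepge].
- elim=> //= n ih; rewrite /step; case: unpickle => // q'; case: ifPn => // q'r.
  by rewrite /Num.max; case: ifP.
- move=> q qr; exists (pickle q).+1; rewrite /= /step pickleK qr.
  by rewrite le_max lexx.
Qed.

Lemma nondecreasing_rat_bigcup_eq d1 d2 (T1 : measurableType d1)
    (T2 : measurableType d2) (R : realType) (P1 : {measure set T1 -> \bar R})
    (P2 : {measure set T2 -> \bar R}) (A : rat -> set T1) (B : rat -> set T2)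
    (r : R) :
  (forall q, measurable (A q)) -> (forall q, measurable (B q)) ->
  (forall q q', (q <= q')%R -> A q `<=` A q') ->
  (forall q q', (q <= q')%R -> B q `<=` B q') ->
  (forall q, P1 (A q) = P2 (B q)) ->
  P1 (\bigcup_(q in [set q | (ratr q < r)%R]) A q) =
  P2 (\bigcup_(q in [set q | (ratr q < r)%R]) B q).
Proof.
move=> mA mB ndA ndB AB; have [u [ndu ur urq]] := rat_exhaust r.
have E (T : Type) (C : rat -> set T) : (forall q q', (q <= q')%R -> C q `<=` C q') ->
    \bigcup_(q in [set q | (ratr q < r)%R]) C q = \bigcup_n C (u n).
  move=> ndC; apply/seteqP; split => [x [q /= /urq[n qn] Cx]|x [n _ Cx]].
    by exists n => //; exact: ndC Cx.
  by exists (u n) => //=.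
rewrite !E//.
have c1 : P1 (A (u n)) @[n --> \oo] --> P1 (\bigcup_n A (u n)).
  apply: nondecreasing_cvg_mu => //; first exact: bigcupT_measurable.
  by move=> m n mn; apply/subsetPset; apply: ndA; exact: ndu.
have c2 : P2 (B (u n)) @[n --> \oo] --> P2 (\bigcup_n B (u n)).
  apply: nondecreasing_cvg_mu => //; first exact: bigcupT_measurable.
  by move=> m n mn; apply/subsetPset; apply: ndB; exact: ndu.
rewrite -(cvg_lim _ c1)// -(cvg_lim _ c2)//.
by congr (lim _); under eq_fun do rewrite AB.
Qed.

Lemma ae_le_of_integral_le d (T : measurableType d) (R : realType)
    (m : {measure set T -> \bar R}) (f g : T -> \bar R) :
  m.-integrable setT f -> m.-integrable setT g ->
  (forall x, f x \is a fin_num) -> (forall x, g x \is a fin_num) ->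
  (forall E, measurable E -> \int[m]_(x in E) f x <= \int[m]_(x in E) g x) ->
  m [set x | g x < f x] = 0.
Proof.
move=> fi gi ffin gfin fg.
have mf := measurable_int _ fi; have mg := measurable_int _ gi.
pose E := [set x | g x < f x].
have mE : measurable E by rewrite -[E]setTI; exact: measurable_lte.
have fiE : m.-integrable E f by apply: integrableS fi.
have giE : m.-integrable E g by apply: integrableS gi.
have i0 : \int[m]_(x in E) `|(f \- g) x| = 0.
  apply/eqP; rewrite eq_le integral_ge0 ?andbT//.
  under eq_integral => x /[!inE] xE.
    rewrite gee0_abs; last by rewrite sube_ge0 ?ltW// gfin.
    over.
  rewrite integralB//= sube_le0; exact: fg.
have mB : measurable_fun E (f \- g : T -> \bar R).
  by apply: emeasurable_funB; exact: measurable_funTS.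
have [N [mN N0 EN]] := (ae_eq_integral_abs m mE mB).1 i0.
apply: (@subset_measure0 _ _ _ m E N) => // x Ex; apply: EN => /= /(_ Ex).
by move=> fg0; move: Ex; rewrite /E /= -sube_gt0 fg0 ltxx.
Qed.

(** The rectangles with second side in a generating pi-system form a pi-system
which generates the product sigma-algebra. *)
Lemma probability_prod_unique d1 d2 (T1 : measurableType d1)
    (T2 : measurableType d2) (R : realType) (G : set (set T2))
    (m1 m2 : probability (T1 * T2)%type R) :
  @measurable _ T2 = <<s G >> -> setI_closed G -> G setT ->
  (forall C B, measurable C -> G B -> m1 (C `*` B) = m2 (C `*` B)) ->
  forall A, measurable A -> m1 A = m2 A.
Proof.
move=> mG GI GT m12.
pose H := [set C `*` B | C in @measurable _ T1 & B in G].
have HT : H setT by exists setT => //; exists setT => //; rewrite setXTT.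
apply: (@measure_unique _ _ _ H (fun=> setT)) => //.
- rewrite measurable_prod_measurableType; apply/seteqP; split.
    apply: smallest_sub; first exact: smallest_sigma_algebra.
    move=> _ [C mC [B mB <-]].
    rewrite (_ : C `*` B = (C `*` setT) `&` (setT `*` B)); last first.
      by rewrite -setXI setTI setIT.
    have -> : (@setT T1) `*` B = snd @^-1` B by apply/seteqP; split => z // [].
    apply: (@measurableI _ (g_sigma_algebraType H)).
      by apply: sub_sigma_algebra; exists C => //; exists setT.
    move: B mB; rewrite mG; apply: smallest_sub => [|B GB].
      split; first by rewrite /= preimage_set0; exact: sigma_algebra0.
        by move=> B; rewrite !setTD /=; exact: (@measurableC _ (g_sigma_algebraType H)).
      by move=> F mF /=; rewrite preimage_bigcup; exact: (@bigcupT_measurable _ (g_sigma_algebraType H)).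
    by apply: sub_sigma_algebra; exists setT => //; exists B => //; apply/seteqP; split => z // [].
  apply: smallest_sub; first exact: smallest_sigma_algebra.
  move=> _ [C mC [B mB <-]]; apply: sub_sigma_algebra; exists C => //.
  by exists B => //; rewrite mG; exact: sub_sigma_algebra.
- move=> _ _ [C mC [B GB <-]] [C' mC' [B' GB' <-]]; rewrite -setXI.
  by exists (C `&` C'); [exact: measurableI|exists (B `&` B') => //; exact: GI].
- by rewrite bigcup_const.
- by move=> _ [C mC [B GB <-]]; exact: m12.
- by move=> _; apply: le_lt_trans (probability_le1 m1 measurableT) (ltry _).
Qed.

Section noise_outsourcing.
Context {R : realType} {d} {S : measurableType d} (mu : probability S R).
Variables (h : S -> S) (phi : S -> R).
Hypotheses (mh : measurable_fun setT h) (mphi : measurable_fun setT phi).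

Let muh := distribution mu (mfun_of mh).

Let below q := [set x | (phi x < ratr q)%R].

Let mbelow q : measurable (below q).
Proof.
rewrite (_ : below q = phi @^-1` `]-oo, ratr q[%classic).
  exact: measurable_preimageT.
by apply/seteqP; split => x /=; rewrite in_itv.
Qed.

Section cond_cdf_at.
Variable q : rat.

(** For fixed q, the law of h restricted to the event phi < q; its density with
respect to the law of h is the conditional distribution function at q. *)
Let nuq (C : set S) := mu (h @^-1` C `&` below q).

Let nuq0 : nuq set0 = 0.
Proof. by rewrite /nuq preimage_set0 set0I measure0. Qed.

Let nuq_ge0 C : 0 <= nuq C.
Proof. by rewrite /nuq measure_ge0. Qed.

Let nuq_sigma_additive : semi_sigma_additive nuq.
Proof.
move=> F mF tF mUF; rewrite /nuq preimage_bigcup setI_bigcupl.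
apply: measure_semi_sigma_additive.
- by move=> n; apply: measurableI => //; exact: measurable_preimageT.
- apply/trivIsetP => /= i j _ _ ij; rewrite setIACA -preimage_setI.
  by move/trivIsetP : tF => /(_ _ _ _ _ ij) ->//; rewrite preimage_set0 set0I.
- apply: bigcupT_measurable => n; apply: measurableI => //.
  exact: measurable_preimageT.
Qed.

HB.instance Definition _ :=
  isMeasure.Build _ _ _ nuq nuq0 nuq_ge0 nuq_sigma_additive.

Let nuq_fin : fin_num_fun nuq.
Proof.
move=> C mC; apply: fin_num_measure; apply: measurableI => //.
exact: measurable_preimageT.
Qed.

HB.instance Definition _ := Measure_isFinite.Build _ _ _ nuq nuq_fin.

Lemma cond_cdf_at : exists f : S -> \bar R,
  [/\ forall x, 0 <= f x, forall x, f x \is a fin_num,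
      muh.-integrable setT f &
      forall C, measurable C ->
        mu (h @^-1` C `&` below q) = \int[muh]_(x in C) f x].
Proof.
have dom : nuq `<< muh.
  apply/null_content_dominatesP => C mC; rewrite /= /distribution /pushforward.
  move=> h0; apply: (@subset_measure0 _ _ _ mu _ (h @^-1` C)) => //.
  - by apply: measurableI => //; exact: measurable_preimageT.
  - exact: measurable_preimageT.
exists (Radon_Nikodym_SigmaFinite.f nuq muh); split.
- exact: Radon_Nikodym_SigmaFinite.f_ge0.
- exact: Radon_Nikodym_SigmaFinite.f_fin_num.
- exact: Radon_Nikodym_SigmaFinite.f_integrable.
- by move=> C mC; rewrite -Radon_Nikodym_SigmaFinite.f_integral.
Qed.

End cond_cdf_at.

(** Radon-Nikodym densities are only defined almost everywhere; the countably
many null sets where the values at rational points fail to be monotone or to lie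
in [0, 1] are collected into one null set, on which all values are reset to 0. *)
Lemma cond_cdf : exists F : rat -> S -> \bar R,
  [/\ forall q x, 0 <= F q x <= 1,
      forall q, measurable_fun setT (F q),
      forall x, {homo F ^~ x : q q' / (q <= q')%R >-> q <= q'} &
      forall C q, measurable C ->
        mu (h @^-1` C `&` below q) = \int[muh]_(x in C) F q x].
Proof.
have /choice[f fP] := cond_cdf_at.
have fi q : muh.-integrable setT (f q) by have [] := fP q.
have mf q : measurable_fun setT (f q) := measurable_int _ (fi q).
have ffin q x : f q x \is a fin_num by have [] := fP q.
have fE C q : measurable C ->
  mu (h @^-1` C `&` below q) = \int[muh]_(x in C) f q x by have [_ _ _] := fP q; apply.
(* N1 is where monotonicity fails, N2 where the upper bound 1 fails. *)
pose N1 (p : rat * rat) := if (p.1 <= p.2)%R then [set x | f p.2 x < f p.1 x] else set0.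
pose N2 (q : rat) := [set x | 1 < f q x].
pose N := (\bigcup_p N1 p) `|` (\bigcup_q N2 q).
have mN1 p : measurable (N1 p).
  by rewrite /N1; case: ifP => // _; rewrite -[X in measurable X]setTI; exact: measurable_lte.
have mN2 p : measurable (N2 p).
  by rewrite /N2 -[X in measurable X]setTI; exact: measurable_lte.
have bigcupc (T : countType) (G : T -> set S) :
    (forall t, measurable (G t)) -> (forall t, muh (G t) = 0) ->
    measurable (\bigcup_t G t) /\ muh (\bigcup_t G t) = 0.
  move=> mG G0.
  pose G' n := if @unpickle T n is Some t then G t else set0.
  have E : \bigcup_t G t = \bigcup_n G' n.
    apply/seteqP; split => [x [t _ Gx]|x [n _]].
      by exists (pickle t) => //; rewrite /G' pickleK.
    by rewrite /G'; case: unpickle => // t Gx; exists t.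
  have mG' n : measurable (G' n) by rewrite /G'; case: unpickle.
  rewrite E; split; first exact: bigcupT_measurable.
  apply/eqP; rewrite eq_le measure_ge0 andbT.
  apply: (le_trans (generalized_Boole_inequality muh mG' _)).
    exact: bigcupT_measurable.
  by rewrite eseries0// => n _ _; rewrite /G'; case: unpickle.
have [mNN1 N10] : measurable (\bigcup_p N1 p) /\ muh (\bigcup_p N1 p) = 0.
  apply: bigcupc => // -[q q']; rewrite /N1 /=; case: ifPn => // keptq'.
  apply: ae_le_of_integral_le => // E mE; rewrite -!fE//.
  apply: le_measure; rewrite ?inE; try by apply: measurableI => //; exact: measurable_preimageT.
  by apply: setIS => x /= /lt_le_trans; apply; rewrite ler_rat.
have [mNN2 N20] : measurable (\bigcup_p N2 p) /\ muh (\bigcup_p N2 p) = 0.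
  apply: bigcupc => // q; apply: (@ae_le_of_integral_le _ _ _ _ _ (cst 1)) => //.
    exact: finite_measure_integrable_cst.
  move=> E mE; rewrite -!fE// integral_cst// mul1e.
  apply: le_measure; rewrite ?inE; [|exact: measurable_preimageT|exact: subIsetl].
  by apply: measurableI => //; exact: measurable_preimageT.
have mN : measurable N by exact: measurableU.
have N0 : muh N = 0 by exact: etrans (measureU0 mNN1 mNN2 N20) N10.
exists (fun q x => if x \in N then 0 else f q x); split.
- move=> q x; case: ifPn => [_|]; first by rewrite lexx lee01.
  rewrite notin_setE => /= Nx; have [-> _ _ _] /= := fP q.
  by rewrite leNgt; apply/negP => fx; apply: Nx; right; exists q.
- move=> q; apply: measurable_fun_ifT => //.
  exact: measurable_mem.
- move=> x q q' keptq'; case: ifPn => //; rewrite notin_setE => /= Nx.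
  rewrite leNgt; apply/negP => fx; apply: Nx; left; exists (q, q') => //.
  by rewrite /N1 keptq'.
- move=> C q mC; rewrite fE//; apply: ge0_ae_eq_integral => //.
  + exact: measurable_funTS.
  + apply: measurable_funTS; apply: measurable_fun_ifT => //.
    exact: measurable_mem.
  + by move=> x _; have [-> _ _ _] := fP q.
  + by move=> x _; case: ifP => // _; have [-> _ _ _] := fP q.
  + exists N; split => // x /= /not_implyP[_ fx]; apply: contrapT => Nx.
    by apply: fx; rewrite memNset.
Qed.

Definition unif : probability (measurableTypeR R) R := uniform_prob ltr01.

Lemma unif_lt (t : \bar R) : 0 <= t <= 1 -> unif [set u : R | u%:E < t] = t.
Proof.
case: t => [t| |]; [|by rewrite leye_eq andbF|by []].
rewrite !lee_fin => /andP[t0 t1].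
rewrite /unif/= /uniform_prob integral_uniform_pdf.
rewrite (_ : _ `&` _ = `[0%R, t[%classic); last first.
  apply/seteqP; split => x /=; rewrite !in_itv/= lte_fin.
    by move=> [-> /andP[-> _]].
  by move=> /andP[-> xt]; rewrite xt (ltW (lt_le_trans xt t1)).
rewrite (eq_integral (cst 1)); last first.
  move=> x; rewrite inE/= in_itv/= => /andP[x0 xt].
  by rewrite /uniform_pdf x0 (ltW (lt_le_trans xt t1)) subr0 invr1.
rewrite integral_cst//= mul1e lebesgue_measure_itv/= lte_fin.
by case: ltP => [_|t0']; rewrite ?sube0//; congr EFin; apply/le_anti; rewrite t0.
Qed.

Lemma measurable_lt_EFin d' (E : measurableType d') (f : E -> \bar R) :
  measurable_fun setT f ->
  measurable [set z : E * measurableTypeR R | (z.2 : R)%:E < f z.1].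
Proof.
move=> mf; rewrite -[X in measurable X]setTI; apply: measurable_lte => //.
  apply/measurable_EFinP; exact: measurable_snd.
exact: measurableT_comp.
Qed.

(** Quantile transform: Q0 (e, u) is the infimum of the rationals q such that
u < F q e, so that Q0 (e, u) < r iff u < F q e for some rational q < r. Hence
(h, Q0 (h, u)) and (h, phi) give the same mass to the rectangles
C * ]-oo, r[, and therefore have the same law. *)
Lemma noise_outsourcing : exists Q0 : S * measurableTypeR R -> \bar R,
  measurable_fun setT Q0 /\
  forall F : S -> \bar R, forall G : \bar R -> \bar R,
    measurable_fun setT F -> measurable_fun setT G ->
    (forall x, 0 <= F x) -> (forall x, 0 <= G x) ->
    \int[mu]_x (F (h x) * \int[unif]_u G (Q0 (h x, u))) =
    \int[mu]_x (F (h x) * G (phi x)%:E).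
Proof.
have [F [F01 mF ndF FE]] := cond_cdf.
pose A q := [set z : S * measurableTypeR R | (z.2 : R)%:E < F q z.1].
have mA q : measurable (A q) by exact: measurable_lt_EFin.
pose Q0 (z : S * measurableTypeR R) := ereal_inf [set (ratr q : R)%:E | q in [set q | A q z]].
have Q0lt (r : R) : Q0 @^-1` `]-oo, r%:E[ = \bigcup_(q in [set q | (ratr q < r)%R]) A q.
  apply/seteqP; split => [z|z [q /= qr Aq]]; rewrite /= in_itv/=.
    by move/ereal_inf_lt => [_ [q Aq <-]]; rewrite lte_fin => qr; exists q.
  by apply: le_lt_trans (_ : (ratr q)%:E < _); rewrite ?lte_fin//; apply: ereal_inf_lbound; exists q.
have mQ0 : measurable_fun setT Q0.
  apply: (measurability _ (ErealGenInftyO.measurableE R)).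
  move=> _ [_ [r ->] <-]; rewrite setTI Q0lt bigcup_mkcond.
  by apply: bigcupT_measurable_rat => q; case: ifP.
exists Q0; split=> // {}Fh G mFh mG Fh0 G0.
pose P : probability (S * measurableTypeR R)%type R := muh \x unif.
have mX1 : measurable_fun setT (fun x => (h x, (phi x)%:E)).
  by apply/measurable_fun_pair => //; exact/measurable_EFinP.
have mX2 : measurable_fun setT (fun z : S * measurableTypeR R => (z.1, Q0 z)).
  exact/measurable_fun_pair.
pose J1 : probability (S * \bar R)%type R := distribution mu (mfun_of mX1).
pose J2 : probability (S * \bar R)%type R := distribution P (mfun_of mX2).
have J12r C r : measurable C -> J1 (C `*` `]-oo, r%:E[%classic) = J2 (C `*` `]-oo, r%:E[%classic).
  move=> mC; rewrite /J1 /J2 /= /distribution /pushforward/=.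
  rewrite (_ : _ @^-1` _ = \bigcup_(q in [set q | (ratr q < r)%R]) (h @^-1` C `&` below q)); last first.
    rewrite -setI_bigcupr; apply/seteqP; split => x /=; rewrite in_itv/= lte_fin => -[Chx].
      move=> xr; split => //; have /rat_in_itvoo[q] := xr; rewrite in_itv/= => /andP[xq qr].
      by exists q.
    by move=> [q /= qr xq]; split => //; exact: lt_trans xq qr.
  rewrite [in RHS](_ : _ @^-1` _ = \bigcup_(q in [set q | (ratr q < r)%R]) ((C `*` setT) `&` A q)); last first.
    rewrite -setI_bigcupr -Q0lt; apply/seteqP; split => z /=.
      by move=> [Cz]; split.
    by move=> [[Cz _]]; split.
  have mCT : measurable (C `*` [set: measurableTypeR R]) by exact: measurableX.
  apply: (@nondecreasing_rat_bigcup_eq _ _ _ _ R mu P (fun q => h @^-1` C `&` below q)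
    (fun q => (C `*` setT) `&` A q) r).
  - by move=> q; apply: measurableI => //; exact: measurable_preimageT.
  - by move=> q; exact: measurableI.
  - move=> q q' keptq'; apply: setIS => x /= /lt_le_trans; apply.
    by rewrite ler_rat.
  - move=> q q' keptq'; apply: setIS => z /= /lt_le_trans; apply; exact: ndF.
  - move=> q; transitivity (\int[muh]_(x in C) F q x); first exact: FE.
    rewrite integral_mkcond /P /product_measure1/=.
    apply: eq_integral => x _; rewrite patchE /=; case: ifPn => xC.
      rewrite (_ : xsection _ _ = [set u | u%:E < F q x]) ?unif_lt//.
      apply/seteqP; split => u; rewrite /xsection/= inE/=; first by case.
      by move=> uF; split => //; split => //; rewrite inE in xC.
    rewrite (_ : xsection _ _ = set0) ?measure0//.
    apply/seteqP; split => u //; rewrite /xsection/= inE/= => -[[xC' _] _].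
    by move: xC; rewrite notin_setE.
have J12 : forall A, measurable A -> J1 A = J2 A.
  apply: (@probability_prod_unique _ _ S (\bar R) R ([set setT] `|` @ErealGenInftyO.G R) J1 J2).
  - have /= := ErealGenInftyO.measurableE R.
    move=> E; apply/seteqP; split => B.
      by rewrite /measurable/= E; apply: sub_smallest2r => // ? ?; right.
    apply: smallest_sub; first exact: sigma_algebra_measurable.
    by move=> _ [->|[r ->]]; [exact: measurableT|exact: emeasurable_itv].
  - move=> _ _ [->|[r ->]] [->|[r' ->]]; rewrite ?setTI ?setIT; [by left|by right; exists r'|by right; exists r|].
    right; exists (Num.min r r'); apply/seteqP; split => x /=; rewrite !in_itv/= EFin_min lt_min.
      by move=> [-> ->].
    by move/andP.
  - by left.
  - move=> C B mC [->|[r ->]]; last exact: J12r.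
    rewrite /J1 /J2 /= /distribution /pushforward/=.
    rewrite (_ : _ @^-1` _ = h @^-1` C); last by apply/seteqP; split => x // [].
    rewrite [in RHS](_ : _ @^-1` _ = C `*` setT); last by apply/seteqP; split => x [].
    have := @product_measure1E _ _ _ _ R muh unif C setT mC measurableT.
    move=> e; apply: etrans (esym e); rewrite -[LHS]mule1.
    by congr (_ * _); exact: esym (probability_setT unif).
pose FG (z : S * \bar R) := Fh z.1 * G z.2.
have mFG : measurable_fun setT FG.
  by apply: emeasurable_funM; [exact: measurableT_comp|exact: measurableT_comp].
have FG0 z : 0 <= FG z by exact: mule_ge0.
transitivity (\int[J2]_z FG z); last first.
  rewrite (eq_measure_integral J1); last by move=> A' mA' _; exact/esym/J12.
  rewrite /J1 /= /distribution/= ge0_integral_pushforward//.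
rewrite /J2 /= /distribution/= ge0_integral_pushforward// preimage_setT.
rewrite fubini_tonelli1//=; last first.
  exact: measurableT_comp.
rewrite /fubini_F /muh /distribution/= ge0_integral_pushforward//=.
- apply: eq_integral => x _; rewrite -ge0_integralZl//.
  by apply: measurableT_comp => //; apply: measurableT_comp.
- apply: (@measurable_fun_fubini_tonelli_F _ _ S (measurableTypeR R) R unif
    (FG \o (fun z => (z.1, Q0 z)))) => [|x]; last exact: FG0.
  exact: measurableT_comp.
- by move=> x _; exact: integral_ge0.
Qed.

(** Transport of the real-valued case along the retraction psi. *)
Lemma disintegration (psi : R -> S) : measurable_fun setT psi ->
  cancel phi psi ->
  exists Q : S * measurableTypeR R -> S, measurable_fun setT Q /\
  forall F G : S -> \bar R,
    measurable_fun setT F -> measurable_fun setT G ->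
    (forall x, 0 <= F x) -> (forall x, 0 <= G x) ->
    \int[mu]_x (F (h x) * \int[unif]_u G (Q (h x, u))) =
    \int[mu]_x (F (h x) * G x).
Proof.
move=> mpsi phiK; have [Q0 [mQ0 Q0E]] := noise_outsourcing.
have mpf : measurable_fun setT (psi \o fine) by exact: measurableT_comp.
exists (psi \o fine \o Q0); split; first exact: measurableT_comp.
move=> F G mF mG F0 G0.
rewrite (Q0E F (G \o psi \o fine)) => [||||x]//; last 2 first.
- exact: (@measurableT_comp _ _ _ _ _ _ G).
- exact: G0.
by under eq_integral do rewrite /= phiK.
Qed.

End noise_outsourcing.

End disintegration.

(** * Nonnegative measurable functions *)

Section nnm.
Local Open Scope ereal_scope.
Context {R : realType} {d} {S : measurableType d}.
Implicit Types (F G : S -> \bar R) (f g : S -> R).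

Definition nnm F := measurable_fun setT F /\ forall x, 0 <= F x.
Definition nnr f := measurable_fun setT f /\ forall x, (0 <= f x)%R.

Lemma nnmM F G : nnm F -> nnm G -> nnm (fun x => F x * G x).
Proof.
by move=> [mF F0] [mG G0]; split=> [|x]; [exact: emeasurable_funM|exact: mule_ge0].
Qed.

Lemma nnmD F G : nnm F -> nnm G -> nnm (fun x => F x + G x).
Proof.
by move=> [mF F0] [mG G0]; split=> [|x]; [exact: emeasurable_funD|exact: adde_ge0].
Qed.

Lemma nnm_sum (I : Type) (s : seq I) (F : I -> S -> \bar R) :
  (forall i, nnm (F i)) -> nnm (fun x => \sum_(i <- s) F i x).
Proof.
move=> nF; split=> [|x]; first by apply: emeasurable_sum => i; exact: (nF i).1.
by apply: sume_ge0 => i _; exact: (nF i).2.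
Qed.

Lemma nnm_EFin f : nnr f -> nnm (fun x => (f x)%:E).
Proof.
by move=> [mf f0]; split=> [|x]; [exact/measurable_EFinP|rewrite lee_fin].
Qed.

Lemma nnrM f g : nnr f -> nnr g -> nnr (fun x => f x * g x)%R.
Proof.
by move=> [mf f0] [mg g0]; split=> [|x]; [exact: measurable_funM|exact: mulr_ge0].
Qed.

Lemma nnrD f g : nnr f -> nnr g -> nnr (fun x => f x + g x)%R.
Proof.
by move=> [mf f0] [mg g0]; split=> [|x]; [exact: measurable_funD|exact: addr_ge0].
Qed.

(** Continuous away from 0, and 0 is sent to 0. *)
Lemma measurable_invr : measurable_fun setT (@GRing.inv R).
Proof.
rewrite (_ : @GRing.inv R = (fun x => if x == 0%R then 0%R else x^-1)%R); last first.
  by apply/funext => x; case: eqP => // ->; rewrite invr0.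
apply: measurable_fun_if => //.
- by apply: measurable_fun_eqr.
- rewrite setTI (_ : _ @^-1` _ = [set~ 0%R]); last first.
    by apply/seteqP; split => x /=; case: eqP.
  apply: open_continuous_measurable_fun; first by apply: closed_openC; exact: closed_eq.
  by move=> x; rewrite inE/= => /eqP x0; exact: inv_continuous.
Qed.

Lemma nnrV f : nnr f -> nnr (fun x => (f x)^-1)%R.
Proof.
move=> [mf f0]; split=> [|x]; last by rewrite invr_ge0.
exact: measurableT_comp measurable_invr mf.
Qed.

Lemma nnr_sqr f : nnr f -> nnr (fun x => f x ^+ 2)%R.
Proof.
move=> nf; rewrite (_ : (fun x => _) = (fun x => f x * f x)%R); first exact: nnrM.
by apply/funext => x; rewrite expr2.
Qed.

Lemma nnr_cst (r : R) : (0 <= r)%R -> nnr (fun=> r).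
Proof. by move=> r0; split. Qed.

Lemma nnm_cst (r : \bar R) : 0 <= r -> nnm (fun=> r).
Proof. by move=> r0; split. Qed.

Lemma nnr_indic (A : set S) : measurable A -> nnr (\1_A : S -> R).
Proof. by move=> mA; split. Qed.

Lemma nnm_indic (A : set S) : measurable A -> nnm (fun x => (\1_A x)%:E : \bar R).
Proof. by move=> mA; apply/nnm_EFin/nnr_indic. Qed.

End nnm.

Lemma nnr_comp (R : realType) d d' (S : measurableType d) (S' : measurableType d')
    (f : S -> R) (k : S' -> S) :
  nnr f -> measurable_fun setT k -> nnr (fun x => f (k x)).
Proof. by move=> [mf f0] mk; split=> // ; exact: measurableT_comp. Qed.

Lemma nnm_comp (R : realType) d d' (S : measurableType d) (S' : measurableType d')
    (F : S -> \bar R) (k : S' -> S) :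
  nnm F -> measurable_fun setT k -> nnm (fun x => F (k x)).
Proof. by move=> [mF F0] mk; split=> // ; exact: measurableT_comp. Qed.

Create HintDb nnm.
#[global] Hint Resolve nnmM nnmD nnm_EFin nnrM nnrD nnrV nnm_indic nnr_indic : nnm.

Lemma eq_integralT d (S : measurableType d) (R : realType) (m : {measure set S -> \bar R})
    (f g : S -> \bar R) : (forall x, f x = g x) -> (\int[m]_x f x = \int[m]_x g x)%E.
Proof. by move=> fg; congr (integral _ _ _); exact/funext. Qed.
Arguments eq_integralT {d S R m f g} _.

Lemma integral_prob_cst d (S : measurableType d) (R : realType)
    (P : probability S R) (r : \bar R) : (\int[P]_x (fun=> r) x = r)%E.
Proof.
rewrite integral_cst// -[RHS]mule1; congr (_ * _)%E; exact: probability_setT.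
Qed.

(** * Conditional expectation given a measurable projection *)

Section cond_exp.
Local Open Scope ereal_scope.
Context {R : realType} {d} {S : measurableType d} (mu : probability S R).
Variables (h : S -> S) (Q : S * measurableTypeR R -> S).
Hypotheses (mh : measurable_fun setT h) (mQ : measurable_fun setT Q).
Hypothesis hK : forall x, h (h x) = h x.
Hypothesis QE : forall F G : S -> \bar R,
  measurable_fun setT F -> measurable_fun setT G ->
  (forall x, 0 <= F x) -> (forall x, 0 <= G x) ->
  \int[mu]_x (F (h x) * \int[@unif R]_u G (Q (h x, u))) =
  \int[mu]_x (F (h x) * G x).

(** The conditional expectation of G given h under mu, when Q samples the
conditional law: a version that is defined everywhere and factors through h. *)
Definition cexp (G : S -> \bar R) (x : S) := \int[@unif R]_u G (Q (h x, u)).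

Lemma measurable_Qh : measurable_fun setT
  (fun z : S * measurableTypeR R => Q (h z.1, z.2)).
Proof.
apply: measurableT_comp => //; apply/measurable_fun_pair => //.
exact: measurableT_comp.
Qed.

Lemma nnm_cexp G : nnm G -> nnm (cexp G).
Proof.
move=> [mG G0]; split=> [|x]; last exact: integral_ge0.
apply: (@measurable_fun_fubini_tonelli_F _ _ S (measurableTypeR R) R (@unif R)
  (fun z => G (Q (h z.1, z.2)))) => //.
exact: measurableT_comp mG measurable_Qh.
Qed.

Lemma cexp_h G x : cexp G (h x) = cexp G x.
Proof. by rewrite /cexp hK. Qed.

Lemma cexp_ce F G : nnm F -> nnm G -> (forall x, F (h x) = F x) ->
  \int[mu]_x (F x * cexp G x) = \int[mu]_x (F x * G x).
Proof.
move=> [mF F0] [mG G0] Fh.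
transitivity (\int[mu]_x (F (h x) * \int[@unif R]_u G (Q (h x, u)))).
  by congr (integral _ _ _); apply/funext => x; rewrite Fh.
by rewrite QE//; apply: eq_integralT => x; rewrite Fh.
Qed.

(** Both sides are equal to the integral of cexp F * cexp G. *)
Lemma cexp_sym F G : nnm F -> nnm G ->
  \int[mu]_x (F x * cexp G x) = \int[mu]_x (cexp F x * G x).
Proof.
move=> nF nG; rewrite -(cexp_ce (nnm_cexp nF) nG (cexp_h F)).
under eq_integral do rewrite muleC.
rewrite -(cexp_ce (nnm_cexp nG) nF (cexp_h G)).
by apply: eq_integralT => x; rewrite muleC.
Qed.

Lemma cexp1 : cexp (fun=> 1) = fun=> 1.
Proof.
apply/funext => x; rewrite /cexp integral_cst// mul1e.
exact: (probability_setT (@unif R)).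
Qed.

Lemma le_cexp F G : nnm F -> nnm G -> (forall x, F x <= G x) ->
  forall x, cexp F x <= cexp G x.
Proof.
move=> [mF F0] [mG G0] FG x; apply: ge0_le_integral => //.
- exact: measurable_fun_pair2 (measurableT_comp mF measurable_Qh).
- exact: measurable_fun_pair2 (measurableT_comp mG measurable_Qh).
Qed.

Lemma cexp_ae_eq (F G : S -> \bar R) : nnm F -> nnm G ->
  mu.-integrable setT F -> mu.-integrable setT G ->
  (forall H, nnm H -> (forall x, H (h x) = H x) -> (forall x, H x <= 1) ->
    \int[mu]_x (H x * F x) = \int[mu]_x (H x * G x)) ->
  ae_eq mu setT (cexp F) (cexp G).
Proof.
move=> nF nG iF iG FG.
have nc1 : nnm (fun _ : S => 1 : \bar R) by apply: nnm_cst; rewrite lee_fin ler01.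
have icexp H : nnm H -> mu.-integrable setT H -> mu.-integrable setT (cexp H).
  move=> nH iH; apply/integrableP; split; first exact: (nnm_cexp nH).1.
  under eq_integral do rewrite gee0_abs ?(nnm_cexp nH).2//.
  have -> : \int[mu]_x cexp H x = \int[mu]_x H x.
    transitivity (\int[mu]_x (1 * cexp H x)); first by apply: eq_integralT => x; rewrite mul1e.
    by rewrite cexp_ce//; apply: eq_integralT => x; rewrite mul1e.
  move/integrableP : iH => [_]; under eq_integral do rewrite gee0_abs ?nH.2//.
  by [].
apply: integral_ae_eq => //; [exact: icexp|exact: (nnm_cexp nG).1|].
move=> E _ mE; have nE := nnm_indic (R := R) mE.
rewrite integral_mkcond [RHS]integral_mkcond.
have e H : \int[mu]_x ((cexp H \_ E) x) = \int[mu]_x ((\1_E x)%:E * cexp H x).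
  by apply: eq_integralT => x; rewrite muleC epatch_indic.
rewrite !e !cexp_sym//; apply: FG => [|x|x]; [exact: nnm_cexp|exact: cexp_h|].
rewrite -[X in _ <= X](_ : cexp (fun=> 1) x = 1); last by rewrite cexp1.
by apply: le_cexp => // y; rewrite lee_fin indicE; case: (_ \in _).
Qed.

Section one_step.
Variables a b m : S -> R.
Hypotheses (na : nnr a) (nb : nnr b) (nm : nnr m).
Hypothesis mh_m : forall x, m (h x) = m x.

(** Both sides describe the measure under which, given h, the points x and y are
independent with densities a / m and b / m, scaled by m; the description may
start from either point. The product F x * G y is integrated. *)
Lemma step_sym F G : nnm F -> nnm G ->
  \int[mu]_x (F x * (a x * (m x)^-1)%:E * cexp (fun y => (b y)%:E * G y) x) =
  \int[mu]_x (G x * (b x * (m x)^-1)%:E * cexp (fun y => (a y)%:E * F y) x).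
Proof.
move=> nF nG.
have naF : nnm (fun y => (a y)%:E * F y) by auto with nnm.
have nbG : nnm (fun y => (b y)%:E * G y) by auto with nnm.
have nmV : nnm (fun x => (m x)^-1%:E) by auto with nnm.
have sw (a' : S -> R) (F' G' : S -> \bar R) : 
    \int[mu]_x (F' x * (a' x * (m x)^-1)%:E * G' x) =
    \int[mu]_x (((m x)^-1%:E * G' x) * ((a' x)%:E * F' x)).
  apply: eq_integralT => x; rewrite EFinM (muleC (F' x)) -!muleA.
  by rewrite (muleCA (G' x)) (muleCA (m x)^-1%:E) (muleC (G' x)).
rewrite !sw -[LHS]cexp_ce//; last 2 first.
- exact: nnmM nmV (nnm_cexp nbG).
- by move=> x; rewrite mh_m cexp_h.
rewrite -[RHS]cexp_ce//; last 2 first.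
- exact: nnmM nmV (nnm_cexp naF).
- by move=> x; rewrite mh_m cexp_h.
by apply: eq_integralT => x; rewrite -!muleA [cexp _ x * _]muleC.
Qed.

Hypothesis ca : ae_eq mu setT (cexp (fun x => (a x)%:E)) (fun x => (m x)%:E).
Hypothesis cb : ae_eq mu setT (cexp (fun x => (b x)%:E)) (fun x => (m x)%:E).

(** Where the conditional expectation m of a vanishes, so does a; this makes the
convention 0^-1 = 0 harmless in the weights a / m. *)
Lemma step_null : {ae mu, forall x, m x = 0%R -> a x = 0%R}.
Proof.
pose A := m @^-1` [set 0%R].
have mA : measurable A by apply: measurable_preimageT (nm.1) _.
have nA := nnm_indic (R := R) mA.
have naE : nnm (fun x => (a x)%:E) by exact: nnm_EFin.
have nmE : nnm (fun x => (m x)%:E) by exact: nnm_EFin.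
have Ah x : (\1_A (h x))%:E = (\1_A x)%:E :> \bar R.
  rewrite !indicE (_ : (h x \in A) = (x \in A))//.
  by apply/idP/idP => /set_mem Ax; apply/mem_set; move: Ax; rewrite /A /= mh_m.
have i0 : \int[mu]_x `|(\1_A x)%:E * (a x)%:E| = 0.
  under eq_integral do rewrite gee0_abs ?(nnmM nA naE).2//.
  rewrite -cexp_ce//.
  transitivity (\int[mu]_x ((\1_A x)%:E * (m x)%:E)).
    apply: ge0_ae_eq_integral => //.
    - exact: (nnmM nA (nnm_cexp naE)).1.
    - exact: (nnmM nA nmE).1.
    - by move=> x _; exact: (nnmM nA (nnm_cexp naE)).2.
    - by move=> x _; exact: (nnmM nA nmE).2.
    - exact: ae_eqe_mul2l.
  apply: integral0_eq => x _; rewrite indicE; case: (boolP (x \in A)); last by rewrite mul0e.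
  by rewrite inE /A /= => ->; rewrite mule0.
have /(ae_eq_integral_abs mu measurableT (nnmM nA naE).1) := i0.
apply: filterS => x /(_ I) /= + mx0.
by rewrite indicE mem_set ?mul1e//; case.
Qed.

(** A function of h takes the same value at both points, so the b-point
integrates to m and cancels the division by m. *)
Lemma step_adapted F G : nnm F -> nnm G -> (forall x, G (h x) = G x) ->
  \int[mu]_x (F x * (a x * (m x)^-1)%:E * cexp (fun y => (b y)%:E * G y) x) =
  \int[mu]_x (F x * G x * (a x)%:E).
Proof.
move=> nF nG Gh; rewrite step_sym//.
have naF : nnm (fun y => (a y)%:E * F y) by auto with nnm.
have nmV : nnm (fun x => (m x)^-1%:E) by auto with nnm.
have nmE : nnm (fun x => (m x)%:E) by auto with nnm.
have nbE : nnm (fun x => (b x)%:E) by auto with nnm.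
have nW := nnmM (nnmM nG nmV) (nnm_cexp naF).
transitivity (\int[mu]_x ((G x * (m x)^-1%:E * cexp (fun y => (a y)%:E * F y) x) * (b x)%:E)).
  by apply: eq_integralT => x; rewrite EFinM -!muleA; congr (_ * _); rewrite muleC -!muleA.
rewrite -cexp_ce//; last by move=> x; rewrite Gh mh_m cexp_h.
transitivity (\int[mu]_x ((G x * (m x)^-1%:E * cexp (fun y => (a y)%:E * F y) x) * (m x)%:E)).
  apply: ge0_ae_eq_integral => //.
  - exact: (nnmM nW (nnm_cexp nbE)).1.
  - exact: (nnmM nW nmE).1.
  - by move=> x _; exact: (nnmM nW (nnm_cexp nbE)).2.
  - by move=> x _; exact: (nnmM nW nmE).2.
  - exact: ae_eqe_mul2l.
have nV := nnmM nG (nnmM nmV nmE).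
transitivity (\int[mu]_x ((G x * ((m x)^-1%:E * (m x)%:E)) * cexp (fun y => (a y)%:E * F y) x)).
  by apply: eq_integralT => x; rewrite -!muleA (muleC (cexp _ _)).
rewrite cexp_ce//; last by move=> x; rewrite Gh mh_m.
have nFGa : nnm (fun x => F x * G x * (a x)%:E) by auto with nnm.
apply: ge0_ae_eq_integral => //.
- exact: (nnmM nV naF).1.
- exact: nFGa.1.
- by move=> x _; exact: (nnmM nV naF).2.
- by move=> x _; exact: nFGa.2.
apply: filterS step_null => x a0 _.
have [m0|m0] := eqVneq (m x) 0%R; first by rewrite (a0 m0) mul0e !mule0.
by rewrite -EFinM mulVf// mule1 (muleC (F x)) -muleA (muleC (F x)).
Qed.

End one_step.
End cond_exp.

(** * Weighted push-forwards *)

Section weighted_pushforward.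
Local Open Scope ereal_scope.
Context {R : realType} {d d'} {O : measurableType d} {E : measurableType d'}.
Variables (P : probability O R) (w : O -> R) (Z : O -> E).
Hypotheses (nw : nnr w) (mZ : measurable_fun setT Z).

Definition wmeas of nnr w := fun A : set O => \int[P]_(x in A) (w x)%:E.

Local Notation W := (wmeas nw).

Let W0 : W set0 = 0. Proof. by rewrite /wmeas integral_set0. Qed.

Let W_ge0 A : 0 <= W A.
Proof. by apply: integral_ge0 => x _; rewrite lee_fin nw.2. Qed.

Let mwE : measurable_fun setT (fun x => (w x)%:E).
Proof. exact: (nnm_EFin nw).1. Qed.

Let W_sigma_additive : semi_sigma_additive W.
Proof.
move=> F mF tF mUF; rewrite /wmeas; apply: cvg_toP.
  apply: ereal_nondecreasing_is_cvgn => m n mn.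
  by apply: lee_sum_nneg_natr => // k _ _; exact: W_ge0.
rewrite ge0_integral_bigcup//=; first exact: measurable_funTS.
by move=> x _; rewrite lee_fin nw.2.
Qed.

HB.instance Definition _ := isMeasure.Build _ _ _ W W0 W_ge0 W_sigma_additive.

Hypothesis wfin : \int[P]_x (w x)%:E < +oo.

Let W_fin : fin_num_fun W.
Proof.
move=> A mA; rewrite ge0_fin_numE//; apply: le_lt_trans wfin.
by apply: ge0_subset_integral => // x _; rewrite lee_fin nw.2.
Qed.

(** The weight is the Radon-Nikodym derivative of the weighted measure. *)
Lemma integral_wmeas g : nnm g -> \int[W]_x g x = \int[P]_x (g x * (w x)%:E).
Proof.
move=> [mg g0].
pose W' : {finite_measure set O -> \bar R} :=
  HB.pack W (Measure_isFinite.Build _ _ _ W W_fin).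
have dom : W' `<< P.
  apply/null_content_dominatesP => A mA A0; rewrite /W'/= /wmeas.
  by apply: null_set_integral => //; exact: measurable_funTS.
rewrite -(Radon_Nikodym_SigmaFinite.change_of_variables (nu := W') dom)//.
have f0 := Radon_Nikodym_SigmaFinite.f_ge0 dom.
have fi := Radon_Nikodym_SigmaFinite.f_integrable dom.
apply: ge0_ae_eq_integral => //.
- by apply: emeasurable_funM => //; exact: measurable_int fi.
- exact: emeasurable_funM.
- by move=> x _; exact: mule_ge0.
- by move=> x _; apply: mule_ge0 => //; rewrite lee_fin nw.2.
apply: ae_eqe_mul2l; apply: integral_ae_eq => // A _ mA.
by rewrite -Radon_Nikodym_SigmaFinite.f_integral.
Qed.

Definition wpush of measurable_fun setT Z := fun A : set E => W (Z @^-1` A).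

Let mZA A : measurable A -> measurable (Z @^-1` A).
Proof. exact: measurable_preimageT. Qed.

Let push0 : wpush mZ set0 = 0. Proof. by rewrite /wpush preimage_set0 measure0. Qed.
Let push_ge0 A : 0 <= wpush mZ A. Proof. exact: measure_ge0. Qed.
Let push_sigma_additive : semi_sigma_additive (wpush mZ).
Proof.
move=> F mF tF mUF; rewrite /wpush preimage_bigcup.
apply: measure_semi_sigma_additive.
- by move=> n; exact: mZA.
- apply/trivIsetP => /= i j _ _ ij; rewrite -preimage_setI.
  by move/trivIsetP : tF => /(_ _ _ _ _ ij) ->//; rewrite preimage_set0.
- by rewrite -preimage_bigcup; exact: mZA.
Qed.

HB.instance Definition _ := isMeasure.Build _ _ _ (wpush mZ) push0 push_ge0 push_sigma_additive.

Lemma integral_wpush g : nnm g ->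
  \int[wpush mZ]_x g x = \int[P]_x (g (Z x) * (w x)%:E).
Proof.
move=> [mg g0].
transitivity (\int[pushforward W Z]_x g x); first by [].
rewrite ge0_integral_pushforward// preimage_setT integral_wmeas//.
by split=> [|x]; [exact: measurableT_comp|exact: g0].
Qed.

End weighted_pushforward.

(** * The entropy function *)

Section entropy_function.
Context {R : realType}.
Implicit Types r g x : R.

(** The integrand of relative entropy, normalised to be nonnegative with minimum
0 at 1. At r = 0 the convention ln 0 = 0 gives the right limit 1. *)
Definition entf r := r * ln r - r + 1.

Lemma entf0 : entf 0 = 1. Proof. by rewrite /entf mul0r subr0 add0r. Qed.

(** exp - 1 is the convex conjugate of entf. The proof is 1 + x <= exp x at
x = g - ln r. *)
Lemma fenchel_entf r g : 0 <= r -> r * g + 1 <= entf r + expR g.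
Proof.
rewrite le_eqVlt => /predU1P[<-|r0].
  by rewrite entf0 mul0r add0r lerDl expR_ge0.
have -> : expR g = r * expR (g - ln r).
  by rewrite expRB lnK// mulrCA divff ?mulr1// gt_eqF.
have := expR_ge1Dx (g - ln r); rewrite /entf.
move: (ln r) (expR _) => l e le; nra.
Qed.

Lemma entf_ge0 r : 0 <= r -> 0 <= entf r.
Proof. by move=> r0; have := fenchel_entf 0 r0; rewrite mulr0 add0r expR0 lerDr. Qed.

Let ndecr_from0 (f f' : R -> R) : (forall x, is_derive x 1 f (f' x)) ->
  (forall x, 0 < x -> 0 <= f' x) -> forall x, 0 <= x -> f 0 <= f x.
Proof.
move=> fd f'0 x x0.
apply: (@ger0_derive1_ndecry R f 0) => //; last first.
  by apply: derivable_within_continuous => y _; have [] := fd y.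
move=> y; rewrite in_itv/= andbT => y0; rewrite derive1E.
  by have [_ ->] := fd y; exact: f'0.

Qed.

Lemma double_le_expRB x : 0 <= x -> 2 * x <= expR x - expR (- x).
Proof.
move=> x0; rewrite -subr_ge0.
have -> : 0 = (fun y => expR y - expR (- y) - 2 * y) 0 :> R.
  by rewrite /= oppr0 expR0 mulr0 subrr subr0.
apply: (ndecr_from0 (f := fun y => expR y - expR (- y) - 2 * y) (f' := fun y => expR y + expR (- y) - 2)) => // y.
  apply: is_derive_eq => /=.
  rewrite /GRing.scale/=; ring.
move=> _; have e0 := expR_gt0 y; rewrite expRN.
have : 0 <= (expR y - 1) ^+ 2 / expR y by rewrite divr_ge0 ?sqr_ge0// ltW.
by congr (_ <= _); field; rewrite gt_eqF.
Qed.

Lemma le_expRN_quadratic x : 0 <= x ->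
  3 / 2 - 2 * expR (- x) + expR (- x) ^+ 2 / 2 <= x.
Proof.
move=> x0; rewrite -subr_ge0.
have -> : 0 = (fun y => y - (3 / 2 - 2 * expR (- y) + expR (- y) ^+ 2 / 2)) 0 :> R.
  by rewrite /= oppr0 expR0; lra.
apply: (ndecr_from0 (f := fun y => y - (3 / 2 - 2 * expR (- y) + expR (- y) ^+ 2 / 2)) (f' := fun y => (1 - expR (- y)) ^+ 2)) => // y.
  apply: is_derive_eq => /=.
  rewrite /GRing.scale/=; field.
  by [].
by move=> _; exact: sqr_ge0.
Qed.

(** In the variable x = ln r this is [le_expRN_quadratic]. *)
Lemma entf_ge_above r : 1 <= r -> (r - 1) ^+ 2 <= 2 * (r * entf r).
Proof.
move=> r1; have r0 : 0 < r by exact: lt_le_trans r1.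
have := le_expRN_quadratic (ln_ge0 r1); rewrite expRN lnK// /entf => h.
have {h} := ler_wpM2l (sqr_ge0 r) h.
have -> : r ^+ 2 * (3 / 2 - 2 * r^-1 + r^-1 ^+ 2 / 2) = r ^+ 2 * (3 / 2) - 2 * r + 1 / 2.
  by field; rewrite gt_eqF.
move: (ln r) => l; lra.
Qed.

(** In the variable x = - ln r this is [double_le_expRB]. *)
Lemma entf_ge_below r : 0 <= r -> r <= 1 -> (1 - r) ^+ 2 <= 2 * entf r.
Proof.
rewrite le_eqVlt => /predU1P[<- _|r0 r1]; first by rewrite entf0 subr0 expr1n; lra.
have l0 : 0 <= - ln r by rewrite oppr_ge0 ln_le0.
have := double_le_expRB l0; rewrite opprK expRN lnK// /entf => h.
have {h} := ler_wpM2l (ltW r0) h; rewrite mulrBr divff ?gt_eqF//.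
move: (ln r) => l; lra.
Qed.

Lemma measurable_entf : measurable_fun setT entf.
Proof.
apply: measurable_funD => //; apply: measurable_funB => //.
by apply: measurable_funM => //; exact: measurable_ln.
Qed.

Lemma nnr_entf d (S : measurableType d) (f : S -> R) : nnr f -> nnr (entf \o f).
Proof.
move=> [mf f0]; split=> [|x]; last exact: entf_ge0.
exact: measurableT_comp measurable_entf mf.
Qed.

(** The bound is optimal at e = sqrt (B / A). This is how the Cauchy-Schwarz
inequality is obtained from the arithmetic-geometric mean inequality, without
having to discuss integrability beforehand. *)
Lemma optimize_eps (X A B : R) : 0 <= A -> 0 <= B ->
  (forall e, 0 < e -> X <= e / 2 * A + B / (2 * e)) -> X <= Num.sqrt (A * B).
Proof.
move=> A0 B0 XAB.
apply/ler_addgt0Pr => e e0.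
have [A00|A1] := eqVneq A 0.
  rewrite A00 mul0r sqrtr0 add0r.
  have e1 : 0 < (B + 1) / (2 * e) by rewrite divr_gt0 ?mulr_gt0// ltr_wpDl.
  apply: le_trans (XAB _ e1) _; rewrite A00 mulr0 add0r.
  have -> : B / (2 * ((B + 1) / (2 * e))) = e * (B / (B + 1)).
    by field; rewrite !gt_eqF// ltr_wpDl.
  by rewrite ler_piMr ?(ltW e0)// ler_pdivrMr ?ltr_wpDl// mul1r lerDl.
have [B00|B1] := eqVneq B 0.
  rewrite B00 mulr0 sqrtr0 add0r.
  have Ap : 0 < A by rewrite lt_neqAle eq_sym A1.
  have e1 : 0 < 2 * e / A by rewrite divr_gt0 ?mulr_gt0.
  apply: le_trans (XAB _ e1) _; rewrite B00 mul0r addr0.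
  by rewrite mulrAC mulfVK ?gt_eqF//  mulrC mulKf.
have Ap : 0 < A by rewrite lt_neqAle eq_sym A1.
have Bp : 0 < B by rewrite lt_neqAle eq_sym B1.
have [s0 t0] : 0 < Num.sqrt A /\ 0 < Num.sqrt B by rewrite !sqrtr_gt0.
apply: le_trans (XAB (Num.sqrt B / Num.sqrt A) _) _; first by rewrite divr_gt0.
rewrite sqrtrM// -[X in _ / _ / _ * X](sqr_sqrtr A0) -[X in _ + X / _](sqr_sqrtr B0).
rewrite -[X in X <= _]addr0 lerD ?(ltW e0)// le_eqVlt; apply/orP; left; apply/eqP.
by field; rewrite !gt_eqF.
Qed.

End entropy_function.

(** * Chain rule for the entropy of a martingale *)

(** One step of a martingale: D' has conditional expectation D given D (stated by
testing against functions of D), and a is any function controlled by the entropy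
of the increment D' / D. *)
Section entropy_chain.
Context {R : realType} {d} {S : measurableType d} (mu : probability S R).
Variables D D' a : S -> R.
Hypotheses (nD : nnr D) (nD' : nnr D') (na : nnr a).
Hypothesis DD' : forall phi : R -> \bar R, nnm phi ->
  (\int[mu]_x (phi (D x) * (D x)%:E) = \int[mu]_x (phi (D x) * (D' x)%:E))%E.
Hypothesis aD : forall x, 0 < D x -> a x ^+ 2 <= 2 * (D x * entf (D' x / D x)).
Hypothesis aD0 : forall x, D x = 0 -> a x = 0.

(** The range of D is truncated away from 0 and from infinity, except that the
value 0 itself is kept: there ln D = 0 and D' vanishes almost surely, so that no
separate treatment is needed in the limit. *)
Let level (n : nat) : set R := `[0, n.+1%:R] `&` ([set 0] `|` `[n.+1%:R^-1, +oo[).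

Let mlevel n : measurable (level n).
Proof. by apply: measurableI => //; apply: measurableU. Qed.

Let I n (r : R) : R := \1_(level n) r.

Let nnrI n : nnr (I n). Proof. exact: nnr_indic. Qed.

Let M n : R := ln n.+1%:R.

Let M_ge0 n : 0 <= M n. Proof. by rewrite ln_ge0// ler1n. Qed.

Let ln_level n r : level n r -> - M n <= ln r <= M n.
Proof.
rewrite /level /= !in_itv/= andbT => -[/andP[r0 rn] [->|nr]].
  by rewrite ln0// oppr_le0 M_ge0.
have r1 : 0 < r by apply: lt_le_trans nr; rewrite invr_gt0.
by rewrite /M -lnV ?posrE// !ler_ln ?posrE ?invr_gt0// nr rn.
Qed.

(** On a level set |ln r| <= M, so M and M - ln r are nonnegative; writing
ln D as their difference keeps all integrands nonnegative. *)
Let p1 n r : R := I n r * M n.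
Let p2 n r : R := I n r * (M n - ln r).

Let np1 n : nnr (p1 n). Proof. apply: nnrM; [exact: nnrI | exact/nnr_cst/M_ge0]. Qed.

Let np2 n : nnr (p2 n).
Proof.
split=> [|r].
  apply: measurable_funM; first exact: (nnrI n).1.
  by apply: measurable_funB => //; exact: measurable_ln.
rewrite /p2 /I indicE; case: (boolP (r \in level n)) => [/set_mem/ln_level/andP[_ ?]|_]; rewrite ?mul0r// mul1r subr_ge0//.
Qed.

Let bounded n (f : R -> R) (b : R) : 0 <= b -> nnr f -> (forall r, f r <= I n r * b) ->
  (\int[mu]_x ((f (D x))%:E * (D x)%:E) \is a fin_num)%E.
Proof.
move=> b0 nf fb; have nfD := nnmM (nnm_EFin (nnr_comp nf nD.1)) (nnm_EFin nD).
rewrite ge0_fin_numE; last by apply: integral_ge0 => x _; exact: nfD.2.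
apply: (@le_lt_trans _ _ (\int[mu]_x (cst (b * n.+1%:R)%:E x))%E); last first.
  by rewrite integral_prob_cst ltry.
apply: ge0_le_integral => //.
- by move=> x _; exact: nfD.2.
- exact: nfD.1.
- move=> x _; rewrite /= -EFinM lee_fin.
  apply: (@le_trans _ _ (I n (D x) * b * D x)); first by rewrite ler_wpM2r ?nD.2.
  rewrite /I indicE; case: (boolP (_ \in _)) => [/set_mem[]|_]; last first.
    by rewrite !mul0r mulr_ge0.
  by rewrite /= in_itv/= => /andP[_ Dn] _; rewrite mul1r ler_wpM2l.
Qed.

Let fin1 n : (\int[mu]_x ((p1 n (D x))%:E * (D x)%:E) \is a fin_num)%E.
Proof. exact: (bounded (n := n) (M_ge0 n) (np1 n)). Qed.

Let fin2 n : (\int[mu]_x ((p2 n (D x))%:E * (D x)%:E) \is a fin_num)%E.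
Proof.
apply: (bounded (n := n) (b := 2 * M n)) => //; first by rewrite mulr_ge0.
move=> r; rewrite /p2 /I indicE; case: (boolP (_ \in _)) => [/set_mem/ln_level|_].
  by rewrite !mul1r => /andP[] *; lra.
by rewrite !mul0r.
Qed.

Let D0D' : {ae mu, forall x, D x = 0 -> D' x = 0}.
Proof.
have nz : nnm (fun r : R => (\1_[set 0%R] r)%:E : \bar R) by exact: nnm_indic.
have := DD' nz; rewrite integral0_eq => [|x _]; last first.
  rewrite indicE; case: (boolP (_ \in _)) => [/set_mem ->|_]; rewrite ?mule0 ?mul0e//.
have nz1 : nnr (\1_[set 0%R] : R -> R) by exact: nnr_indic.
have nzD' := nnmM (nnm_EFin (nnr_comp nz1 nD.1)) (nnm_EFin nD').
move=> e; have : ae_eq mu setT (fun x => (\1_[set 0%R] (D x))%:E * (D' x)%:E)%E (cst 0%E).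
  apply/(ae_eq_integral_abs _ measurableT nzD'.1); rewrite [RHS]e.
  by apply: eq_integralT => x; rewrite gee0_abs//; exact: nzD'.2.
apply: filterS => x /(_ Logic.I) h Dx0; move: h; rewrite Dx0 indicE mem_set//= mul1e.
by case.
Qed.

Let half x : R := a x ^+ 2 / 2 + entf (D x).

Let nhalf : nnr half.
Proof.
apply: nnrD; last exact: nnr_entf.
apply: nnrM; last by apply: nnr_cst; rewrite invr_ge0.
by rewrite (_ : (fun x => a x ^+ 2) = (fun x => a x * a x)); [exact: nnrM|apply/funext => x; rewrite expr2].
Qed.

(** The pointwise chain rule: entf D' equals
D * entf (D' / D) + entf D + (D' - D) * ln D, and the last term is killed by the
martingale property after integration. *)
Let key x : (D x = 0 -> D' x = 0) ->
  half x + D' x * ln (D x) <= entf (D' x) + D x * ln (D x).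
Proof.
move=> D0; have [D00|Dx0] := eqVneq (D x) 0.
  by rewrite /half (aD0 D00) D0// D00 expr0n/= mul0r add0r.
have Dp : 0 < D x by rewrite lt_neqAle eq_sym Dx0 nD.2.
have -> : entf (D' x) = D x * entf (D' x / D x) + entf (D x) + (D' x - D x) * ln (D x).
  have [->|D'0] := eqVneq (D' x) 0.
    by rewrite mul0r entf0 /entf; ring.
  have D'p : 0 < D' x by rewrite lt_neqAle eq_sym D'0 nD'.2.
  by rewrite /entf ln_div ?posrE//; field.
by have := aD Dp; rewrite /half; lra.
Qed.

Let level_step n :
  (\int[mu]_x ((I n (D x))%:E * (half x)%:E) <= \int[mu]_x (entf (D' x))%:E)%E.
Proof.
have nID := nnr_comp (nnrI n) nD.1.
have nIh := nnmM (nnm_EFin nID) (nnm_EFin nhalf).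
have nIh' := nnmM (nnm_EFin nID) (nnm_EFin (nnr_entf nD')).
have nh' := nnm_EFin (nnr_entf nD').
have n1D := nnmM (nnm_EFin (nnr_comp (np1 n) nD.1)) (nnm_EFin nD).
have n2D := nnmM (nnm_EFin (nnr_comp (np2 n) nD.1)) (nnm_EFin nD).
have n1D' := nnmM (nnm_EFin (nnr_comp (np1 n) nD.1)) (nnm_EFin nD').
have n2D' := nnmM (nnm_EFin (nnr_comp (np2 n) nD.1)) (nnm_EFin nD').
have f1 := fin1 n; have f2 := fin2 n.
have e1 := DD' (nnm_EFin (np1 n)); have e2 := DD' (nnm_EFin (np2 n)).
suff : (\int[mu]_x ((I n (D x))%:E * (half x)%:E) +
     (\int[mu]_x ((p1 n (D x))%:E * (D x)%:E) + \int[mu]_x ((p2 n (D x))%:E * (D x)%:E)) <=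
   \int[mu]_x (entf (D' x))%:E +
     (\int[mu]_x ((p1 n (D x))%:E * (D x)%:E) + \int[mu]_x ((p2 n (D x))%:E * (D x)%:E)))%E.
  by rewrite leeD2rE// fin_numD f1.
(* Exchanging D and D' on opposite sides leaves the pointwise chain rule. *)
rewrite {1}e1 {2}e2.
rewrite -!ge0_integralD//; try by [exact: n1D.1|exact: n2D.1|exact: n1D'.1|exact: n2D'.1|exact: nIh.1|exact: nh'.1|
  exact: (nnmD n1D n2D').1|exact: (nnmD n1D' n2D).1|
  move=> x _; exact: n1D.2|move=> x _; exact: n2D.2|move=> x _; exact: n1D'.2|move=> x _; exact: n2D'.2|
  move=> x _; exact: nIh.2|move=> x _; exact: nh'.2|move=> x _; exact: (nnmD n1D n2D').2|move=> x _; exact: (nnmD n1D' n2D).2].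
apply: ae_ge0_le_integral => //.
- by move=> x _; exact: (nnmD nIh (nnmD n1D' n2D)).2.
- exact: (nnmD nIh (nnmD n1D' n2D)).1.
- by move=> x _; exact: (nnmD nh' (nnmD n1D n2D')).2.
- exact: (nnmD nh' (nnmD n1D n2D')).1.
apply: filterS D0D' => x /key kx _; rewrite -!EFinM -!EFinD lee_fin /p1 /p2.
have h0 := entf_ge0 (nD'.2 x); rewrite /I indicE; case: (_ \in _); rewrite ?mul0r ?add0r ?addr0// !mul1r.
lra.
Qed.

(** The pointwise chain rule is integrated on each level set, where ln D is
bounded, and the level sets exhaust the space. *)
Lemma entropy_chain :
  (\int[mu]_x (a x ^+ 2 / 2 + entf (D x))%:E <= \int[mu]_x (entf (D' x))%:E)%E.
Proof.
have -> : (\int[mu]_x (a x ^+ 2 / 2 + entf (D x))%:E =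
    \int[mu]_(x in \bigcup_n D @^-1` level n) (half x)%:E)%E.
  congr (integral _ _ _); apply/esym/seteqP; split => // x _.
  (* A level n with 1 / (n + 1) <= D x <= n + 1 exceeds both D x and its inverse. *)
  pose u := (D x)^-1 + D x; have u0 : 0 <= u by rewrite addr_ge0 ?invr_ge0 ?nD.2.
  have un : u < (Num.truncn u).+1%:R by exact: truncnS_gt.
  exists (Num.truncn u) => //; split=> /=.
    rewrite in_itv/= nD.2/= (le_trans _ (ltW un))// /u lerDr invr_ge0 nD.2//.
  have [->|Dx0] := eqVneq (D x) 0; first by left.
  have Dp : 0 < D x by rewrite lt_neqAle eq_sym Dx0 nD.2.
  right; rewrite /= in_itv/= andbT invf_ple ?posrE//.
  by rewrite (le_trans _ (ltW un))// /u lerDl nD.2.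
have mB n : measurable (D @^-1` level n) by rewrite -[X in measurable X]setTI; exact: nD.1.
have nh := nnm_EFin nhalf.
have cv : (\int[mu]_(x in D @^-1` level n) (half x)%:E)%E @[n --> \oo] -->
    (\int[mu]_(x in \bigcup_n D @^-1` level n) (half x)%:E)%E.
  apply: ge0_nondecreasing_set_cvg_integral => //.
  - move=> n m nm; apply/subsetPset => x [].
    have nm1 : (n.+1%:R : R) <= m.+1%:R by rewrite ler_nat ltnS.
    rewrite /= !in_itv/= andbT => /andP[Dx0 Dxn] Dx; split=> /=.
      by rewrite in_itv/= Dx0/= (le_trans Dxn).
    case: Dx => [->|Dx]; [by left|right].
    by rewrite /= in_itv/= andbT (le_trans _ Dx)// lef_pV2 ?posrE.
  - by move=> n; apply: measurable_funTS; exact: nh.1.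
  - by move=> n x _; exact: nh.2.
rewrite -(cvg_lim _ cv)//; apply: lime_le; first by apply/cvg_ex; eexists; exact: cv.
apply: nearW => n; rewrite integral_mkcond.
rewrite (eq_integralT (g := fun x => ((I n (D x))%:E * (half x)%:E)%E)); first exact: level_step.
move=> x; rewrite epatch_indic /I /= muleC !indicE.
by congr (_%:R%:E * _)%E; apply/idP/idP => /set_mem ?; apply/mem_set.
Qed.

End entropy_chain.

(** * Transport-entropy estimate *)

Section transport_bound.
Context {R : realType} {d} {S : measurableType d} (mu : probability S R).
Variables (f : S -> R) (E : R).
Hypothesis nf : nnr f.
Hypothesis fE : (\int[mu]_x (expR (f x ^+ 2))%:E = E%:E)%E.

Let nexp (g : S -> R) : measurable_fun setT g -> nnr (fun x => expR (g x)).
Proof. by move=> mg; split=> [|x]; [exact: measurableT_comp|exact: expR_ge0]. Qed.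

Let le_int (g1 g2 : S -> R) : nnr g1 -> nnr g2 -> (forall x, g1 x <= g2 x) ->
  (\int[mu]_x (g1 x)%:E <= \int[mu]_x (g2 x)%:E)%E.
Proof.
move=> /nnm_EFin n1 /nnm_EFin n2 g12; apply: ge0_le_integral => //.
- by move=> x _; exact: n1.2.
- exact: n1.1.
- exact: n2.1.
- by move=> x _; rewrite lee_fin.
Qed.

Let int_add (g1 g2 : S -> R) : nnr g1 -> nnr g2 ->
  (\int[mu]_x (g1 x + g2 x)%:E = \int[mu]_x (g1 x)%:E + \int[mu]_x (g2 x)%:E)%E.
Proof.
move=> /nnm_EFin n1 /nnm_EFin n2; rewrite -ge0_integralD//.
- by move=> x _; exact: n1.2.
- exact: n1.1.
- by move=> x _; exact: n2.2.
- exact: n2.1.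
Qed.

Let int_scale (k : R) (g : S -> R) : 0 <= k -> nnr g ->
  (\int[mu]_x (k * g x)%:E = k%:E * \int[mu]_x (g x)%:E)%E.
Proof.
move=> k0 /nnm_EFin ng; rewrite -ge0_integralZl//.
- exact: ng.1.
- by move=> x _; exact: ng.2.
Qed.

Let E_ge1 : 1 <= E.
Proof.
rewrite -lee_fin -fE -(integral_prob_cst mu 1).
apply: (@le_int (fun=> 1) (fun x => expR (f x ^+ 2))).
- exact: nnr_cst.
- exact: nexp (nnr_sqr nf).1.
- by move=> x; rewrite -[leLHS]expR0 ler_expR sqr_ge0.
Qed.

Let L := ln E.

Let L_ge0 : 0 <= L. Proof. exact: ln_ge0. Qed.

(** The Gibbs variational bound, by integrating the Fenchel inequality at
g = f^2 - L, whose exponential has integral 1. *)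
Lemma donsker_varadhan (r : S -> R) (H : R) : nnr r -> (\int[mu]_x (r x)%:E = 1)%E ->
  (\int[mu]_x (entf (r x))%:E = H%:E)%E ->
  (\int[mu]_x (f x ^+ 2 * r x)%:E <= (H + L)%:E)%E.
Proof.
move=> nr r1 rH.
have E0 : 0 < E by exact: lt_le_trans E_ge1.
have nfr := nnrM (nnr_sqr nf) nr.
have ne : nnr (fun x => expR (f x ^+ 2)) by exact: nexp (nnr_sqr nf).1.
have n1 : nnr (fun _ : S => 1 : R) by exact: nnr_cst.
have nh := nnr_entf nr.
have nLr : nnr (fun x => L * r x) by apply: nnrM => //; exact: nnr_cst.
have neE : nnr (fun x => E^-1 * expR (f x ^+ 2)).
  by apply: nnrM => //; apply: nnr_cst; rewrite invr_ge0 ltW.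
have : (\int[mu]_x (f x ^+ 2 * r x + 1)%:E <=
    \int[mu]_x (entf (r x) + (E^-1 * expR (f x ^+ 2) + L * r x))%:E)%E.
  apply: le_int; [exact: nnrD|exact: nnrD nh (nnrD neE nLr)|move=> x].
  have := fenchel_entf (f x ^+ 2 - L) (nr.2 x).
  rewrite expRB /L lnK// (mulrC E^-1).
  by move: (ln E) (expR _ / E) => l e; lra.
rewrite int_add// (int_add nh (nnrD neE nLr)) (int_add neE nLr).
rewrite (int_scale _ ne) ?invr_ge0 ?(ltW E0)// (int_scale _ nr)//.
rewrite rH fE r1 integral_prob_cst -EFinM mulVf ?gt_eqF// mule1.
rewrite addeCA addeC leeD2lE//.
Qed.

Let optimizeE (X : \bar R) (A B : R) : 0 <= A -> 0 <= B -> (0 <= X)%E ->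
  (forall e, 0 < e -> (X <= (e / 2 * A + B / (2 * e))%:E)%E) ->
  (X <= (Num.sqrt (A * B))%:E)%E.
Proof.
move=> A0 B0; case: X => [x _ h|_ /(_ 1 ltr01)|//]; last by rewrite leye_eq.
by rewrite lee_fin; apply: optimize_eps => // e /h; rewrite lee_fin.
Qed.

Let young (x y e : R) : 0 < e -> x * y <= e / 2 * x ^+ 2 + y ^+ 2 / (2 * e).
Proof.
move=> e0; rewrite -subr_ge0.
have -> : e / 2 * x ^+ 2 + y ^+ 2 / (2 * e) - x * y = (e * x - y) ^+ 2 / (2 * e).
  by field; rewrite gt_eqF.
by rewrite divr_ge0 ?sqr_ge0// mulr_ge0// ltW.
Qed.

(** Cauchy-Schwarz for X^2 <= u * v, in the form of a family of linear bounds. *)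
Let weighted (u v X : S -> R) (A B : R) :
  nnr u -> nnr v -> nnr X -> 0 <= A -> 0 <= B ->
  (\int[mu]_x (u x)%:E <= A%:E)%E -> (\int[mu]_x (v x)%:E <= B%:E)%E ->
  (forall e x, 0 < e -> X x <= e / 2 * u x + (2 * e)^-1 * v x) ->
  (\int[mu]_x (X x)%:E <= (Num.sqrt (A * B))%:E)%E.
Proof.
move=> nu nv nX A0 B0 uA vB Xuv; apply: optimizeE => //.
  by apply: integral_ge0 => x _; exact: (nnm_EFin nX).2.
move=> e e0; have e2 : 0 <= e / 2 by rewrite divr_ge0// ltW.
have e2' : 0 <= (2 * e)^-1 by rewrite invr_ge0 mulr_ge0// ltW.
have neu : nnr (fun x => e / 2 * u x) by apply: nnrM => //; exact: nnr_cst.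
have nev : nnr (fun x => (2 * e)^-1 * v x) by apply: nnrM => //; exact: nnr_cst.
apply: (@le_trans _ _ (\int[mu]_x (e / 2 * u x + (2 * e)^-1 * v x)%:E)%E).
  by apply: le_int => [//||x]; [exact: nnrD|exact: Xuv].
rewrite (int_add neu nev) (int_scale _ nu)// (int_scale _ nv)// EFinD (EFinM (e / 2) A) (mulrC B) (EFinM _ B).
by apply: leeD; apply: lee_wpmul2l; rewrite ?lee_fin.
Qed.

Variables (D c : S -> R) (H : R) (T : nat).
Hypotheses (nD : nnr D) (nc : nnr c).
Hypotheses (c1 : forall x, c x <= 1) (cD : forall x, c x <= D x).
Hypothesis D1 : (\int[mu]_x (D x)%:E = 1)%E.
Hypothesis DH : (\int[mu]_x (entf (D x))%:E = H%:E)%E.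
Hypothesis cH : (\int[mu]_x ((1 - c x) ^+ 2)%:E <= (T%:R * (2 * H))%:E)%E.

Let H_ge0 : 0 <= H.
Proof.
rewrite -lee_fin -DH; apply: integral_ge0 => x _.
exact: (nnm_EFin (nnr_entf nD)).2.
Qed.

Let HL_ge0 : 0 <= H + L. Proof. by rewrite addr_ge0. Qed.

Let n1c : nnr (fun x => 1 - c x).
Proof. by split=> [|x]; [apply: measurable_funB => //; exact: nc.1|rewrite subr_ge0]. Qed.

Let int_f2 : (\int[mu]_x (f x ^+ 2)%:E <= L%:E)%E.
Proof.
have n1 : nnr (fun _ : S => 1 : R) by exact: nnr_cst.
have := @donsker_varadhan (fun=> 1) 0 n1; rewrite add0r.
rewrite (eq_integralT (f := fun x => (f x ^+ 2 * 1)%:E) (g := fun x => (f x ^+ 2)%:E)) => [|x]; last by rewrite mulr1.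
apply; first exact: integral_prob_cst.
by rewrite /entf ln1 mulr0 sub0r addrC subrr integral_prob_cst.
Qed.

Let int_lost : (\int[mu]_x (f x * (1 - c x))%:E <= (Num.sqrt (L * (T%:R * (2 * H))))%:E)%E.
Proof.
apply: (weighted (u := fun x => f x ^+ 2) (v := fun x => (1 - c x) ^+ 2)) => //.
- exact: nnr_sqr.
- exact: nnr_sqr.
- exact: nnrM.
- by rewrite !mulr_ge0.
- by move=> e x e0; rewrite (mulrC (2 * e)^-1); exact: young.
Qed.

Let excess x := Num.max (D x - 1) 0.

Let nexcess : nnr (fun x => f x * excess x).
Proof.
apply: nnrM => //; split=> [|x]; last by rewrite le_max lexx orbT.
by apply: measurable_maxr => //; apply: measurable_funB => //; exact: nD.1.
Qed.

(** (r - 1)^2 <= 2 * r * entf r for r >= 1 yields sqrt ((H + L) * 2 H), which is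
good enough when H <= 1. For larger H it suffices that (D - 1)^+ <= D and that D
is a probability density, which yields sqrt (H + L). *)
Let int_excess : (\int[mu]_x (f x * excess x)%:E <= (Num.sqrt ((1 + L) * (2 * H)))%:E)%E.
Proof.
have nfD := nnrM (nnr_sqr nf) nD.
have fD : (\int[mu]_x (f x ^+ 2 * D x)%:E <= (H + L)%:E)%E by exact: donsker_varadhan.
have [H1|H1] := leP H 1.
  have le1 : (\int[mu]_x (f x * excess x)%:E <= (Num.sqrt ((H + L) * (2 * H)))%:E)%E.
    apply: (weighted (u := fun x => f x ^+ 2 * D x) (v := fun x => 2 * entf (D x))) => //.
    - by apply: nnrM; [exact: nnr_cst|exact: nnr_entf].
    - by rewrite mulr_ge0.
    - by rewrite int_scale ?DH//; exact: nnr_entf.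
    - move=> e x e0; have f0 := nf.2 x; have h0 := entf_ge0 (nD.2 x).
      rewrite /excess; have [D1x|D1x] := leP (D x - 1) 0.
        by rewrite mulr0 addr_ge0// mulr_ge0 ?divr_ge0 ?invr_ge0 ?mulr_ge0 ?sqr_ge0 ?nD.2// ltW.
      have Dx1 : 1 <= D x by lra.
      have Dx0 : 0 < D x by lra.
      have h := entf_ge_above Dx1.
      apply: le_trans (young (f x) (D x - 1) (e := e * D x) _) _; first exact: mulr_gt0.
      rewrite -[e * D x / 2 * _](_ : e / 2 * (f x ^+ 2 * D x) = _); last by field.
      rewrite lerD2l ler_pdivrMr ?mulr_gt0//.
      rewrite -[leRHS](_ : 2 * (D x * entf (D x)) = _)//; first by field; rewrite gt_eqF.
  apply: le_trans le1 _; rewrite lee_fin ler_wsqrtr// ler_wpM2r ?mulr_ge0// lerD2r//.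
have le1 : (\int[mu]_x (f x * excess x)%:E <= (Num.sqrt ((H + L) * 1))%:E)%E.
  apply: (weighted (u := fun x => f x ^+ 2 * D x) (v := D)) => //; first by rewrite D1.
  move=> e x e0; have f0 := nf.2 x; have Dx0 := nD.2 x.
  apply: (@le_trans _ _ (f x * 1 * D x)).
    by rewrite mulr1 ler_wpM2l// /excess ge_max Dx0 andbT; lra.
  have := young (f x) 1 e0; rewrite expr1n => /(ler_wpM2r Dx0).
  by rewrite mulrDl !mul1r -!mulrA.
apply: le_trans le1 _; rewrite lee_fin ler_wsqrtr// mulr1.
have := L_ge0; move: L => l l0; nra.
Qed.

(** D - c <= (D - 1)^+ + (1 - c) pointwise, so the integral of f * (1 - c) occurs
twice and the integral of f * (D - 1)^+ once. *)
Lemma transport_bound :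
  (\int[mu]_x (f x * (1 - c x))%:E + \int[mu]_x (f x * (D x - c x))%:E <=
   ((2 * Num.sqrt T%:R + 1) * Num.sqrt (1 + L) * Num.sqrt (2 * H))%:E)%E.
Proof.
have L1 : 0 <= 1 + L by rewrite addr_ge0.
have le1 : (\int[mu]_x (f x * (D x - c x))%:E <=
    \int[mu]_x (f x * excess x)%:E + \int[mu]_x (f x * (1 - c x))%:E)%E.
  have nfc := nnrM nf n1c.
  rewrite -int_add//; apply: le_int; [|exact: nnrD|move=> x].
    apply: nnrM => //; split=> [|x]; last by rewrite subr_ge0.
    by apply: measurable_funB; [exact: nD.1|exact: nc.1].
  rewrite -mulrDr ler_wpM2l ?nf.2// /excess.
  have : D x - 1 <= Num.max (D x - 1) 0 by rewrite le_max lexx.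
  lra.
have le2 : (\int[mu]_x (f x * (1 - c x))%:E <=
    (Num.sqrt T%:R * Num.sqrt (1 + L) * Num.sqrt (2 * H))%:E)%E.
  apply: le_trans int_lost _; rewrite lee_fin -!sqrtrM ?mulr_ge0//.
  rewrite ler_wsqrtr// mulrCA mulrA ler_wpM2r ?mulr_ge0// ler_wpM2l// lerDr//.
apply: le_trans (leeD le2 (le_trans le1 (leeD int_excess le2))) _.
rewrite -!EFinD lee_fin (sqrtrM _ L1) le_eqVlt; apply/orP; left; apply/eqP; ring.
Qed.

End transport_bound.

Lemma sqr_sum_le (R : realDomainType) (a : nat -> R) n :
  (\sum_(0 <= s < n) a s) ^+ 2 <= n%:R * \sum_(0 <= s < n) a s ^+ 2.
Proof.
elim: n => [|[|n] ih]; first by rewrite !big_nil mulr0 expr0n.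
  by rewrite !big_nat1 mul1r.
rewrite big_nat_recr//= [X in _ * X]big_nat_recr//=.
move: (\sum_(_ <= _ < _) _) (\sum_(_ <= _ < _) _) ih => Y X ih.
have k0 : 0 < n.+1%:R :> R by rewrite ltr0n.
rewrite -(ler_pM2l k0) -(natr1 n.+1); move: (n.+1%:R : R) k0 ih => k k0 ih.
have k1 : 0 <= k + 1 by rewrite addr_ge0// ltW.
have := ler_wpM2l k1 ih; have := sqr_ge0 (k * a n.+1 - X).
move: (a n.+1) => b; lra.
Qed.

(** * The adapted coupling *)

(** The filtration is encoded by idempotent maps h t: a function depends on the
first t coordinates iff it is unchanged by precomposition with h t, which forgets
the later coordinates. Q t samples a path given h t, under mu. *)
Section filtered.
Local Open Scope ereal_scope.
Context {R : realType} {d} {S : measurableType d} (mu : probability S R).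
Variables (T : nat) (h : nat -> S -> S) (Q : nat -> S * measurableTypeR R -> S).
Hypothesis mh : forall t, measurable_fun setT (h t).
Hypothesis mQ : forall t, measurable_fun setT (Q t).
Hypothesis hh : forall s t x, (s <= t)%N -> h s (h t x) = h s x.
Hypothesis hT : forall x, h T x = x.
Hypothesis h0 : forall x y, h 0%N x = h 0%N y.
Hypothesis QE : forall t, forall F G : S -> \bar R,
  measurable_fun setT F -> measurable_fun setT G ->
  (forall x, 0 <= F x) -> (forall x, 0 <= G x) ->
  \int[mu]_x (F (h t x) * \int[@unif R]_u G (Q t (h t x, u))) =
  \int[mu]_x (F (h t x) * G x).

Let hK t x : h t (h t x) = h t x. Proof. exact: hh. Qed.

Local Notation K t := (cexp (h t) (Q t)).

Definition adapted (U : Type) t (f : S -> U) := forall x, f (h t x) = f x.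

Lemma adapted_le (U : Type) s t (f : S -> U) : (s <= t)%N -> adapted s f -> adapted t f.
Proof. by move=> st fs x; rewrite -[RHS]fs -[LHS]fs hh. Qed.

Variable Dn : S -> R.
Hypothesis nDn : nnr Dn.
Hypothesis Dn1 : \int[mu]_x (Dn x)%:E = 1.

Let nDnE : nnm (fun x => (Dn x)%:E) := nnm_EFin nDn.

Let KDn_fin t : {ae mu, forall x, K t (fun x => (Dn x)%:E) x \is a fin_num}.
Proof.
have nK := nnm_cexp (mh t) (mQ t) nDnE.
suff : mu.-integrable setT (K t (fun x => (Dn x)%:E)).
  by move=> /integrable_ae -/(_ measurableT); apply: filterS => x; apply.
apply/integrableP; split; first exact: nK.1.
rewrite (eq_integralT (g := fun x => 1 * K t (fun x => (Dn x)%:E) x)); last first.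
  by move=> x; rewrite gee0_abs ?mul1e//; exact: nK.2.
rewrite (cexp_ce (mu := mu) (@QE t))//.
by rewrite (eq_integralT (g := fun x => (Dn x)%:E)) ?Dn1 ?ltry// => x; rewrite mul1e.
Qed.

(** The cases t = 0 and t >= T are set apart so that dens 0 = 1 and
dens T = Dn hold everywhere and not only almost everywhere. *)
Definition dens t x : R := if t == 0%N then 1%R else if (T <= t)%N then Dn x else
  fine (K t (fun x => (Dn x)%:E) x).

Lemma nnr_dens t : nnr (dens t).
Proof.
rewrite /dens; case: eqP => [_|_]; first exact: nnr_cst.
case: leqP => // tT; have [mK K0] := nnm_cexp (mh t) (mQ t) nDnE.
by split=> [|x]; [exact: measurableT_comp|exact: fine_ge0].
Qed.

Lemma dens_adapted t : adapted t (dens t).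
Proof.
move=> x; rewrite /dens; case: eqP => // _; case: leqP => [Tt|_].
  by rewrite -{1}(hT (h t x)) hh// hT.
by rewrite cexp_h.
Qed.

Lemma dens0 x : dens 0%N x = 1%R. Proof. by []. Qed.

Lemma densT x : (0 < T)%N -> dens T x = Dn x.
Proof. by rewrite /dens leqnn; case: T. Qed.

Lemma dens_int t F : nnm F -> adapted t F ->
  \int[mu]_x (F x * (dens t x)%:E) = \int[mu]_x (F x * (Dn x)%:E).
Proof.
move=> nF Ft; rewrite /dens; have [t0|_] := eqVneq t 0%N.
  have Fc x : F x = F point by rewrite -Ft -(Ft point) t0 (h0 x point).
  rewrite (eq_integralT (g := fun x => F point * 1)); last by move=> x; rewrite Fc.
  rewrite [RHS](eq_integralT (g := fun x => F point * (Dn x)%:E)); last by move=> x; rewrite Fc.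
  have F0 : 0 <= F point by have [_ +] := nF; exact.
  rewrite ge0_integralZl// ge0_integralZl//; [|exact: nDnE.1|by move=> x _; exact: nDnE.2].
  by rewrite Dn1 integral_prob_cst.
case: leqP => // tT; have nK := nnm_cexp (mh t) (mQ t) nDnE.
rewrite -[RHS](cexp_ce (mu := mu) (@QE t))//.
have nfK : nnm (fun x => (fine (K t (fun x => (Dn x)%:E) x))%:E).
  by apply: nnm_EFin; split=> [|x]; [exact: measurableT_comp nK.1|exact/fine_ge0/nK.2].
apply: ge0_ae_eq_integral => //.
- exact: (nnmM nF nfK).1.
- exact: (nnmM nF nK).1.
- by move=> x _; exact: (nnmM nF nfK).2.
- by move=> x _; exact: (nnmM nF nK).2.
- by apply: filterS (KDn_fin t) => x xfin _; rewrite fineK.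
Qed.

(** kept t is the density with respect to mu of the mass that is still on the
diagonal after t steps. The division by 0 is harmless, as kept t <= dens t. *)
Fixpoint kept t x : R := if t is s.+1 then
  (kept s x * Num.min (dens s.+1 x / dens s x) 1)%R else 1%R.

(** The same mass, as a density of the first t coordinates of Y with respect to
their law under Dn * mu. *)
Definition keptq t x : R := (kept t x / dens t x)%R.

Let d_ge0 t x : (0 <= dens t x)%R := (nnr_dens t).2 x.

Lemma nnr_min1 (f : S -> R) : nnr f -> nnr (fun x => Num.min (f x) 1%R).
Proof.
move=> [mf f0]; split=> [|x]; first exact: measurable_minr.
by rewrite le_min f0 ler01.
Qed.

Lemma nnr_kept t : nnr (kept t).
Proof.
elim: t => [|t ih] /=; first exact: nnr_cst.
by apply/nnrM/nnr_min1/nnrM; [|exact: nnr_dens|exact/nnrV/nnr_dens].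
Qed.

Lemma kept_ge0 t x : (0 <= kept t x)%R. Proof. exact: (nnr_kept t).2. Qed.

Lemma kept_decr t x : (kept t.+1 x <= kept t x)%R.
Proof. by rewrite /= ler_piMr ?kept_ge0// ge_min lexx orbT. Qed.

Lemma kept_le1 t x : (kept t x <= 1)%R.
Proof. by elim: t => [//|t ih]; exact: le_trans (kept_decr t x) ih. Qed.

Lemma kept_dens t x : (kept t x <= dens t x)%R.
Proof.
elim: t => [|t ih]; first by rewrite /= dens0.
have [d0|d0] := eqVneq (dens t x) 0%R.
  suff -> : kept t.+1 x = 0%R by [].
  apply/le_anti; rewrite kept_ge0 andbT; apply: le_trans (kept_decr _ _) _.
  by rewrite -d0.
apply: (@le_trans _ _ (kept t x * (dens t.+1 x / dens t x))%R) => /=.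
  by apply: ler_wpM2l; rewrite ?kept_ge0// ge_min lexx.
rewrite mulrCA ler_piMr//.
by rewrite ler_pdivrMr ?mul1r// lt_neqAle eq_sym d0 d_ge0.
Qed.

Lemma kept_adapted t : adapted t (kept t).
Proof.
elim: t => [//|t ih] x /=; rewrite dens_adapted.
by rewrite (adapted_le (leqnSn t) ih) (adapted_le (leqnSn t) (@dens_adapted t)).
Qed.

Lemma keptq_ge0 t x : (0 <= keptq t x)%R.
Proof. by rewrite /keptq divr_ge0// kept_ge0. Qed.

Lemma nnr_keptq t : nnr (keptq t).
Proof. by apply: nnrM; [exact: nnr_kept|exact/nnrV/nnr_dens]. Qed.

Lemma keptq_adapted t : adapted t (keptq t).
Proof. by move=> x; rewrite /keptq kept_adapted dens_adapted. Qed.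

Lemma keptq_dens t x : (keptq t x * dens t x = kept t x)%R.
Proof.
rewrite /keptq; have [d0|d0] := eqVneq (dens t x) 0%R; last by rewrite mulfVK.
by apply/le_anti; rewrite d0 mulr0 kept_ge0/= -d0 kept_dens.
Qed.

Lemma keptq_decr t x : (keptq t.+1 x <= keptq t x)%R.
Proof.
have [e0|e0] := eqVneq (dens t.+1 x) 0%R; first by rewrite {1}/keptq e0 invr0 mulr0 keptq_ge0.
have e1 : (0 < dens t.+1 x)%R by rewrite lt_neqAle eq_sym e0 d_ge0.
rewrite {1}/keptq ler_pdivrMr//= /keptq mulrAC -mulrA.
by apply: ler_wpM2l; rewrite ?kept_ge0// ge_min lexx.
Qed.

Lemma kept0 x : kept 0%N x = 1%R. Proof. by []. Qed.

Lemma keptq0 x : keptq 0%N x = 1%R. Proof. by rewrite /keptq /= dens0 divr1. Qed.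

(** The densities with respect to mu of the laws of X and of Y on the event that
the two paths separate at step s. *)
Definition lostX s x := (kept s x - kept s.+1 x)%R.
Definition lostY s x := ((keptq s x - keptq s.+1 x) * Dn x)%R.

Lemma lostYE s x : lostY s x = ((keptq s x - keptq s.+1 x) * Dn x)%R. Proof. by []. Qed.

Lemma nnr_lostX s : nnr (lostX s).
Proof.
split=> [|x]; last by rewrite subr_ge0 kept_decr.
by apply: measurable_funB; [exact: (nnr_kept s).1|exact: (nnr_kept s.+1).1].
Qed.

Lemma nnr_qB s : nnr (fun x => keptq s x - keptq s.+1 x)%R.
Proof.
split=> [|x]; last by rewrite subr_ge0 keptq_decr.
by apply: measurable_funB; [exact: (nnr_keptq s).1|exact: (nnr_keptq s.+1).1].
Qed.

Lemma nnr_lostY s : nnr (lostY s).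
Proof. exact: nnrM (nnr_qB s) nDn. Qed.

Lemma lostX_le1 s x : (lostX s x <= 1)%R.
Proof. by rewrite /lostX lerBlDr; have := kept_le1 s x; have := kept_ge0 s.+1 x; lra. Qed.

Lemma lostX_adapted s : adapted s.+1 (lostX s).
Proof.
by move=> x; rewrite /lostX (adapted_le (leqnSn s) (@kept_adapted s)) kept_adapted.
Qed.

Lemma qB_adapted s : adapted s.+1 (fun x => keptq s x - keptq s.+1 x)%R.
Proof.
by move=> x; rewrite (adapted_le (leqnSn s) (@keptq_adapted s)) keptq_adapted.
Qed.

(** keptq t depends on the first t coordinates only, so it comes out of the
conditional expectation of Dn given them, which is dens t. *)
Lemma keptq_int t F : nnm F -> adapted t F ->
  \int[mu]_x (F x * (keptq t x * Dn x)%:E) = \int[mu]_x (F x * (kept t x)%:E).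
Proof.
move=> nF Ft; have nq := nnm_EFin (nnr_keptq t).
rewrite (eq_integralT (g := fun x => (F x * (keptq t x)%:E) * (Dn x)%:E)); last first.
  by move=> x; rewrite EFinM muleA.
rewrite -(@dens_int t)//; [|exact: nnmM|by move=> x; rewrite Ft keptq_adapted].
by apply: eq_integralT => x; rewrite -muleA -EFinM keptq_dens.
Qed.

(** Given the first s coordinates, the masses that X and Y lose at step s agree;
this is what makes it possible to couple them. *)
Lemma residual_int s F : nnm F -> adapted s F -> (forall x, F x <= 1) ->
  \int[mu]_x (F x * (lostX s x)%:E) = \int[mu]_x (F x * (lostY s x)%:E).
Proof.
move=> nF Fs F1.
have fin : \int[mu]_x (F x * (kept s.+1 x)%:E) \is a fin_num.
  rewrite ge0_fin_numE; last by apply: integral_ge0 => x _; exact: (nnmM nF (nnm_EFin (nnr_kept _))).2.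
  apply: (@le_lt_trans _ _ (\int[mu]_x (cst 1 x))); last first.
    by rewrite integral_prob_cst ltry.
  apply: ge0_le_integral => //.
  - by move=> x _; exact: (nnmM nF (nnm_EFin (nnr_kept _))).2.
  - exact: (nnmM nF (nnm_EFin (nnr_kept _))).1.
  - move=> x _; rewrite -[X in _ <= X]mule1; apply: lee_pmul => //; first exact: nF.2.
      by rewrite lee_fin kept_ge0.
    by rewrite lee_fin kept_le1.
have na := nnm_EFin (nnr_lostX s); have nb := nnm_EFin (nnr_lostY s).
have nc := nnm_EFin (nnr_kept s.+1).
have nqD := nnm_EFin (nnrM (nnr_keptq s.+1) nDn).
have e1 : \int[mu]_x (F x * (lostX s x)%:E) + \int[mu]_x (F x * (kept s.+1 x)%:E) =
    \int[mu]_x (F x * (kept s x)%:E).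
  rewrite -ge0_integralD//; try by [exact: (nnmM nF na).1|exact: (nnmM nF nc).1|move=> x _; exact: (nnmM nF na).2|move=> x _; exact: (nnmM nF nc).2].
  apply: eq_integralT => x; rewrite -ge0_muleDr ?lee_fin ?(nnr_lostX s).2 ?kept_ge0//.
  by rewrite -EFinD /lostX subrK.
have e2 : \int[mu]_x (F x * (lostY s x)%:E) + \int[mu]_x (F x * (kept s.+1 x)%:E) =
    \int[mu]_x (F x * (kept s x)%:E).
  rewrite -(@keptq_int s.+1)//; last exact: adapted_le Fs.
  rewrite -(@keptq_int s)//.
  rewrite -ge0_integralD//; try by [exact: (nnmM nF nb).1|exact: (nnmM nF nqD).1|move=> x _; exact: (nnmM nF nb).2|move=> x _; exact: (nnmM nF nqD).2].
  apply: eq_integralT => x; rewrite -ge0_muleDr ?lee_fin ?(nnr_lostY s).2 ?(nnrM (nnr_keptq s.+1) nDn).2//.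
  by rewrite -EFinD /lostY mulrBl subrK.
by rewrite -[LHS](addeK _ fin) e1 -e2 (addeK _ fin).
Qed.

(** The common conditional expectation of lostX s and lostY s given the first s
coordinates. *)
Definition lostK s x : R := fine (K s (fun x => (lostX s x)%:E) x).

Let naE s : nnm (fun x => (lostX s x)%:E) := nnm_EFin (nnr_lostX s).
Let nbE s : nnm (fun x => (lostY s x)%:E) := nnm_EFin (nnr_lostY s).

Lemma K_lostX s x : K s (fun x => (lostX s x)%:E) x = (lostK s x)%:E.
Proof.
have nK := nnm_cexp (mh s) (mQ s) (naE s).
rewrite /lostK fineK// ge0_fin_numE; last exact: nK.2.
apply: le_lt_trans (ltry 1).
rewrite -[X in _ <= X](_ : K s (fun=> 1) x = 1); last by rewrite cexp1.
by apply: le_cexp => // y; rewrite lee_fin lostX_le1.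
Qed.

Lemma nnr_lostK s : nnr (lostK s).
Proof.
have nK := nnm_cexp (mh s) (mQ s) (naE s).
by split=> [|x]; [exact: measurableT_comp nK.1|exact/fine_ge0/nK.2].
Qed.

Lemma lostK_h s x : lostK s (h s x) = lostK s x.
Proof. by rewrite /lostK cexp_h. Qed.

Let int_lostX1 s : \int[mu]_x (lostX s x)%:E <= 1.
Proof.
rewrite -[X in _ <= X](integral_prob_cst mu 1).
by apply: ge0_le_integral => //; [move=> x _; exact: (naE s).2|exact: (naE s).1|move=> x _; rewrite lee_fin lostX_le1].
Qed.

Let int_lostY s : \int[mu]_x (lostY s x)%:E = \int[mu]_x (lostX s x)%:E.
Proof.
have := @residual_int s (fun=> 1); rewrite (eq_integralT (g := fun x => (lostX s x)%:E)); last by move=> x; rewrite mul1e.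
rewrite (eq_integralT (f := fun x => 1 * _) (g := fun x => (lostY s x)%:E)); last by move=> x; rewrite mul1e.
by move=> ->//.
Qed.

Lemma K_lostY s : ae_eq mu setT (K s (fun x => (lostY s x)%:E)) (fun x => (lostK s x)%:E).
Proof.
rewrite (_ : (fun x => (lostK s x)%:E) = K s (fun x => (lostX s x)%:E)); last first.
  by apply/funext => x; rewrite K_lostX.
have ia : mu.-integrable setT (fun x => (lostX s x)%:E).
  apply/integrableP; split; first exact: (naE s).1.
  under eq_integral do rewrite gee0_abs ?(naE s).2//.
  exact: le_lt_trans (int_lostX1 s) (ltry _).
have ib : mu.-integrable setT (fun x => (lostY s x)%:E).
  apply/integrableP; split; first exact: (nbE s).1.
  under eq_integral do rewrite gee0_abs ?(nbE s).2//.
  by rewrite int_lostY; exact: le_lt_trans (int_lostX1 s) (ltry _).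
apply: (cexp_ae_eq (mh s) (mQ s) (hK s) (@QE s)) => // H nH Hh H1.
by rewrite residual_int.
Qed.

Lemma lostX_step s F G : nnm F -> nnm G -> adapted s G ->
  \int[mu]_x (F x * (lostX s x * (lostK s x)^-1)%:E * K s (fun y => (lostY s y)%:E * G y) x) =
  \int[mu]_x (F x * G x * (lostX s x)%:E).
Proof.
move=> nF nG Gs.
apply: (step_adapted (mh s) (mQ s) (hK s) (@QE s) (nnr_lostX s) (nnr_lostY s) (nnr_lostK s) (lostK_h s)) => //.
  by apply: aeW => x _; rewrite K_lostX.
exact: K_lostY.
Qed.

Lemma step_swap s F G : nnm F -> nnm G ->
  \int[mu]_x (F x * (lostX s x * (lostK s x)^-1)%:E * K s (fun y => (lostY s y)%:E * G y) x) =
  \int[mu]_x (G x * (lostY s x * (lostK s x)^-1)%:E * K s (fun y => (lostX s y)%:E * F y) x).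
Proof.
move=> nF nG.
exact: (step_sym (mh s) (mQ s) (hK s) (@QE s) (nnr_lostX s) (nnr_lostY s) (nnr_lostK s) (lostK_h s)).
Qed.

Lemma lostY_step s F G : nnm F -> nnm G -> adapted s F ->
  \int[mu]_x (F x * (lostX s x * (lostK s x)^-1)%:E * K s (fun y => (lostY s y)%:E * G y) x) =
  \int[mu]_x (F x * G x * (lostY s x)%:E).
Proof.
move=> nF nG Fs; rewrite step_swap//.
rewrite (step_adapted (mh s) (mQ s) (hK s) (@QE s) (nnr_lostY s) (nnr_lostX s) (nnr_lostK s) (lostK_h s)) => //.
- by apply: eq_integralT => x; rewrite (muleC (G x)).
- exact: K_lostY.
- by apply: aeW => x _; rewrite K_lostX.
Qed.

(** X is drawn first; Y is resampled from the first s coordinates of X. *)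
Definition Zs s (z : S * measurableTypeR R) : S * S := (z.1, Q s (h s z.1, z.2)).

Lemma mZs s : measurable_fun setT (Zs s).
Proof. by apply/measurable_fun_pair => //; exact: (measurable_Qh (mh s) (mQ s)). Qed.

(** Under mu times the uniform law, this weight turns the law of Zs into the one
where X and Y have the conditional densities lostX / lostK and lostY / lostK and
are conditionally independent. *)
Definition ws s (z : S * measurableTypeR R) : R :=
  (lostX s z.1 * (lostK s z.1)^-1 * lostY s (Zs s z).2)%R.

Lemma nnr_ws s : nnr (ws s).
Proof.
apply: nnrM; last first.
  exact: (nnr_comp (nnr_lostY s) (measurableT_comp measurable_snd (mZs s))).
apply: nnrM; first exact: (nnr_comp (nnr_lostX s) measurable_fst).
exact: (nnr_comp (nnrV (nnr_lostK s)) measurable_fst).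
Qed.

Let PU : probability (S * measurableTypeR R)%type R := mu \x @unif R.

Lemma ws_prod s F G : nnm F -> nnm G ->
  \int[PU]_z (F (Zs s z).1 * G (Zs s z).2 * (ws s z)%:E) =
  \int[mu]_x (F x * (lostX s x * (lostK s x)^-1)%:E * K s (fun y => (lostY s y)%:E * G y) x).
Proof.
move=> nF nG.
have nI : nnm (fun z => F (Zs s z).1 * G (Zs s z).2 * (ws s z)%:E).
  apply: nnmM; last exact: nnm_EFin (nnr_ws s).
  apply: nnmM; first exact: (nnm_comp nF (measurableT_comp measurable_fst (mZs s))).
  exact: (nnm_comp nG (measurableT_comp measurable_snd (mZs s))).
have nbG : nnm (fun z => (lostY s (Zs s z).2)%:E * G (Zs s z).2).
  apply: nnmM; first exact: (nnm_comp (nbE s) (measurableT_comp measurable_snd (mZs s))).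
  exact: (nnm_comp nG (measurableT_comp measurable_snd (mZs s))).
rewrite /PU fubini_tonelli1; [|exact: nI.1|exact: nI.2].
apply: eq_integralT => x; rewrite /fubini_F /cexp -ge0_integralZl//.
- apply: eq_integralT => u; rewrite /ws /= EFinM -!muleA; congr (_ * _).
  by rewrite [G _ * _]muleC -muleA.
- exact: (measurable_fun_pair2 _ nbG.1).
- by move=> u _; apply: mule_ge0; [exact: (nbE s).2|exact: nG.2].
- apply: mule_ge0; first exact: nF.2.
  rewrite lee_fin mulr_ge0 ?invr_ge0//; [exact: (nnr_lostX s).2|exact: (nnr_lostK s).2].
Qed.

Lemma ws_fin s : \int[PU]_z (ws s z)%:E < +oo.
Proof.
have n1 : nnm (fun _ : S => 1 : \bar R) by apply: nnm_cst; rewrite lee_fin ler01.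
have := ws_prod s n1 n1; rewrite lostX_step//.
rewrite (eq_integralT (g := fun z => (ws s z)%:E)); last by move=> z; rewrite !mul1e.
move=> ->; rewrite (eq_integralT (g := fun x => (lostX s x)%:E)); last by move=> x; rewrite !mul1e.
exact: le_lt_trans (int_lostX1 s) (ltry _).
Qed.

Lemma mdiag : measurable_fun setT (fun x : S => (x, x)).
Proof. exact/measurable_fun_pair. Qed.

Lemma kept_fin t : \int[mu]_x (kept t x)%:E < +oo.
Proof.
apply: (@le_lt_trans _ _ (\int[mu]_x (cst 1 x))); last by rewrite integral_prob_cst ltry.
have nc := nnm_EFin (nnr_kept t).
by apply: ge0_le_integral => //; [move=> x _; exact: nc.2|exact: nc.1|move=> x _; rewrite lee_fin kept_le1].
Qed.

(** The summand of index s is the law of the paths which separate at step s. *)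
Definition gamma : set (S * S) -> \bar R :=
  measure_add (wpush mu (nnr_kept T) mdiag)
    (msum (fun s => wpush PU (nnr_ws s) (mZs s)) T).

HB.instance Definition _ := Measure.on gamma.

Lemma integral_gamma g : nnm g ->
  \int[gamma]_z g z = \int[mu]_x (g (x, x) * (kept T x)%:E) +
    \sum_(s < T) \int[PU]_z (g (Zs s z) * (ws s z)%:E).
Proof.
move=> ng; have [mg g0] := ng; rewrite /gamma ge0_integral_measure_add//.
rewrite ge0_integral_measure_sum//; congr (_ + _).
  by rewrite integral_wpush//; exact: kept_fin.
by apply: eq_bigr => s _; rewrite integral_wpush//; exact: ws_fin.
Qed.

Definition theta F G s := \int[mu]_x (F x * (lostX s x * (lostK s x)^-1)%:E *
  K s (fun y => (lostY s y)%:E * G y) x).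

Lemma gamma_prod F G : nnm F -> nnm G ->
  \int[gamma]_z (F z.1 * G z.2) = \int[mu]_x (F x * G x * (kept T x)%:E) +
    \sum_(0 <= s < T) theta F G s.
Proof.
move=> nF nG; rewrite integral_gamma; last first.
  by apply: nnmM; [exact: (nnm_comp nF measurable_fst)|exact: (nnm_comp nG measurable_snd)].
rewrite -(big_mkord xpredT (fun s => \int[PU]_z (F (Zs s z).1 * G (Zs s z).2 * (ws s z)%:E))).
by congr (_ + _); apply: eq_bigr => s _; rewrite ws_prod.
Qed.

Lemma sum_lostX t x : (t <= T)%N ->
  (kept T x + \sum_(t <= s < T) lostX s x = kept t x)%R.
Proof.
move=> tT; have := telescope_sumr (fun s => - kept s x)%R tT.
under eq_bigr do rewrite opprK addrC.
by move=> ->; rewrite opprK addrA subrr add0r.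
Qed.

Lemma sum_lostY t x : (t <= T)%N -> (0 < T)%N ->
  (kept T x + \sum_(t <= s < T) lostY s x = keptq t x * Dn x)%R.
Proof.
move=> tT T0; rewrite /lostY -mulr_suml.
have := telescope_sumr (fun s => - keptq s x)%R tT.
under eq_bigr do rewrite opprK addrC.
move=> ->; rewrite opprK -keptq_dens densT// -mulrDl; congr (_ * _)%R.
by rewrite addrA subrr add0r.
Qed.

(** Mass is lost only where r = dens s.+1 / dens s is below 1, and it is then
kept s * (1 - r); use kept s ^ 2 <= kept s <= dens s and the quadratic lower bound
of entf below 1. *)
Lemma lostX_sqr_le s x : (0 < dens s x)%R ->
  (lostX s x ^+ 2 <= 2 * (dens s x * entf (dens s.+1 x / dens s x)))%R.
Proof.
move=> d0; rewrite /lostX /=; set r := (dens s.+1 x / dens s x)%R.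
have r0 : (0 <= r)%R by rewrite divr_ge0 ?(nnr_dens s.+1).2 ?ltW.
have [c0 c1 cd] := And3 (kept_ge0 s x) (kept_le1 s x) (kept_dens s x).
have hfr := entf_ge0 r0; have [r1|r1] := leP r 1%R.
  have := entf_ge_below r0 r1; move: (kept s x) (dens s x) (entf r) c0 c1 cd d0 hfr.
  move=> c D H c0 c1 cd d0 H0 hr.
  have -> : ((c - c * r) ^+ 2 = c ^+ 2 * (1 - r) ^+ 2)%R by ring.
  apply: (@le_trans _ _ (D * (1 - r) ^+ 2)%R); last by rewrite [leRHS]mulrCA; apply: ler_wpM2l => //; exact: ltW.
  rewrite ler_wpM2r ?sqr_ge0// (le_trans _ cd)// expr2 ler_piMr//.
by rewrite mulr1 subrr expr0n/= !mulr_ge0// ltW.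
Qed.

Lemma lostX_entropy s : \int[mu]_x (lostX s x ^+ 2 / 2 + entf (dens s x))%:E <=
  \int[mu]_x (entf (dens s.+1 x))%:E.
Proof.
apply: entropy_chain; [exact: nnr_dens|exact: nnr_dens|exact: nnr_lostX| | |].
- move=> phi [mphi phi0].
  have nF : nnm (fun x => phi (dens s x)).
    by split=> // ; apply: measurableT_comp mphi (nnr_dens s).1.
  have Fs : adapted s (fun x => phi (dens s x)) by move=> x; rewrite dens_adapted.
  by rewrite dens_int// (dens_int nF)//; exact: adapted_le Fs.
- exact: lostX_sqr_le.
- move=> x d0; have := kept_dens s x; rewrite d0 /lostX => c0.
  have := kept_decr s x; have := kept_ge0 s.+1 x; have := kept_ge0 s x; lra.
Qed.

(** Telescoping sum of the one-step inequalities, from entf (dens 0) = 0. *)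
Lemma sum_lostX_entropy t : \int[mu]_x (\sum_(0 <= s < t) lostX s x ^+ 2 / 2)%:E <=
  \int[mu]_x (entf (dens t x))%:E.
Proof.
have na2 s : nnr (fun x => lostX s x ^+ 2 / 2)%R.
  by apply: nnrM; [exact: (nnr_sqr (nnr_lostX s))|apply: nnr_cst; rewrite invr_ge0].
have nsum n : nnr (fun x => \sum_(0 <= s < n) lostX s x ^+ 2 / 2)%R.
  split=> [|x]; last by apply: sumr_ge0 => s _; exact: (na2 s).2.
  by apply: measurable_sum => s; exact: (na2 s).1.
elim: t => [|t ih].
  rewrite integral0_eq; last by move=> x _; rewrite big_nil.
  by apply: integral_ge0 => x _; rewrite lee_fin entf_ge0// (nnr_dens _).2.
apply: le_trans (lostX_entropy t).
have [n1 n2] := (nnm_EFin (nsum t), nnm_EFin (na2 t)).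
have n3 := nnm_EFin (nnr_entf (nnr_dens t)).
rewrite (eq_integralT (f := fun x => (lostX t x ^+ 2 / 2 + entf (dens t x))%:E) (g := fun x => (lostX t x ^+ 2 / 2)%:E + (entf (dens t x))%:E)) => [|x]; last by rewrite EFinD.
rewrite (eq_integralT (f := fun x => (\sum_(0 <= s < t.+1) lostX s x ^+ 2 / 2)%:E) (g := fun x => (\sum_(0 <= s < t) lostX s x ^+ 2 / 2)%:E + (lostX t x ^+ 2 / 2)%:E)); last first.
  by move=> x; rewrite big_nat_recr.
rewrite ge0_integralD//; [|by move=> x _; exact: n1.2|exact: n1.1|by move=> x _; exact: n2.2|exact: n2.1].
rewrite ge0_integralD//; [|by move=> x _; exact: n2.2|exact: n2.1|by move=> x _; exact: n3.2|exact: n3.1].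
by rewrite addeC leeD2l.
Qed.

(** 1 - kept T is the sum of T losses, so its square is at most T times the sum
of their squares. *)
Lemma lost_mass (H : R) : (0 < T)%N -> \int[mu]_x (entf (Dn x))%:E = H%:E ->
  \int[mu]_x ((1 - kept T x) ^+ 2)%:E <= (T%:R * (2 * H))%:E.
Proof.
move=> T0 DH; have := sum_lostX_entropy T.
rewrite (eq_integralT (f := fun x => (entf (dens T x))%:E) (g := fun x => (entf (Dn x))%:E)) => [|x]; last by rewrite densT.
rewrite DH => /(lee_wpmul2l (_ : 0 <= (2 * T%:R)%:E)); rewrite lee_fin mulr_ge0// => /(_ isT).
rewrite -EFinM (mulrC 2%R) -mulrA; apply: le_trans.
have nsum : nnr (fun x => \sum_(0 <= s < T) lostX s x ^+ 2 / 2)%R.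
  have na2 s : nnr (fun x => lostX s x ^+ 2 / 2)%R.
    by apply: nnrM; [exact: (nnr_sqr (nnr_lostX s))|apply: nnr_cst; rewrite invr_ge0].
  split=> [|x]; last by apply: sumr_ge0 => s _; exact: (na2 s).2.
  by apply: measurable_sum => s; exact: (na2 s).1.
have nsE := nnm_EFin nsum.
rewrite -ge0_integralZl//; [|exact: nsE.1|by move=> x _; exact: nsE.2].
have n1c : nnr (fun x => 1 - kept T x)%R.
  by split=> [|x]; [apply: measurable_funB => //; exact: (nnr_kept T).1|rewrite subr_ge0 kept_le1].
have n1 := nnm_EFin (nnr_sqr n1c).
apply: ge0_le_integral => //.
- by move=> x _; exact: n1.2.
- exact: n1.1.
- by apply: measurable_funeM; exact: nsE.1.
- move=> x _; rewrite -EFinM lee_fin -mulr_suml.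
  have <- : (\sum_(0 <= s < T) lostX s x = 1 - kept T x)%R.
    by have := sum_lostX x (leq0n T); rewrite kept0 => <-; rewrite addrAC subrr add0r.
  rewrite -mulrA (mulrC 2%R) divfK//; exact: sqr_sum_le.
Qed.

#[local] Opaque dens kept keptq lostX lostY lostK cexp.

Let merge H (r : nat -> S -> R) t : nnm H -> (forall s, nnr (r s)) ->
  \int[mu]_x (H x * (kept T x)%:E) + \sum_(t <= s < T) \int[mu]_x (H x * (r s x)%:E) =
  \int[mu]_x (H x * (kept T x + \sum_(t <= s < T) r s x)%:E).
Proof.
move=> nH nr; have nc := nnm_EFin (nnr_kept T).
have nrE s := nnm_EFin (nr s).
rewrite -ge0_integral_sum//; last 2 first.
- by move=> s; exact: (nnmM nH (nrE s)).1.
- by move=> s x _; exact: (nnmM nH (nrE s)).2.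
have ns : nnm (fun x => \sum_(t <= s < T) (H x * (r s x)%:E)).
  by apply: nnm_sum => s; exact: nnmM.
rewrite -ge0_integralD//; try by [exact: (nnmM nH nc).1|exact: ns.1|move=> x _; exact: (nnmM nH nc).2|move=> x _; exact: ns.2].
apply: eq_integralT => x; rewrite EFinD ge0_muleDr ?lee_fin ?kept_ge0//; last first.
  by apply: sumr_ge0 => s _; exact: (nr s).2.
congr (_ + _); rewrite -sumEFin ge0_sume_distrr// => s _.
by rewrite lee_fin (nr s).2.
Qed.

(** The conditional expectation of G Y on separation at step s < t, given X. *)
Definition kXs s (G : S -> \bar R) x :=
  (lostX s x * (lostK s x)^-1)%:E * K s (fun y => (lostY s y)%:E * G y) x.

(** The conditional expectation of G Y given X under gamma, for G depending on the
first t coordinates: on the event that the paths agree up to time t, whose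
conditional probability is kept t, the value is G X. It depends only on the first
t coordinates of X, which is causality. *)
Definition kX t (G : S -> \bar R) x :=
  G x * (kept t x)%:E + \sum_(0 <= s < t) kXs s G x.

Definition kYs s (F : S -> \bar R) x :=
  ((keptq s x - keptq s.+1 x) * (lostK s x)^-1)%:E * K s (fun y => (lostX s y)%:E * F y) x.

(** The counterpart of kX with the roles of X and Y exchanged; the reference law
is then Dn * mu, whence keptq instead of kept. *)
Definition kY t (F : S -> \bar R) x :=
  F x * (keptq t x)%:E + \sum_(0 <= s < t) kYs s F x.

Let nK s G : nnm G -> nnm (K s G) := nnm_cexp (mh s) (mQ s) (G := G).

Let nkXs s G : nnm G -> nnm (kXs s G).
Proof.
move=> nG; apply: nnmM; last exact: nK (nnmM (nbE s) nG).
by apply: nnm_EFin; apply: nnrM (nnr_lostX s) (nnrV (nnr_lostK s)).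
Qed.

Let nkYs s F : nnm F -> nnm (kYs s F).
Proof.
move=> nF; apply: nnmM; last exact: nK (nnmM (naE s) nF).
by apply: nnm_EFin; apply: nnrM (nnr_qB s) (nnrV (nnr_lostK s)).
Qed.

Lemma nnm_kX t G : nnm G -> nnm (kX t G).
Proof.
move=> nG; apply: nnmD; first exact: nnmM nG (nnm_EFin (nnr_kept t)).
by apply: nnm_sum => s; exact: nkXs.
Qed.

Lemma nnm_kY t F : nnm F -> nnm (kY t F).
Proof.
move=> nF; apply: nnmD; first exact: nnmM nF (nnm_EFin (nnr_keptq t)).
by apply: nnm_sum => s; exact: nkYs.
Qed.

Let K_adapted s G t : (s <= t)%N -> adapted t (K s G).
Proof. by move=> st; apply: adapted_le st _ => x; rewrite cexp_h. Qed.

Let lostK_adapted s t : (s <= t)%N -> adapted t (lostK s).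
Proof. by move=> st; apply: adapted_le st _ => x; exact: lostK_h. Qed.

Let kXs_adapted s t G : (s < t)%N -> adapted t (kXs s G).
Proof.
move=> st x; rewrite /kXs.
have -> : lostX s (h t x) = lostX s x by exact: (adapted_le st (@lostX_adapted s)).
have -> : lostK s (h t x) = lostK s x by exact: (lostK_adapted (ltnW st)).
by rewrite (@K_adapted s _ t (ltnW st) x).
Qed.

Let kYs_adapted s t F : (s < t)%N -> adapted t (kYs s F).
Proof.
move=> st x; rewrite /kYs.
have -> : (keptq s (h t x) - keptq s.+1 (h t x) = keptq s x - keptq s.+1 x)%R.
  exact: (adapted_le st (@qB_adapted s)).
have -> : lostK s (h t x) = lostK s x by exact: (lostK_adapted (ltnW st)).
by rewrite (@K_adapted s _ t (ltnW st) x).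
Qed.

Lemma kX_adapted t G : adapted t G -> adapted t (kX t G).
Proof.
move=> Gt x; rewrite /kX (Gt x) (@kept_adapted t x).
have E : \sum_(0 <= s < t) kXs s G (h t x) = \sum_(0 <= s < t) kXs s G x.
  by apply: eq_big_nat => s /andP[_ st]; exact: kXs_adapted.
exact: (f_equal (fun z => G x * (kept t x)%:E + z) E).
Qed.

Lemma kY_adapted t F : adapted t F -> adapted t (kY t F).
Proof.
move=> Ft x; rewrite /kY (Ft x) (@keptq_adapted t x).
have E : \sum_(0 <= s < t) kYs s F (h t x) = \sum_(0 <= s < t) kYs s F x.
  by apply: eq_big_nat => s /andP[_ st]; exact: kYs_adapted.
exact: (f_equal (fun z => F x * (keptq t x)%:E + z) E).
Qed.

(** The separations at times s >= t leave the first t coordinates equal, so in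
their contribution G Y = G X by [lostX_step], and they add up with the diagonal
part to kept t. *)
Lemma gamma_causal_fst t F G : (t <= T)%N -> nnm F -> nnm G -> adapted t G ->
  \int[gamma]_z (F z.1 * G z.2) = \int[mu]_x (F x * kX t G x).
Proof.
move=> tT nF nG Gt; have nFG := nnmM nF nG; rewrite gamma_prod//.
have nc := nnm_EFin (nnr_kept t).
have nFk s := nnmM nF (nkXs s nG).
have -> : \sum_(0 <= s < T) theta F G s =
    \sum_(0 <= s < t) theta F G s + \sum_(t <= s < T) theta F G s.
  exact: big_cat_nat.
have -> : \sum_(t <= s < T) theta F G s = \sum_(t <= s < T) \int[mu]_x (F x * G x * (lostX s x)%:E).
  by apply: eq_big_nat => s /andP[ts _]; rewrite /theta lostX_step//; exact: adapted_le Gt.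
have -> : \sum_(0 <= s < t) theta F G s = \sum_(0 <= s < t) \int[mu]_x (F x * kXs s G x).
  by apply: eq_bigr => s _; apply: eq_integralT => x; rewrite muleA.
rewrite addeCA merge//; last exact: nnr_lostX.
rewrite [X in _ + X](_ : _ = \int[mu]_x (F x * G x * (kept t x)%:E)); last first.
  by apply: eq_integralT => x; rewrite sum_lostX.
rewrite -ge0_integral_sum//; last 2 first.
- by move=> s; exact: (nFk s).1.
- by move=> s x _; exact: (nFk s).2.
have ns : nnm (fun x => \sum_(0 <= s < t) (F x * kXs s G x)) by apply: nnm_sum => s; exact: nFk.
rewrite addeC -ge0_integralD//; try by [exact: (nnmM nFG nc).1|exact: ns.1|move=> x _; exact: (nnmM nFG nc).2|move=> x _; exact: ns.2].
apply: eq_integralT => x; rewrite /kX ge0_muleDr; last 2 first.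
- exact: (nnmM nG nc).2.
- by apply: sume_ge0 => s _; exact: (nkXs s nG).2.
rewrite muleA; congr (_ + _); rewrite ge0_sume_distrr// => s _.
exact: (nkXs s nG).2.
Qed.

(** As for [gamma_causal_fst], after rewriting the contributions of the early
separations from the point of view of Y by [step_swap]. *)
Lemma gamma_causal_snd t F G : (t <= T)%N -> (0 < T)%N ->
  nnm F -> nnm G -> adapted t F ->
  \int[gamma]_z (F z.1 * G z.2) = \int[mu]_x (G x * kY t F x * (Dn x)%:E).
Proof.
move=> tT T0 nF nG Ft; have nFG := nnmM nF nG; rewrite gamma_prod//.
have nq := nnm_EFin (nnr_keptq t).
have nqD := nnm_EFin (nnrM (nnr_keptq t) nDn).
have nGD := nnmM nG nDnE.
have nFk s := nnmM nGD (nkYs s nF).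
have -> : \sum_(0 <= s < T) theta F G s =
    \sum_(0 <= s < t) theta F G s + \sum_(t <= s < T) theta F G s.
  exact: big_cat_nat.
have -> : \sum_(t <= s < T) theta F G s = \sum_(t <= s < T) \int[mu]_x (F x * G x * (lostY s x)%:E).
  by apply: eq_big_nat => s /andP[ts _]; rewrite /theta lostY_step//; exact: adapted_le Ft.
have -> : \sum_(0 <= s < t) theta F G s = \sum_(0 <= s < t) \int[mu]_x (G x * (Dn x)%:E * kYs s F x).
  apply: eq_bigr => s _; rewrite /theta step_swap//; apply: eq_integralT => x.
  rewrite /kYs -!muleA; congr (_ * _); rewrite muleA -EFinM lostYE.
  by congr (_%:E * _); rewrite mulrAC mulrC.
rewrite addeCA merge//; last exact: nnr_lostY.
rewrite [X in _ + X](_ : _ = \int[mu]_x (F x * G x * (keptq t x * Dn x)%:E)); last first.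
  by apply: eq_integralT => x; rewrite sum_lostY.
rewrite -ge0_integral_sum//; last 2 first.
- by move=> s; exact: (nFk s).1.
- by move=> s x _; exact: (nFk s).2.
have ns : nnm (fun x => \sum_(0 <= s < t) (G x * (Dn x)%:E * kYs s F x)).
  by apply: nnm_sum => s; exact: nFk.
rewrite addeC -ge0_integralD//; try by [exact: (nnmM nFG nqD).1|exact: ns.1|move=> x _; exact: (nnmM nFG nqD).2|move=> x _; exact: ns.2].
apply: eq_integralT => x.
have -> : G x * kY t F x * (Dn x)%:E = G x * (Dn x)%:E * kY t F x.
  by rewrite -!muleA (muleC (kY t F x)).
rewrite /kY ge0_muleDr; last 2 first.
- exact: (nnmM nF nq).2.
- by apply: sume_ge0 => s _; exact: (nkYs s nF).2.
rewrite ge0_sume_distrr//; last by move=> s _; exact: (nkYs s nF).2.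
congr (_ + _).
by rewrite EFinM (muleC (F x)) -!muleA; congr (_ * _); rewrite muleA muleC.
Qed.

Let one_nnm : nnm (fun _ : S => 1 : \bar R). Proof. by apply: nnm_cst; rewrite lee_fin ler01. Qed.

Lemma gamma_fst F : nnm F -> \int[gamma]_z F z.1 = \int[mu]_x F x.
Proof.
move=> nF; rewrite (eq_integralT (g := fun z => F z.1 * 1)); last by move=> z; rewrite mule1.
rewrite (@gamma_causal_fst 0%N F (fun=> 1))//.
by apply: eq_integralT => x; rewrite /kX big_nil adde0 kept0 mule1 mule1.
Qed.

Lemma gamma_snd G : (0 < T)%N -> nnm G ->
  \int[gamma]_z G z.2 = \int[mu]_x (G x * (Dn x)%:E).
Proof.
move=> T0 nG; rewrite (eq_integralT (g := fun z => 1 * G z.2)); last by move=> z; rewrite mul1e.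
rewrite (@gamma_causal_snd 0%N (fun=> 1) G)//.
by apply: eq_integralT => x; rewrite /kY big_nil adde0 keptq0 mule1 mule1.
Qed.

Lemma gamma_setT : gamma setT = 1.
Proof.
rewrite -[LHS]mul1e -[LHS]integral_cst//.
by rewrite (gamma_fst one_nnm) integral_prob_cst.
Qed.

(** The diagonal is free; off the diagonal, f x and f y are integrated against
the two marginals of the separated mass, whose densities sum to 1 - kept T and
Dn - kept T. *)
Lemma gamma_cost (g : S * S -> \bar R) (f : S -> R) : (0 < T)%N ->
  nnm g -> nnr f -> (forall x, g (x, x) = 0) ->
  (forall x y, g (x, y) <= (f x)%:E + (f y)%:E) ->
  \int[gamma]_z g z <=
    \int[mu]_x (f x * (1 - kept T x))%:E + \int[mu]_x (f x * (Dn x - kept T x))%:E.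
Proof.
move=> T0 ng nf g0 gf; rewrite integral_gamma//.
rewrite [X in X + _]integral0_eq ?add0e; last by move=> x _; rewrite g0 mul0e.
have nfE := nnm_EFin nf.
have nfZ1 s : nnm (fun z : S * measurableTypeR R => (f (Zs s z).1)%:E * 1 * (ws s z)%:E).
  apply: nnmM; last exact: nnm_EFin (nnr_ws s).
  apply: nnmM; last by apply: nnm_cst; rewrite lee_fin ler01.
  exact: (nnm_comp nfE (measurableT_comp measurable_fst (mZs s))).
have nfZ2 s : nnm (fun z : S * measurableTypeR R => 1 * (f (Zs s z).2)%:E * (ws s z)%:E).
  apply: nnmM; last exact: nnm_EFin (nnr_ws s).
  apply: nnmM; first by apply: nnm_cst; rewrite lee_fin ler01.
  exact: (nnm_comp nfE (measurableT_comp measurable_snd (mZs s))).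
have ngZ s : nnm (fun z => g (Zs s z) * (ws s z)%:E).
  by apply: nnmM; [exact: (nnm_comp ng (mZs s))|exact: nnm_EFin (nnr_ws s)].
have step s : \int[PU]_z (g (Zs s z) * (ws s z)%:E) <=
    \int[mu]_x ((f x)%:E * (lostX s x)%:E) + \int[mu]_x ((f x)%:E * (lostY s x)%:E).
  apply: (@le_trans _ _ (\int[PU]_z ((f (Zs s z).1)%:E * 1 * (ws s z)%:E + 1 * (f (Zs s z).2)%:E * (ws s z)%:E))).
    apply: ge0_le_integral => //.
    - by move=> z _; exact: (ngZ s).2.
    - exact: (ngZ s).1.
    - exact: (nnmD (nfZ1 s) (nfZ2 s)).1.
    - move=> z _; rewrite mule1 mul1e -ge0_muleDl ?nfE.2//.
      apply: lee_wpmul2r; first by rewrite lee_fin (nnr_ws s).2.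
      by have := gf (Zs s z).1 (Zs s z).2; rewrite -surjective_pairing.
  rewrite ge0_integralD//; try by [exact: (nfZ1 s).1|exact: (nfZ2 s).1|move=> z _; exact: (nfZ1 s).2|move=> z _; exact: (nfZ2 s).2].
  rewrite (ws_prod s nfE one_nnm) (ws_prod s one_nnm nfE) lostX_step// lostY_step//.
  apply: leeD.
    by rewrite (eq_integralT (g := fun x => (f x)%:E * (lostX s x)%:E))// => x; rewrite mule1.
  by rewrite (eq_integralT (g := fun x => (f x)%:E * (lostY s x)%:E))// => x; rewrite mul1e.
apply: le_trans (lee_sum _ (fun (s : 'I_T) _ => step s)) _.
rewrite big_split/=.
rewrite -(big_mkord xpredT (fun s => \int[mu]_x ((f x)%:E * (lostX s x)%:E))).
rewrite -(big_mkord xpredT (fun s => \int[mu]_x ((f x)%:E * (lostY s x)%:E))).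
have half (r : nat -> S -> R) (q : S -> R) : (forall s, nnr (r s)) ->
    (forall x, (kept T x + \sum_(0 <= s < T) r s x = q x)%R) ->
    \sum_(0 <= s < T) \int[mu]_x ((f x)%:E * (r s x)%:E) <= \int[mu]_x (f x * (q x - kept T x))%:E.
  move=> nr rq; have nrE s := nnm_EFin (nr s).
  rewrite -ge0_integral_sum//; last 2 first.
  - by move=> s; exact: (nnmM nfE (nrE s)).1.
  - by move=> s x _; exact: (nnmM nfE (nrE s)).2.
  rewrite (eq_integralT (g := fun x => (f x * (q x - kept T x))%:E))// => x.
  rewrite -rq addrAC subrr add0r mulr_sumr -sumEFin.
  by apply: eq_bigr => s _; rewrite EFinM.
apply: leeD; apply: half => //.
- exact: nnr_lostX.
- by move=> x; rewrite sum_lostX.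
- exact: nnr_lostY.
- by move=> x; rewrite sum_lostY// keptq0 mul1r.
Qed.

End filtered.

(** * Relative entropy in terms of the density *)

Section density.
Context {R : realType} {d} {S : measurableType d} (mu nu : probability S R).
Hypothesis numu : nu `<< mu.

(** This version of the derivative is nonnegative and finite everywhere, and not
only almost everywhere. *)
Definition density x : R := fine (Radon_Nikodym_SigmaFinite.f nu mu x).

Let densityE x : (density x)%:E = Radon_Nikodym_SigmaFinite.f nu mu x.
Proof. by rewrite /density fineK// Radon_Nikodym_SigmaFinite.f_fin_num. Qed.

Lemma nnr_density : nnr density.
Proof.
split=> [|x]; last by rewrite fine_ge0// Radon_Nikodym_SigmaFinite.f_ge0.
apply: measurableT_comp => //; apply: (measurable_int mu).
exact: Radon_Nikodym_SigmaFinite.f_integrable.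
Qed.

Lemma integral_density G : nnm G ->
  (\int[nu]_x G x = \int[mu]_x (G x * (density x)%:E))%E.
Proof.
move=> [mG G0]; rewrite -(Radon_Nikodym_SigmaFinite.change_of_variables numu)//.
by apply: eq_integralT => x; rewrite densityE.
Qed.

Lemma measurable_lne_EFin : measurable_fun setT (fun r : R => lne r%:E).
Proof.
rewrite (_ : (fun r : R => _) = (fun r => if r <= 0 then -oo%E else (ln r)%:E)%R)//.
apply: measurable_fun_ifT => //; first exact: measurable_fun_ler.
by apply/measurable_EFinP; exact: measurable_ln.
Qed.

Let density_neq0 : {ae nu, forall x, density x != 0}.
Proof.
have mZ : measurable (density @^-1` [set 0]).
  by rewrite -[X in measurable X]setTI; exact: nnr_density.1.
exists (density @^-1` [set 0]); split => //; last by move=> x /= /negP; rewrite negbK => /eqP.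
transitivity (\int[nu]_x (\1_(density @^-1` [set 0]) x)%:E)%E.
  by rewrite integral_indic// setIT.
rewrite integral_density; last exact: nnm_indic.
apply: integral0_eq => x _; rewrite indicE; case: (boolP (_ \in _)) => [/set_mem|]; last by rewrite mul0e.
by rewrite /= => ->; rewrite mule0.
Qed.

(** The negative part of ln D is nu-integrable because - D * ln D <= 1, and D
integrates to 1 under mu, so the terms - D + 1 of entf (D) contribute nothing. *)
Lemma relative_entropyE : relative_entropy nu mu = (\int[mu]_x (entf (density x))%:E)%E.
Proof.
have nD := nnr_density; have nDE := nnm_EFin nD.
rewrite /relative_entropy; case: pselect => //= _.
have mln : measurable_fun setT (fun x => ln (density x)).
  by move: nD => [mD _]; exact: (measurableT_comp (@measurable_ln R) mD).
have -> : (\int[nu]_x lne (Radon_Nikodym (charge_of_finite_measure nu) mu x) =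
    \int[nu]_x (ln (density x))%:E)%E.
  apply: ae_eq_integral => //.
  - rewrite (_ : (fun x => _) = (fun r : R => lne r%:E) \o (fun x => fine (Radon_Nikodym (charge_of_finite_measure nu) mu x))).
      apply: measurableT_comp measurable_lne_EFin _; exact: measurableT_comp.
    by apply/funext => x; rewrite [RHS]/comp fineK// Radon_Nikodym_fin_num.
  - exact/measurable_EFinP.
  have e1 := null_dominates_ae_eq measurableT numu (ae_eq_Radon_Nikodym_SigmaFinite numu measurableT).
  apply: filterS2 e1 density_neq0 => x ex D0 _.
  rewrite -ex// -densityE /= leNgt lt_neqAle eq_sym D0.
  by rewrite nD.2.
rewrite integralE.
pose lp x := Num.max (ln (density x)) 0; pose ln' x := Num.max (- ln (density x)) 0.
have nlp : nnr lp.
  by split=> [|x]; [exact: measurable_maxr|rewrite le_max lexx orbT].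
have nln : nnr ln'.
  by split=> [|x]; [apply: measurable_maxr => //; exact: measurableT_comp|rewrite le_max lexx orbT].
have -> : (\int[nu]_x (fun x => (ln (density x))%:E)^\+ x = \int[mu]_x (lp x * density x)%:E)%E.
  rewrite (eq_integralT (g := fun x => (lp x)%:E)) => [|x]; last by rewrite funeposE -EFin_max.
  by rewrite (integral_density (nnm_EFin nlp)).
have -> : (\int[nu]_x (fun x => (ln (density x))%:E)^\- x = \int[mu]_x (ln' x * density x)%:E)%E.
  rewrite (eq_integralT (g := fun x => (ln' x)%:E)) => [|x]; last by rewrite funenegE -EFinN -EFin_max.
  by rewrite (integral_density (nnm_EFin nln)).
have np := nnm_EFin (nnrM nlp nD); have nn := nnm_EFin (nnrM nln nD).
have nh := nnm_EFin (nnr_entf nD).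
have n1 : nnm (fun _ : S => 1%E : \bar R) by apply: nnm_cst; rewrite lee_fin.
have fin_neg : (\int[mu]_x (ln' x * density x)%:E \is a fin_num)%E.
  rewrite ge0_fin_numE; last by apply: integral_ge0 => x _; exact: nn.2.
  apply: (@le_lt_trans _ _ (\int[mu]_x (cst 1 x))%E); last by rewrite integral_prob_cst ltry.
  apply: ge0_le_integral => //; [by move=> x _; exact: nn.2|exact: nn.1|move=> x _].
  rewrite lee_fin /ln'; have := entf_ge0 (nD.2 x); have := nD.2 x; rewrite /entf.
  move: (density x) (ln (density x)) => r l r0 hr.
  by have [l0|l0] := leP (- l) 0; rewrite ?mul0r//; lra.
have key : (\int[mu]_x (entf (density x))%:E + \int[mu]_x (ln' x * density x)%:E + 1 =
    \int[mu]_x (lp x * density x)%:E + 1)%E.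
  rewrite -[in LHS](_ : \int[mu]_x (density x)%:E = 1)%E; last first.
    rewrite -(integral_prob_cst nu 1%E) (integral_density n1).
    by apply: eq_integralT => x; rewrite mul1e.
  rewrite -[X in (_ = _ + X)%E](integral_prob_cst mu 1%E).
  rewrite -!ge0_integralD//; try by [exact: np.1|exact: nn.1|exact: nh.1|exact: nDE.1|exact: (nnmD nh nn).1|
    move=> x _; exact: np.2|move=> x _; exact: nn.2|move=> x _; exact: nh.2|move=> x _; exact: nDE.2|move=> x _; exact: (nnmD nh nn).2].
  apply: eq_integralT => x; rewrite -!EFinD; congr (_%:E); rewrite /entf /lp /ln'.
  have := nD.2 x; move: (density x) (ln (density x)) => r l r0.
  have [l0|l0] := leP (- l) 0; have [l1|l1] := leP l 0; try lra.
  have -> : l = 0 by lra. lra.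
move/(f_equal (fun z => z - 1)%E): key; rewrite !addeK// => <-.
by rewrite addeK.
Qed.

End density.

(** * Causality and the filtration of the coordinates *)

(** Zb is the process with respect to which conditioning takes place and m its
law; k is the kernel giving the conditional expectation of G Za given Zb for G
depending on the past only, and Q samples Zb given its past. *)
Section causal_cond_indep.
Local Open Scope ereal_scope.
Context {R : realType} {dO d} {O : measurableType dO} {S : measurableType d}.
Variables (gam : probability O R) (m : probability S R) (Zb Za : O -> S).
Hypotheses (mZb : measurable_fun setT Zb) (mZa : measurable_fun setT Za).
Variables (h : S -> S) (Q : S * measurableTypeR R -> S) (k : (S -> \bar R) -> S -> \bar R).
Hypothesis mh : measurable_fun setT h.
Hypothesis mQ : measurable_fun setT Q.
Hypothesis hh : forall x, h (h x) = h x.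
Hypothesis QE : forall F G : S -> \bar R,
  measurable_fun setT F -> measurable_fun setT G ->
  (forall x, 0 <= F x) -> (forall x, 0 <= G x) ->
  \int[m]_x (F (h x) * \int[@unif R]_u G (Q (h x, u))) =
  \int[m]_x (F (h x) * G x).
Hypothesis nk : forall G, nnm G -> nnm (k G).
Hypothesis kh : forall G, (forall x, G (h x) = G x) -> forall x, k G (h x) = k G x.
Hypothesis kE : forall F G, nnm F -> nnm G -> (forall x, G (h x) = G x) ->
  \int[gam]_z (F (Zb z) * G (Za z)) = \int[m]_x (F x * k G x).
Hypothesis law : forall F, nnm F -> \int[gam]_z F (Zb z) = \int[m]_x F x.
Variables FA FB GG : set (set O).
Hypothesis FAP : forall A, FA A -> exists2 A0, measurable A0 & A = Za @^-1` (h @^-1` A0).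
Hypothesis FBP : forall B, FB B -> exists2 B0, measurable B0 & B = Zb @^-1` B0.
Hypothesis GGP : forall C, GG C <-> exists2 C0, measurable C0 & C = Zb @^-1` (h @^-1` C0).

Let n1 : nnm (fun _ : S => 1 : \bar R). Proof. by apply: nnm_cst; rewrite lee_fin. Qed.

(** phi may be infinite on a null set; its finite part is then a version of the
conditional probability. *)
Let is_cond (A : set O) (phi : S -> \bar R) : measurable A -> nnm phi ->
  (forall x, phi (h x) = phi x) ->
  (forall F, nnm F -> (forall x, F (h x) = F x) ->
    \int[m]_x (F x * phi x) = \int[gam]_z (F (Zb z) * (\1_A z)%:E)) ->
  is_cond_prob gam GG A (fun z => fine (phi (Zb z))).
Proof.
move=> mA nphi phih phiE.
have nf : nnr (fun z => fine (phi (Zb z))).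
  split=> [|z]; last by apply/fine_ge0/nphi.2.
  by apply: measurableT_comp => //; exact: measurableT_comp nphi.1 mZb.
have nfphi : nnm (fun x => (fine (phi x))%:E).
  by apply: nnm_EFin; split=> [|x]; [exact: measurableT_comp nphi.1|exact/fine_ge0/nphi.2].
have phi1 : \int[m]_x phi x = \int[gam]_z (\1_A z)%:E.
  have := phiE _ n1 (fun=> erefl).
  rewrite (eq_integralT (g := phi)) => [|x]; last by rewrite mul1e.
  by move=> ->; apply: eq_integralT => z; rewrite mul1e.
have phi_fin : {ae m, forall x, phi x \is a fin_num}.
  suff : m.-integrable setT phi.
    by move=> /integrable_ae -/(_ measurableT); apply: filterS => x; apply.
  apply/integrableP; split; first exact: nphi.1.
  rewrite (eq_integralT (g := phi)) => [|x]; last by rewrite gee0_abs//; exact: nphi.2.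
  rewrite phi1 integral_indic// setIT.
  exact: le_lt_trans (probability_le1 _ mA) (ltry _).
have fphi F : nnm F -> \int[m]_x (F x * (fine (phi x))%:E) = \int[m]_x (F x * phi x).
  move=> nF; apply: ge0_ae_eq_integral => //.
  - exact: (nnmM nF nfphi).1.
  - exact: (nnmM nF nphi).1.
  - by move=> x _; exact: (nnmM nF nfphi).2.
  - by move=> x _; exact: (nnmM nF nphi).2.
  - by apply: filterS phi_fin => x xfin _; rewrite fineK.
split.
- move=> B mB; apply/GGP; exists ((fun x => fine (phi x)) @^-1` B).
    rewrite -[X in measurable X]setTI; apply: (measurableT_comp _ nphi.1) => //; exact: measurable_fine.
  by apply/seteqP; split => z /=; rewrite phih.
- apply/integrableP; split; first exact/measurable_EFinP/nf.1.
  rewrite (eq_integralT (g := fun z => (fine (phi (Zb z)))%:E)) => [|z]; last first.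
    by rewrite gee0_abs// lee_fin; exact: nf.2.
  rewrite (law nfphi).
  have := fphi _ n1.
  rewrite (eq_integralT (g := fun x => (fine (phi x))%:E)) => [->|x]; last by rewrite mul1e.
  rewrite (eq_integralT (g := phi)) => [|x]; last by rewrite mul1e.
  rewrite phi1 integral_indic// setIT.
  exact: le_lt_trans (probability_le1 _ mA) (ltry _).
- move=> C /GGP[C0 mC0 ->].
  have mC : measurable (h @^-1` C0) by rewrite -[X in measurable X]setTI; exact: mh.
  have nC : nnm (fun x => (\1_(h @^-1` C0) x)%:E : \bar R) by exact: nnm_indic.
  have Ch x : (\1_(h @^-1` C0) (h x))%:E = (\1_(h @^-1` C0) x)%:E :> \bar R.
    by rewrite !indicE; congr ((_ : bool)%:R%:E); apply/idP/idP => /set_mem /= H; apply/mem_set; rewrite /= ?hh// -hh.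
  rewrite integral_mkcond epatch_indic.
  transitivity (\int[m]_x ((\1_(h @^-1` C0) x)%:E * (fine (phi x))%:E)).
    rewrite -(law (nnmM nC nfphi)); apply: eq_integralT => z /=.
    by rewrite muleC.
  rewrite fphi// phiE//.
  transitivity (\int[gam]_z (\1_(A `&` Zb @^-1` (h @^-1` C0)) z)%:E).
    apply: eq_integralT => z.
    rewrite -EFinM; congr (_%:E); rewrite mulrC -[RHS]/((\1_(A `&` Zb @^-1` (h @^-1` C0)) : O -> R) z) indicI /=.
    by congr (_ * _)%R; rewrite !indicE.
  rewrite integral_indic ?setIT//; apply: measurableI => //.
  by rewrite -[X in measurable X]setTI; exact: mZb.
Qed.

(** The conditional probability of the past event A given Zb depends on the past of
Zb only, so conditioning it further on the past does not change it: pulling it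
out of the conditional expectation of the indicator of B gives the product rule. *)
Lemma causal_cond_indep : cond_indep gam FA FB GG.
Proof.
move=> A B /FAP[A0 mA0 eA] /FBP[B0 mB0 eB].
have mhA : measurable (h @^-1` A0) by rewrite -[X in measurable X]setTI; exact: mh.
have mA : measurable A.
  by rewrite eA -[X in measurable X]setTI; exact: (mZa measurableT mhA).
have mB : measurable B by rewrite eB -[X in measurable X]setTI; exact: mZb.
have nA : nnm (fun x => (\1_(h @^-1` A0) x)%:E : \bar R) by exact: nnm_indic.
have nB : nnm (fun x => (\1_B0 x)%:E : \bar R) by exact: nnm_indic.
have Ah x : (\1_(h @^-1` A0) (h x))%:E = (\1_(h @^-1` A0) x)%:E :> \bar R.
  by rewrite !indicE; congr ((_ : bool)%:R%:E); apply/idP/idP => /set_mem /= H; apply/mem_set; rewrite /= ?hh// -hh.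
pose pA := k (fun x => (\1_(h @^-1` A0) x)%:E).
pose pB := cexp h Q (fun x => (\1_B0 x)%:E).
have npA : nnm pA := nk nA.
have npB : nnm pB := nnm_cexp mh mQ nB.
have pAh x : pA (h x) = pA x by exact: kh.
have pBh x : pB (h x) = pB x by exact: cexp_h.
have pB_fin x : pB x \is a fin_num.
  rewrite ge0_fin_numE; last exact: npB.2.
  apply: le_lt_trans (ltry 1).
  rewrite -[X in _ <= X](_ : cexp h Q (fun=> 1) x = 1); last by rewrite cexp1.
  by apply: le_cexp => // y; rewrite lee_fin indicE lern1 leq_b1.
have indA z : (\1_A z)%:E = (\1_(h @^-1` A0) (Za z))%:E :> \bar R by rewrite eA !indicE.
have indB z : (\1_B z)%:E = (\1_B0 (Zb z))%:E :> \bar R by rewrite eB !indicE.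
exists (fun z => fine (pA (Zb z))), (fun z => fine (pB (Zb z))),
  (fun z => fine (pA (Zb z) * pB (Zb z))); split.
- apply: is_cond => // F nF Fh; rewrite -kE//.
  by apply: eq_integralT => z; rewrite indA.
- apply: is_cond => // F nF Fh; rewrite (cexp_ce (mu := m) QE)// -(law (nnmM nF nB)).
  by apply: eq_integralT => z; rewrite indB.
- apply: (is_cond (phi := fun x => pA x * pB x)).
  + exact: measurableI.
  + exact: nnmM.
  + by move=> x; rewrite pAh pBh.
  + move=> F nF Fh.
    rewrite (eq_integralT (g := fun x => (F x * pA x) * pB x)) => [|x]; last by rewrite muleA.
    rewrite (cexp_ce (mu := m) QE)//; last 2 first.
    * exact: nnmM.
    * by move=> x; rewrite Fh pAh.
    rewrite (eq_integralT (g := fun x => (F x * (\1_B0 x)%:E) * pA x)) => [|x]; last by rewrite muleAC.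
    rewrite -(kE (nnmM nF nB))//; apply: eq_integralT => z.
    rewrite -indA -indB indicI/= EFinM -muleA; congr (_ * _).
    by rewrite muleC.
- apply: aeW => z; have := pB_fin (Zb z); have := npA.2 (Zb z); have := npB.2 (Zb z).
  case: (pB _) => [r| |]//; case: (pA _) => [s| |]//= r0 _ _.
  move: r0; rewrite lee_fin le_eqVlt => /predU1P[<-|r0]; first by rewrite mule0 mul0r.
  by rewrite gt0_mulye ?lte_fin// mul0r.
Qed.

End causal_cond_indep.

Section sigma_upto.
Context {R : realType} {T : nat} {X : 'I_T -> ptopologicalType}.
Local Notation XX := (prod_topology X).

Definition coord_upto (t : nat) (x : XX) : XX := fun i => if (i < t)%N then x i else point.

Lemma coord_upto_upto s t x : (s <= t)%N -> coord_upto s (coord_upto t x) = coord_upto s x.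
Proof.
move=> st; apply: functional_extensionality_dep => i; rewrite /coord_upto.
by case: ifP => // si; rewrite (leq_trans si).
Qed.

Lemma coord_uptoT x : coord_upto T x = x.
Proof. by apply: functional_extensionality_dep => i; rewrite /coord_upto ltn_ord. Qed.

Lemma coord_upto0 x y : coord_upto 0%N x = coord_upto 0%N y.
Proof. exact: functional_extensionality_dep. Qed.

Lemma measurable_coord i : measurable_fun setT ((fun x => x i) : borel XX -> borel (X i)).
Proof.
apply: measurable_fun_generated => U oU; apply: borel_open.
by move: U oU; apply/continuousP/continuous_coord.
Qed.

Hypothesis hX : forall t, polish R (X t).

Lemma measurable_to_prod d (O : measurableType d) (f : O -> XX) :
  (forall t, measurable_fun setT ((fun w => f w t) : O -> borel (X t))) ->
  measurable_fun setT (f : O -> borel XX).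
Proof.
pose B t := sval (cid (polish_base (hX t))).
exact: (@measurable_fun_coord _ _ B (fun t => svalP (cid (polish_base (hX t))))).
Qed.

Lemma measurable_coord_upto t : measurable_fun setT (coord_upto t : borel XX -> borel XX).
Proof.
apply: measurable_to_prod => i; rewrite /coord_upto.
by case: (i < t)%N; [exact: measurable_coord|exact: measurable_cst].
Qed.

(** Each coordinate of coord_upto t (Z w) is constant or a coordinate of Z w of
index less than t, and conversely the latter can be read off coord_upto t (Z w). *)
Lemma sigma_uptoP (O : pointedType) (Z : O -> XX) t (A : set O) :
  sigma_upto Z t A <->
  exists2 A0, @measurable _ (borel XX) A0 & A = Z @^-1` (coord_upto t @^-1` A0).
Proof.
rewrite /sigma_upto; set G := \bigcup_(i in _) _; split.
  move=> sA; suff [A0 mA0 <-] : (preimage_set_system setT (coord_upto t \o Z) (@measurable _ (borel XX))) A.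
    by exists A0 => //; rewrite setTI.
  apply: sA; split; first by apply: sigma_algebra_preimage; exact: sigma_algebra_measurable.
  move=> _ [i /= it [B mB <-]].
  exists ((fun x : XX => x i) @^-1` B).
      by rewrite -[X in measurable X]setTI; exact: measurable_coord.
    by rewrite !setTI; apply/seteqP; split => z /=; rewrite /coord_upto it.
move=> [A0 mA0 ->].
have mZ : measurable_fun setT (coord_upto t \o Z : g_sigma_algebraType G -> borel XX).
  apply: measurable_to_prod => i; rewrite /coord_upto /=.
  case it: (i < t)%N; last exact: measurable_cst.
  rewrite /measurable_fun => _ B mB; apply: sub_sigma_algebra; exists i => //=.
  by exists B; rewrite // it.
by have := mZ measurableT _ mA0; rewrite setTI.
Qed.

End sigma_upto.

(** * The bound on the adapted Wasserstein distance *)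

Section pushforward_probability.
Local Open Scope ereal_scope.
Context {R : realType} {d1 d2} {O1 : measurableType d1} {O2 : measurableType d2}.
Variables (m : {measure set O1 -> \bar R}) (f : O1 -> O2).
Hypotheses (mf : measurable_fun setT f) (m1 : m setT = 1).

Definition prob_push of measurable_fun setT f & m setT = 1 := pushforward m f.

Let push0 : prob_push mf m1 set0 = 0.
Proof. by rewrite /prob_push /pushforward preimage_set0 measure0. Qed.

Let push_ge0 A : 0 <= prob_push mf m1 A. Proof. exact: measure_ge0. Qed.

Let push_sigma_additive : semi_sigma_additive (prob_push mf m1).
Proof.
move=> F mF tF mUF; rewrite /prob_push /pushforward preimage_bigcup.
apply: measure_semi_sigma_additive.
- by move=> n; exact: measurable_preimageT.
- apply/trivIsetP => /= i j _ _ ij; rewrite -preimage_setI.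
  by move/trivIsetP : tF => /(_ _ _ _ _ ij) ->//; rewrite preimage_set0.
- by rewrite -preimage_bigcup; exact: measurable_preimageT.
Qed.

HB.instance Definition _ := isMeasure.Build _ _ _ (prob_push mf m1)
  push0 push_ge0 push_sigma_additive.

Let push1 : prob_push mf m1 setT = 1.
Proof. by rewrite /prob_push /pushforward preimage_setT. Qed.

HB.instance Definition _ := Measure_isProbability.Build _ _ _ (prob_push mf m1) push1.

Lemma integral_prob_push (g : O2 -> \bar R) : nnm g ->
  \int[prob_push mf m1]_y g y = \int[m]_x g (f x).
Proof. by move=> [mg g0]; rewrite ge0_integral_pushforward. Qed.

End pushforward_probability.

Section adapted_coupling.
Local Open Scope ereal_scope.
Context {R : realType} {T : nat} {X : 'I_T -> ptopologicalType}.
Local Notation XX := (prod_topology X).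
Hypothesis hX : forall t, polish R (X t).
Hypothesis T0 : (0 < T)%N.
Variables (mu nu : probability (borel XX) R).
Hypothesis numu : nu `<< mu.

Let conditional_sampler (P : probability (borel XX) R) t :
  exists Q : borel XX * measurableTypeR R -> borel XX, measurable_fun setT Q /\
  forall F G : borel XX -> \bar R,
    measurable_fun setT F -> measurable_fun setT G ->
    (forall x, 0 <= F x) -> (forall x, 0 <= G x) ->
    \int[P]_x (F (coord_upto t x) * \int[@unif R]_u G (Q (coord_upto t x, u))) =
    \int[P]_x (F (coord_upto t x) * G x).
Proof.
have [phi [psi [mphi mpsi phiK]]] := polish_retract_real (polish_prod hX).
exact: (disintegration P (measurable_coord_upto hX t) mphi mpsi phiK).
Qed.

Let h t : borel XX -> borel XX := coord_upto t.
Let mh t : measurable_fun setT (h t) := measurable_coord_upto hX t.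
Let hh s t (x : borel XX) : (s <= t)%N -> h s (h t x) = h s x. Proof. exact: coord_upto_upto. Qed.
Let hT (x : borel XX) : h T x = x. Proof. exact: coord_uptoT. Qed.
Let h0 (x y : borel XX) : h 0%N x = h 0%N y. Proof. exact: coord_upto0. Qed.

Let Q t := sval (cid (conditional_sampler mu t)).
Let mQ t : measurable_fun setT (Q t) := (svalP (cid (conditional_sampler mu t))).1.
Let QE t := (svalP (cid (conditional_sampler mu t))).2.

Let D := density mu nu.
Let nD : nnr D := nnr_density numu.
Let D1 : \int[mu]_x (D x)%:E = 1.
Proof.
rewrite -(integral_prob_cst nu 1) (integral_density numu); last by apply: nnm_cst; rewrite lee_fin.
by apply: eq_integralT => x; rewrite mul1e.
Qed.

Let gam0 : {measure set (borel XX * borel XX) -> \bar R} := gamma mu T mh mQ nD.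

Let gam01 : gam0 setT = 1.
Proof. exact: (gamma_setT mh mQ hh hT h0 QE nD D1). Qed.

(** gamma lives on the product sigma-algebra; the identity carries it to the Borel
sigma-algebra of the product topology. *)
Let mid : measurable_fun setT (id : borel XX * borel XX -> borel (XX * XX)%type).
Proof.
have [B BP] := polish_base (polish_prod hX).
exact: (measurable_pair_borel BP BP).
Qed.

Let gam : probability (borel (XX * XX)%type) R := prob_push mid gam01.

Let gamE (g : borel (XX * XX)%type -> \bar R) : nnm g ->
  \int[gam]_z g z = \int[gam0]_z g z.
Proof. exact: integral_prob_push. Qed.

Let mfst : measurable_fun setT (fst : borel (XX * XX)%type -> borel XX).
Proof.
refine (@measurable_fun_generated _ (borel (XX * XX)%type) XX open _ _) => U oU.
apply: sub_sigma_algebra.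
have cfst : continuous (@fst XX XX) by move=> z; apply: (@cvg_fst _ _ (nbhs z.1) (nbhs z.2)).
by move/continuousP: cfst; exact.
Qed.

Let msnd : measurable_fun setT (snd : borel (XX * XX)%type -> borel XX).
Proof.
refine (@measurable_fun_generated _ (borel (XX * XX)%type) XX open _ _) => U oU.
apply: sub_sigma_algebra.
have csnd : continuous (@snd XX XX) by move=> z; apply: (@cvg_snd _ _ (nbhs z.1) (nbhs z.2)).
by move/continuousP: csnd; exact.
Qed.

Let nfst (F : borel XX -> \bar R) : nnm F -> nnm (fun z : borel (XX * XX)%type => F z.1).
Proof. by move=> nF; exact: (nnm_comp nF mfst). Qed.

Let nsnd (F : borel XX -> \bar R) : nnm F -> nnm (fun z : borel (XX * XX)%type => F z.2).
Proof. by move=> nF; exact: (nnm_comp nF msnd). Qed.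

Let gam_fst (F : borel XX -> \bar R) : nnm F -> \int[gam]_z F z.1 = \int[mu]_x F x.
Proof.
by move=> nF; rewrite (gamE (nfst nF)); exact: (gamma_fst mh mQ hh hT h0 QE nD D1).
Qed.

Let gam_snd (F : borel XX -> \bar R) : nnm F -> \int[gam]_z F z.2 = \int[nu]_x F x.
Proof.
move=> nF; rewrite (gamE (nsnd nF)) (integral_density numu)//.
exact: (gamma_snd mh mQ hh hT h0 QE nD D1).
Qed.

Let coupling : is_coupling mu nu gam.
Proof.
move=> A mA; have nA : nnm (fun x : borel XX => (\1_A x)%:E : \bar R) by exact: nnm_indic.
have [mA1 mA2] : measurable (fst @^-1` A : set (borel (XX * XX)%type)) /\
    measurable (snd @^-1` A : set (borel (XX * XX)%type)).
  by split; rewrite -[X in measurable X]setTI; [exact: mfst|exact: msnd].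
split.
- transitivity (\int[gam]_z (\1_(fst @^-1` A) z)%:E).
    by rewrite integral_indic// setIT.
  transitivity (\int[mu]_x (\1_A x)%:E); last by rewrite integral_indic// setIT.
  by rewrite -(gam_fst nA); apply: eq_integralT => z; rewrite !indicE.
- transitivity (\int[gam]_z (\1_(snd @^-1` A) z)%:E).
    by rewrite integral_indic// setIT.
  transitivity (\int[nu]_x (\1_A x)%:E); last by rewrite integral_indic// setIT.
  by rewrite -(gam_snd nA); apply: eq_integralT => z; rewrite !indicE.
Qed.

(** The first direction conditions on X, whose law is mu, and the second one on Y,
whose law is nu; for the latter the sampler of the conditional laws is that of
nu. *)
Let bicausal_gam : bicausal gam.
Proof.
move=> t /andP[_ tT]; split.
- apply: (@causal_cond_indep _ _ _ _ _ gam mu fst snd mfst msnd (h t) (Q t)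
    (kX T h Q D t) (mh t) (mQ t) (fun x => hh x (leqnn t)) (QE t)).
  + move=> G nG; exact: (nnm_kX T mh mQ nD t nG).
  + move=> G Gh x; exact: (kX_adapted Q hh hT D Gh).
  + move=> F G nF nG Gh; rewrite (gamE (nnmM (nfst nF) (nsnd nG))).
    exact: (gamma_causal_fst mh mQ hh hT h0 QE nD D1 (ltnW tT) nF nG Gh).
  + exact: gam_fst.
  + move=> A /(sigma_uptoP hX)[A0 mA0 ->]; by exists A0.
  + move=> B [B0 mB0 <-]; exists B0 => //; by rewrite setTI.
  + move=> C; exact: (sigma_uptoP hX).
have [Q' Q'P] := choice (conditional_sampler nu).
apply: (@causal_cond_indep _ _ _ _ _ gam nu snd fst msnd mfst (h t) (Q' t)
    (kY T h Q D t) (mh t) (Q'P t).1 (fun x => hh x (leqnn t)) (Q'P t).2).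
- move=> G nG; exact: (nnm_kY T mh mQ nD t nG).
- move=> G Gh x; exact: (kY_adapted Q hh hT D Gh).
- move=> F G nF nG Gh.
  rewrite (eq_integralT (g := fun z : borel (XX * XX)%type => G z.1 * F z.2)) => [|z]; last by rewrite muleC.
  rewrite (gamE (nnmM (nfst nG) (nsnd nF))).
  rewrite (gamma_causal_snd mh mQ hh hT h0 QE nD D1 (ltnW tT) T0 nG nF Gh).
  by rewrite (integral_density numu)//; exact: nnmM nF (nnm_kY T mh mQ nD t nG).
- exact: gam_snd.
- move=> A /(sigma_uptoP hX)[A0 mA0 ->]; by exists A0.
- move=> B [B0 mB0 <-]; exists B0 => //; by rewrite setTI.
- move=> C; exact: (sigma_uptoP hX).
Qed.

(** All that the estimate needs to know about the coupling: c is the density of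
the mass on the diagonal. *)
Lemma adapted_coupling : exists (gam : probability (borel (XX * XX)%type) R) (c : borel XX -> R),
  [/\ bicausal_couplings mu nu gam,
      nnr c, (forall x, c x <= 1)%R, (forall x, c x <= density mu nu x)%R &
      (forall H : R, \int[mu]_x (entf (density mu nu x))%:E = H%:E ->
        \int[mu]_x ((1 - c x) ^+ 2)%:E <= (T%:R * (2 * H))%:E) /\
      forall (g : borel (XX * XX)%type -> \bar R) (f : borel XX -> R),
        nnm g -> nnr f -> (forall x, g (x, x) = 0) ->
        (forall x y, g (x, y) <= (f x)%:E + (f y)%:E) ->
        \int[gam]_z g z <= \int[mu]_x (f x * (1 - c x))%:E +
          \int[mu]_x (f x * (density mu nu x - c x))%:E].
Proof.
exists gam, (kept T h Q D T); split.
- by split; [exact: coupling|exact: bicausal_gam].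
- exact: nnr_kept.
- by move=> x; exact: (kept_le1 T mh mQ nD).
- by move=> x; rewrite -[leRHS](densT h Q D x T0); exact: (kept_dens T mh mQ nD).
- split; first by move=> H DH; exact: (lost_mass mh mQ hh hT h0 QE nD D1 T0 DH).
  move=> g f ng nf g0 gf; rewrite gamE//.
  apply: (gamma_cost mh mQ hh hT h0 QE nD D1 T0 _ nf) => //.
  by case: ng => mg g0'; split => //; exact: measurableT_comp mg mid.
Qed.

End adapted_coupling.

(** Convexity of the p-th power at the midpoint of 2 a and 2 b. *)
Lemma powR_add_le (R : realType) (p a b : R) : 1 <= p -> 0 <= a -> 0 <= b ->
  (a + b) `^ p <= 2 `^ (p - 1) * (a `^ p + b `^ p).
Proof.
move=> p1 a0 b0.
have h : (2^-1 * (2 * a) + 2^-1 * (2 * b)) `^ p <=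
    2^-1 * (2 * a) `^ p + 2^-1 * (2 * b) `^ p.
  rewrite {2 4}(_ : 2^-1 = 1 - 2^-1); last by lra.
  apply: (convex_powR p1 (Itv01 _ _)) => //=;
    by rewrite ?inE/= ?in_itv/= ?andbT ?mulr_ge0// ?invr_ge0// invf_le1 ?ler1n.
rewrite !mulrA mulVf// !mul1r in h; apply: le_trans h _.
rewrite !powRM// !mulrA -powR_inv1// -powRD ?pnatr_eq0 ?implybT//.
by rewrite (addrC _ p) -mulrDr.
Qed.

Lemma integral_ge1 (R : realType) d (S : measurableType d) (mu : probability S R)
    (f : S -> R) : measurable_fun setT f -> (forall x, 1 <= f x) ->
  (1 <= \int[mu]_x (f x)%:E)%E.
Proof.
move=> mf f1; rewrite -[leLHS](integral_prob_cst mu 1%E).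
apply: ge0_le_integral => //; first exact/measurable_EFinP.
by move=> x _; rewrite lee_fin.
Qed.

Lemma adapted_wasserstein_le (R : realType) (T : nat) (X : 'I_T -> ptopologicalType)
  (d : prod_topology X -> prod_topology X -> R) (p : R)
  (mu nu : probability (borel (prod_topology X)) R)
  (gam : probability (borel (prod_topology X * prod_topology X)%type) R) :
  0 < p -> bicausal_couplings mu nu gam ->
  (poweR (adapted_wasserstein d p mu nu) p <= \int[gam]_z (d z.1 z.2 `^ p)%:E)%E.
Proof.
move=> p0 gamP.
have I0 : (0 <= \int[gam]_z (d z.1 z.2 `^ p)%:E)%E.
  by apply: integral_ge0 => z _; rewrite lee_fin powR_ge0.
rewrite -[leRHS]poweRe1// -[X in (_ <= _ `^ X)%E](mulVf (lt0r_neq0 p0)) poweRrM.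
apply: gt0_ler_poweR; rewrite ?(ltW p0)//.
- rewrite in_itv/= leey andbT; apply/ereal_infP => _ [g _ <-].
  exact: poweR_ge0.
- by rewrite in_itv/= leey andbT poweR_ge0.
- by apply: ge_ereal_inf; eexists; [exists gam|exact: lexx].
Qed.

Theorem corollary9 (R : realType) (T : nat) (hT : (1 <= T)%N)
  (X : 'I_T -> ptopologicalType) (hX : forall t : 'I_T, polish R (X t))
  (d : prod_topology X -> prod_topology X -> R)
  (hd : is_metric d) (hdtop : metrizes d)
  (p : R) (hp : 1 < p)
  (mu : probability (borel (prod_topology X)) R)
  (x0 : prod_topology X) (alpha : R) (halpha : 0 < alpha)
  (hexp : (\int[mu]_x (expR (alpha * d x x0 `^ (2 * p)))%:E < +oo)%E) :
  forall nu : probability (borel (prod_topology X)) R,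
    (poweR (adapted_wasserstein d p mu nu) p <=
     (2 `^ (p - 1) * (2 * Num.sqrt T%:R + 1) / Num.sqrt alpha)%:E
     * poweR (1 + lne (\int[mu]_x (expR (alpha * d x x0 `^ (2 * p)))%:E)) 2^-1
     * poweR (2%:E * relative_entropy nu mu) 2^-1)%E.
Proof.
move=> nu; have p0 : 0 < p by exact: lt_trans hp.
have [d0 dxx dC dT] := hd.
have mdx : measurable_fun setT ((fun x => d x x0) : borel (prod_topology X) -> R).
  exact: measurable_metric_pt.
have mdp q : measurable_fun setT ((fun x => d x x0 `^ q) : borel (prod_topology X) -> R).
  exact: (measurableT_comp (measurable_powR q) mdx).
have sa : 0 < Num.sqrt alpha by rewrite sqrtr_gt0.
have E1 : (1 <= \int[mu]_x (expR (alpha * d x x0 `^ (2 * p)))%:E)%E.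
  apply: integral_ge1 => [|x].
    by apply: measurableT_comp => //; apply: measurable_funM.
  by rewrite -expR0 ler_expR mulr_ge0 ?powR_ge0// ltW.
have [E EE] : exists E, (\int[mu]_x (expR (alpha * d x x0 `^ (2 * p)))%:E = E%:E)%E.
  exists (fine (\int[mu]_x (expR (alpha * d x x0 `^ (2 * p)))%:E)%E).
  by rewrite fineK// ge0_fin_numE// (le_trans _ E1)// lee_fin.
rewrite EE in E1 *; rewrite lee_fin in E1.
have L0 : 0 <= ln E by exact: ln_ge0.
have -> : lne E%:E = (ln E)%:E by rewrite /= leNgt (lt_le_trans ltr01 E1).
rewrite -EFinD poweR_EFin powR12_sqrt ?addr_ge0//.
set C := 2 `^ (p - 1) * _ / _.
have C0 : 0 < C.
  by rewrite divr_gt0// mulr_gt0 ?powR_gt0// ltr_wpDl ?mulr_ge0.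
have RHSy : relative_entropy nu mu = +oo%E ->
    (poweR (adapted_wasserstein d p mu nu) p <= C%:E * (Num.sqrt (1 + ln E))%:E *
     poweR (2%:E * relative_entropy nu mu) 2^-1)%E.
  move=> ->; rewrite gt0_muley ?lte_fin// poweRyr ?invr_eq0// -EFinM gt0_muley ?leey//.
  by rewrite lte_fin mulr_gt0// sqrtr_gt0 ltr_pwDl.
have [numu|nnumu] := pselect (nu `<< mu); last first.
  by apply: RHSy; rewrite /relative_entropy; case: pselect.
have nD := nnr_density numu.
have := RHSy; have H0 : (0 <= \int[mu]_x (entf (density mu nu x))%:E)%E.
  by apply: integral_ge0 => x _; exact: (nnm_EFin (nnr_entf nD)).2.
rewrite (relative_entropyE numu).
case EH : (\int[mu]_x (entf (density mu nu x))%:E)%E H0 => [H| |]//; last by move=> _ /(_ erefl).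
rewrite lee_fin => H0 _.
rewrite -(EFinM 2) poweR_EFin powR12_sqrt ?mulr_ge0// -!EFinM.
have [gam [c [gamP nc c1 cD [cH gam_cost]]]] := adapted_coupling hX hT numu.
apply: le_trans (adapted_wasserstein_le d p0 gamP) _.
pose f x : R := Num.sqrt alpha * d x x0 `^ p.
have nf : nnr (f : borel (prod_topology X) -> R).
  split=> [|x]; first by apply: measurable_funM.
  by rewrite mulr_ge0 ?powR_ge0// ltW.
have fE : (\int[mu]_x (expR (f x ^+ 2))%:E = E%:E)%E.
  rewrite -EE; apply: eq_integralT => x; congr (expR _)%:E.
  rewrite /f exprMn sqr_sqrtr ?(ltW halpha)//; congr (_ * _).
  by rewrite -powR_mulrn ?powR_ge0// -powRrM mulrC.
(* k * (f x + f y) bounds d x y `^ p, so g below is d `^ p rescaled to f x + f y. *)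
pose k := 2 `^ (p - 1) / Num.sqrt alpha.
have k0 : 0 < k by rewrite divr_gt0 ?powR_gt0.
pose g (z : borel (prod_topology X * prod_topology X)%type) := (k^-1 * d z.1 z.2 `^ p)%:E.
have mg : measurable_fun setT g.
  apply/measurable_EFinP/measurable_funM => //.
  exact: (measurableT_comp (measurable_powR p) (measurable_metric_pair hd hdtop)).
have g0 z : (0 <= g z)%E by rewrite lee_fin mulr_ge0 ?powR_ge0// invr_ge0 ltW.
have le_g : (\int[gam]_z g z <= ((2 * Num.sqrt T%:R + 1) * Num.sqrt (1 + ln E) * Num.sqrt (2 * H))%:E)%E.
  apply: le_trans (gam_cost g f _ nf _ _) _ => //.
  - by move=> x; rewrite /g /= (dxx x x).2// powR0 ?gt_eqF// mulr0.
  - move=> x y; rewrite /g /f /= lee_fin ler_pdivrMl//.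
    have -> : k * (Num.sqrt alpha * d x x0 `^ p + Num.sqrt alpha * d y x0 `^ p) =
        2 `^ (p - 1) * (d x x0 `^ p + d y x0 `^ p).
      by rewrite /k; field; rewrite gt_eqF.
    apply: le_trans (powR_add_le (ltW hp) (d0 x x0) (d0 y x0)).
    apply: ge0_ler_powR; rewrite ?nnegrE ?addr_ge0 ?d0 ?(ltW p0)//.
    by rewrite (dC y x0).
  - apply: (transport_bound nf fE nD nc c1 cD _ EH (cH _ EH)).
    rewrite -(integral_prob_cst nu 1%E) (integral_density numu); last by apply: nnm_cst; rewrite lee_fin.
    by apply: eq_integralT => x; rewrite mul1e.
have -> : (\int[gam]_z (d z.1 z.2 `^ p)%:E = k%:E * \int[gam]_z g z)%E.
  rewrite -ge0_integralZl//; last by rewrite lee_fin ltW.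
  by apply: eq_integralT => z; rewrite -EFinM mulrA divff ?mul1r// gt_eqF.
apply: le_trans (lee_wpmul2l _ le_g) _; first by rewrite lee_fin ltW.
rewrite -EFinM lee_fin /C /k le_eqVlt; apply/orP; left; apply/eqP.
by field; rewrite gt_eqF.
Qed.
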